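(* $$\gamma_2\left(\tfrac14\right)-\gamma_2\left(\tfrac34\right)=2\pi\left[\zeta''\left(0,\tfrac14\right)-\zeta''\left(0,\tfrac34\right)\right]-4\pi\left[\gamma+\log(8\pi)\right]\left[2\log\Gamma\left(\tfrac14\right)-\log\pi-\tfrac12\log 2\right]+\frac{\pi}{2}\left(2\left[\gamma+\log(8\pi)\right]^2+\frac{\pi^2}{6}\right).$$
   Context: For real $u>0$, $\zeta(s,u)$ is the Hurwitz zeta function (the meromorphic continuation in $s$ of $\sum_{n\ge 0}(n+u)^{-s}$), and $\zeta''(s,u)=\frac{\partial^2}{\partial s^2}\zeta(s,u)$. The generalised Stieltjes constants $\gamma_p(u)$, $p\ge 0$, are defined by the Laurent expansion about $s=1$: $\zeta(s,u)=\frac{1}{s-1}+\sum_{p=0}^\infty\frac{(-1)^p}{p!}\gamma_p(u)(s-1)^p$. $\gamma$ is Euler's constant, $\Gamma$ the gamma function and $\log$ the natural logarithm. *)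

(* Defs.v *)
From Stdlib Require Export Reals Factorial ClassicalEpsilon.
From Coquelicot Require Export Coquelicot.

Open Scope R_scope.

Definition euler_gamma : R :=
  real (Lim_seq (fun n => sum_n (fun k => / INR (k + 1)) n - ln (INR (n + 1)))).

(* Euler's integral over (0, +oo); used for x > 0 only. *)
Definition Gamma (x : R) : R :=
  RInt_gen (fun t => Rpower t (x - 1) * exp (- t))
    (at_right 0) (Rbar_locally p_infty).

Definition Cexp (z : C) : C :=
  (exp (Re z) * cos (Im z), exp (Re z) * sin (Im z)).

(* x^s with the real logarithm of the base; used for x > 0 only. *)
Definition Rcpow (x : R) (s : C) : C := Cexp (s * RtoC (ln x))%C.

Definition Cpseries (a : nat -> C) (z l : C) : Prop :=
  @is_pseries C_AbsRing C_NormedModule a z l.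

Definition analytic_at (f : C -> C) (z0 : C) : Prop :=
  exists (a : nat -> C) (r : posreal),
    forall z : C, Cmod (z - z0) < r -> Cpseries a (z - z0)%C (f z).

(* The value of f at z0 itself is irrelevant. *)
Definition meromorphic_at (f : C -> C) (z0 : C) : Prop :=
  exists (N : nat) (a : nat -> C) (r : posreal),
    forall z : C, 0 < Cmod (z - z0) < r ->
      Cpseries a (z - z0)%C ((z - z0) ^ N * f z)%C.

(* By the identity theorem this determines Z everywhere except at the pole
   s = 1, where the value of Z is unconstrained. *)
Definition is_hurwitz_zeta (u : R) (Z : C -> C) : Prop :=
  (forall s : C, 1 < Re s ->
     @is_series C_AbsRing C_NormedModule
       (fun n => Rcpow (INR n + u) (- s)%C) (Z s)) /\
  (forall s : C, s <> RtoC 1 -> analytic_at Z s) /\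
  meromorphic_at Z (RtoC 1).

Definition hurwitz_zeta (u : R) : C -> C :=
  epsilon (inhabits (fun _ : C => RtoC 0)) (is_hurwitz_zeta u).

Definition hurwitz_zeta'' (s : C) (u : R) : C :=
  C_derive (C_derive (hurwitz_zeta u)) s.

Definition is_stieltjes (u : R) (c : nat -> C) : Prop :=
  exists r : posreal,
    forall s : C, 0 < Cmod (s - 1) < r ->
      Cpseries (fun p => (RtoC (-1) ^ p / RtoC (INR (fact p)) * c p)%C)
        (s - 1)%C (hurwitz_zeta u s - 1 / (s - 1))%C.

Definition stieltjes (p : nat) (u : R) : C :=
  epsilon (inhabits (fun _ : nat => RtoC 0)) (is_stieltjes u) p.

(* Main.v *)
(* Write D(s) = zeta(s,1/4) - zeta(s,3/4). It satisfies the functional equation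
     D(1-t) = 4 (8 pi)^-t sin(pi t/2) Gamma(t) D(t),   0 < t < 1,
   and the identity is the comparison of the coefficients of t^2 in the expansions of both sides as t -> 0+: on the left this coefficient is (gamma_2(1/4) - gamma_2(3/4)) / 2, while on the right D(t) = 1/2 + t log(Gamma(1/4)/Gamma(3/4)) + D''(0) t^2/2 + O(t^3).

   The meromorphic continuation comes from Jensen's formula
     (s-1) zeta(s, b+1/2) = (pi/2) int_R (b+iy)^(1-s) / cosh^2(pi y) dy,   b > 0,
   whose right side E_b(s) is entire in s (expand the power under the integral sign) and satisfies E_b - E_(b+1) = (s-1)(b+1/2)^-s: shift the line Re z = 0 to Re z = 1 for f(b+z)/cos^2(pi z), after subtracting from f its Taylor polynomial at the pole. The same shift with 1/cos(pi z), followed by b -> 0+, gives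
     sum_n (-1)^n (n+1/2)^-t = cos(pi t/2) int_0^oo y^-t / cosh(pi y) dy,
   and expanding 1/cosh in powers of exp(-pi y) yields the functional equation. Applied twice it gives the reflection formula for Gamma, hence Gamma(1/4) Gamma(3/4) = pi sqrt 2 and Gamma''(1) = gamma^2 + pi^2/6; Gamma'(1) = -gamma follows from log-convexity.

   A function given by the definition of the Hurwitz zeta function agrees with this continuation near s = 1 (compare coefficients for real s > 1) and then on the real half-line s < 1, which is all that the derivatives at 0 and the Stieltjes constants depend on. *)

Require Import Defs.
From Stdlib Require Import Lra Lia Psatz.

(** * Integrals over the real line *)

(** No residue is ever computed. Subtracting the Taylor polynomial up to the order of the pole makes
    the integrand tend to 0 there, so the shifted integral has only boundary terms. The polynomial
    takes over the role of the residue: its linear part along the line is odd, and the total masses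
    of 1/cosh(pi y) and 1/cosh^2(pi y) are 1 and 2/pi.

    The square of the kernel takes the same values on both lines, so its recurrence telescopes to
    the zeta series. The first power changes sign and telescopes to an alternating series, and the
    offsets 1/4 and 3/4 are those of that series after halving. They are also the exponents 4k+1 and
    4k+3, divided by 4, in the expansion of 2q/(1+q^2).

    For 0 < t < 1 neither zeta series converges. Only differences over a half step have a limit,
    which is why D and not a single zeta function is treated there. As the functional equation is
    available only on 0 < t < 1, all coefficient comparisons are one-sided in t. *)

Definition dominated (f : R -> R) (M : R) : Prop :=
  (forall x, continuous f x) /\ forall x, Rabs (f x) <= M / (1 + x ^ 2).

(* Junk unless [f] is [dominated]: only then is the limit along [[-n, n]] shown to be the improper integral. *)
Definition II (f : R -> R) : R :=
  real (Lim_seq (fun n => RInt f (- INR n) (INR n))).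

Lemma real_derive_continuous (f : R -> R) (x : R) : ex_derive f x -> continuous f x.
Proof. apply (ex_derive_continuous (K := R_AbsRing) (V := R_NormedModule)). Qed.

Lemma is_lim_seq_scal_0 c u : is_lim_seq u 0 -> is_lim_seq (fun n => c * u n) 0.
Proof.
  intros H. replace (Finite 0) with (Finite (c * 0)) by (f_equal; ring).
  apply is_lim_seq_mult'; [apply is_lim_seq_const|exact H].
Qed.

Lemma continuous_ex_RInt (f : R -> R) a b : (forall x, continuous f x) -> ex_RInt f a b.
Proof. intros H; apply (ex_RInt_continuous (V := R_CompleteNormedModule)); intros; apply H. Qed.

Lemma dominated_nonneg f M : dominated f M -> 0 <= M.
Proof.
  intros [_ H]. specialize (H 0). pose proof (Rabs_pos (f 0)).
  replace (M / (1 + 0 ^ 2)) with M in H by field. lra.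
Qed.

Lemma dominated_ex_RInt f M a b : dominated f M -> ex_RInt f a b.
Proof. intros H; apply continuous_ex_RInt; apply H. Qed.

Lemma is_RInt_atan M a b :
  is_RInt (fun x => M / (1 + x ^ 2)) a b (M * atan b - M * atan a).
Proof.
  apply (is_RInt_derive (fun x => M * atan x) (fun x => M / (1 + x ^ 2))).
  - intros x _. auto_derive; trivial. field. nra.
  - intros x _. apply (real_derive_continuous).
    auto_derive. nra.
Qed.

Lemma RInt_atan_bound f M a b : dominated f M -> a <= b ->
  Rabs (RInt f a b) <= M * (atan b - atan a).
Proof.
  intros H Hab.
  apply Rle_trans with (M * atan b - M * atan a); [|lra].
  apply (norm_RInt_le (V := R_NormedModule) f (fun x => M / (1 + x ^ 2)) a b); trivial.
  - intros x _. apply H.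
  - apply (RInt_correct (V := R_CompleteNormedModule)), (dominated_ex_RInt f M), H.
  - apply is_RInt_atan.
Qed.

Lemma atan_lim : is_lim_seq (fun n => atan (INR n)) (PI / 2).
Proof.
  apply is_lim_seq_spec. intros eps.
  pose proof PI_RGT_0.
  set (e := Rmin eps (PI / 2)).
  assert (He : 0 < e) by (apply Rmin_pos; [apply cond_pos|lra]).
  assert (He2 : e <= PI / 2) by apply Rmin_r.
  assert (He3 : e <= eps) by apply Rmin_l.
  destruct (INR_unbounded (tan (PI / 2 - e))) as [N HN].
  exists N; intros n Hn.
  assert (INR N <= INR n) by (apply le_INR; lia).
  assert (PI / 2 - e < atan (INR n)).
  { rewrite <- (atan_tan (PI / 2 - e)) by lra. apply atan_increasing. lra. }
  pose proof (atan_bound (INR n)).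
  rewrite Rabs_left by lra. lra.
Qed.

Lemma RInt_split f a b c : (forall x, continuous f x) ->
  RInt f a c = RInt f a b + RInt f b c.
Proof.
  intros H. symmetry.
  apply (RInt_Chasles (V := R_CompleteNormedModule) f a b c); apply continuous_ex_RInt, H.
Qed.

Lemma II_cauchy_aux f M a b n : dominated f M -> - INR n <= a -> b <= INR n ->
  Rabs (RInt f (- INR n) (INR n) - RInt f a b)
  <= M * (PI / 2 - atan b) + M * (PI / 2 + atan a).
Proof.
  intros H Ha Hb.
  pose proof (dominated_nonneg _ _ H) as HM.
  rewrite (RInt_split f (- INR n) a (INR n)) by apply H.
  rewrite (RInt_split f a b (INR n)) by apply H.
  pose proof (RInt_atan_bound f M (- INR n) a H Ha) as H1.
  pose proof (RInt_atan_bound f M b (INR n) H Hb) as H2.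
  replace (RInt f (- INR n) a + (RInt f a b + RInt f b (INR n)) - RInt f a b)
    with (RInt f (- INR n) a + RInt f b (INR n)) by ring.
  eapply Rle_trans; [apply Rabs_triang|].
  pose proof (atan_bound (INR n)). pose proof (atan_bound (- INR n)).
  nra.
Qed.

Lemma II_lim f M : dominated f M ->
  is_lim_seq (fun n => RInt f (- INR n) (INR n)) (II f).
Proof.
  intros H. apply Lim_seq_correct'. apply ex_lim_seq_cauchy_corr.
  intros eps.
  pose proof (dominated_nonneg _ _ H) as HM.
  pose proof atan_lim as HL. apply is_lim_seq_spec in HL.
  assert (He : 0 < eps / (2 * M + 1)) by (apply Rdiv_lt_0_compat; [apply cond_pos|lra]).
  destruct (HL (mkposreal _ He)) as [N HN]. simpl in HN.
  assert (key : forall n m, (N <= n)%nat -> (n <= m)%nat ->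
    Rabs (RInt f (- INR m) (INR m) - RInt f (- INR n) (INR n)) < eps).
  { intros n m Hn Hm.
    assert (INR n <= INR m) by (apply le_INR; lia).
    eapply Rle_lt_trans; [apply (II_cauchy_aux f M); trivial; lra|].
    specialize (HN n Hn). rewrite atan_opp. apply Rabs_def2 in HN.
    assert (E : eps / (2 * M + 1) * (2 * M + 1) = eps) by (field; lra).
    assert (PI / 2 - atan (INR n) < eps / (2 * M + 1)) by lra.
    pose proof (cond_pos eps). 
    set (q := eps / (2 * M + 1)) in *.
    nra. }
  exists N; intros n m Hn Hm.
  destruct (Nat.le_ge_cases n m) as [h|h].
  - rewrite Rabs_minus_sym. apply key; lia.
  - apply key; lia.
Qed.

Lemma II_unique f M (l : R) : dominated f M ->
  is_lim_seq (fun n => RInt f (- INR n) (INR n)) l -> II f = l.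
Proof.
  intros H Hl. unfold II. rewrite (is_lim_seq_unique _ _ Hl). reflexivity.
Qed.

(** The majorant has the primitive [M * atan], so both tails are explicit and depend on [f] through
    [M] alone. The uniform limits in a parameter rest on this. *)
Lemma II_tail f M a b : dominated f M ->
  Rabs (II f - RInt f a b) <= M * (PI / 2 - atan b) + M * (PI / 2 + atan a).
Proof.
  intros H.
  destruct (INR_unbounded (- a)) as [N1 HN1]. destruct (INR_unbounded b) as [N2 HN2].
  refine (is_lim_seq_le_loc (fun n => Rabs (RInt f (- INR n) (INR n) - RInt f a b)) _
    (Finite (Rabs (II f - RInt f a b))) (Finite _) _ _ (is_lim_seq_const _)).
  2: { apply (is_lim_seq_abs _ (Finite _)). eapply is_lim_seq_minus'.
       apply (II_lim f M H). apply is_lim_seq_const. }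
  exists (N1 + N2)%nat. intros n Hn.
  assert (INR N1 <= INR n) by (apply le_INR; lia).
  assert (INR N2 <= INR n) by (apply le_INR; lia).
  apply II_cauchy_aux; trivial; lra.
Qed.

Lemma II_bound f M : dominated f M -> Rabs (II f) <= M * PI.
Proof.
  intros H. pose proof (II_tail f M 0 0 H) as H1.
  rewrite RInt_point, atan_0 in H1. unfold zero in H1; simpl in H1.
  rewrite Rminus_0_r in H1. lra.
Qed.

Lemma II_lim_gen f M (a b : nat -> R) : dominated f M ->
  is_lim_seq (fun n => atan (a n)) (- (PI / 2)) ->
  is_lim_seq (fun n => atan (b n)) (PI / 2) ->
  is_lim_seq (fun n => RInt f (a n) (b n)) (II f).
Proof.
  intros H Ha Hb.
  apply is_lim_seq_ext with (fun n => II f + - (II f - RInt f (a n) (b n))).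
  { intros; ring. }
  replace (Finite (II f)) with (Finite (II f + 0)) by (f_equal; ring).
  apply is_lim_seq_plus'; [apply is_lim_seq_const|].
  apply is_lim_seq_abs_0.
  apply is_lim_seq_le_le with (fun _ => 0)
    (fun n => M * (PI / 2 - atan (b n)) + M * (PI / 2 + atan (a n))).
  - intros n; split; [apply Rabs_pos|]. rewrite Rabs_Ropp. apply II_tail, H.
  - apply is_lim_seq_const.
  - replace (Finite 0) with (Finite (M * (PI / 2 - PI / 2) + M * (PI / 2 + - (PI / 2))))
      by (f_equal; ring).
    apply is_lim_seq_plus'; apply is_lim_seq_mult'; try apply is_lim_seq_const.
    + apply is_lim_seq_minus'; trivial. apply is_lim_seq_const.
    + apply is_lim_seq_plus'; trivial. apply is_lim_seq_const.
Qed.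

Lemma II_ext f g : (forall x, f x = g x) -> II f = II g.
Proof.
  intros H. unfold II. f_equal. apply Lim_seq_ext. intros n. apply RInt_ext. auto.
Qed.

Lemma dominated_ext f g M : (forall x, f x = g x) -> dominated f M -> dominated g M.
Proof.
  intros E [H1 H2]; split; intros x.
  - apply (continuous_ext f); auto.
  - rewrite <- E; apply H2.
Qed.

Lemma dominated_plus f g M N : dominated f M -> dominated g N ->
  dominated (fun x => f x + g x) (M + N).
Proof.
  intros [H1 H2] [H3 H4]; split; intros x.
  - apply (continuous_plus (V := R_NormedModule) f g); auto.
  - eapply Rle_trans; [apply Rabs_triang|].
    unfold Rdiv; rewrite Rmult_plus_distr_r. apply Rplus_le_compat; auto.
Qed.

Lemma dominated_scal f M c : dominated f M -> dominated (fun x => c * f x) (Rabs c * M).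
Proof.
  intros [H1 H2]; split; intros x.
  - apply (continuous_scal_r (V := R_NormedModule) c f); auto.
  - rewrite Rabs_mult. unfold Rdiv; rewrite Rmult_assoc.
    apply Rmult_le_compat_l; [apply Rabs_pos|apply H2].
Qed.

Lemma II_plus f g M N : dominated f M -> dominated g N ->
  II (fun x => f x + g x) = II f + II g.
Proof.
  intros H1 H2. apply (II_unique _ (M + N)); [apply dominated_plus; trivial|].
  apply is_lim_seq_ext with
    (fun n => RInt f (- INR n) (INR n) + RInt g (- INR n) (INR n)).
  - intros n. symmetry.
    apply (RInt_plus (V := R_CompleteNormedModule) f g); eapply dominated_ex_RInt; eassumption.
  - apply is_lim_seq_plus'; eapply II_lim; eassumption.
Qed.

Lemma II_scal f M c : dominated f M -> II (fun x => c * f x) = c * II f.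
Proof.
  intros H. apply (II_unique _ (Rabs c * M)); [apply dominated_scal; trivial|].
  apply is_lim_seq_ext with (fun n => c * RInt f (- INR n) (INR n)).
  - intros n. symmetry.
    apply (RInt_scal (V := R_CompleteNormedModule) f); eapply dominated_ex_RInt; eassumption.
  - apply is_lim_seq_mult'; [apply is_lim_seq_const|]. eapply II_lim; eassumption.
Qed.

Lemma II_minus f g M N : dominated f M -> dominated g N ->
  II (fun x => f x - g x) = II f - II g.
Proof.
  intros H1 H2.
  rewrite (II_ext _ (fun x => f x + (-1) * g x)) by (intros; ring).
  rewrite (II_plus _ _ M (Rabs (-1) * N)); trivial; [|apply dominated_scal; trivial].
  rewrite (II_scal _ N) by trivial. ring.
Qed.

Lemma II_le f g M N : dominated f M -> dominated g N -> (forall x, f x <= g x) ->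
  II f <= II g.
Proof.
  intros H1 H2 H.
  apply (is_lim_seq_le (fun n => RInt f (- INR n) (INR n)) (fun n => RInt g (- INR n) (INR n))
    (Finite (II f)) (Finite (II g))).
  - intros n. pose proof (pos_INR n). apply RInt_le; trivial; try lra.
    eapply dominated_ex_RInt; eassumption. eapply dominated_ex_RInt; eassumption. auto.
  - eapply II_lim; eassumption.
  - eapply II_lim; eassumption.
Qed.

Lemma II_shift f M N a : dominated f M -> dominated (fun x => f (x + a)) N ->
  II (fun x => f (x + a)) = II f.
Proof.
  intros H H'. apply (II_unique _ N _ H').
  apply is_lim_seq_ext with (fun n => RInt f (- INR n + a) (INR n + a)).
  { intros n. rewrite <- (RInt_comp (V := R_CompleteNormedModule) f (fun x => x + a) (fun _ => 1)).
    - apply RInt_ext; intros. unfold scal; simpl; unfold mult; simpl. ring.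
    - intros; apply H.
    - intros; split; [auto_derive; trivial; ring| apply continuous_const]. }
  (* A translation moves an endpoint inwards by at most |a|, so this one estimate serves both
     ends. *)
  assert (G : forall eps : posreal, exists N0, forall n, (N0 <= n)%nat ->
      PI / 2 - eps < atan (INR n - Rabs a)).
  { intros eps. pose proof atan_lim as HL. apply is_lim_seq_spec in HL.
    destruct (HL eps) as [N0 HN0].
    destruct (INR_unbounded (Rabs a)) as [N1 HN1].
    exists (N0 + N1)%nat. intros n Hn.
    specialize (HN0 (n - N1)%nat ltac:(lia)). apply Rabs_def2 in HN0.
    rewrite minus_INR in HN0 by lia.
    assert (atan (INR n - INR N1) < atan (INR n - Rabs a)) by (apply atan_increasing; lra).
    lra. }
  apply (II_lim_gen f M); trivial.
  - apply is_lim_seq_spec. intros eps. destruct (G eps) as [N0 HN0]. exists N0. intros n Hn.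
    specialize (HN0 n Hn). replace (- INR n + a) with (- (INR n - a)) by ring.
    rewrite atan_opp. pose proof (atan_bound (INR n - a)).
    pose proof (Rle_abs a).
    assert (atan (INR n - Rabs a) <= atan (INR n - a)).
    { destruct (Req_dec a (Rabs a)) as [<-|]; [lra|]. left; apply atan_increasing; lra. }
    apply Rabs_def1; lra.
  - apply is_lim_seq_spec. intros eps. destruct (G eps) as [N0 HN0]. exists N0. intros n Hn.
    specialize (HN0 n Hn). pose proof (atan_bound (INR n + a)).
    pose proof (Rle_abs (- a)). rewrite Rabs_Ropp in *.
    assert (atan (INR n - Rabs a) <= atan (INR n + a)).
    { destruct (Req_dec (- a) (Rabs a)) as [h|h]; [right; f_equal; lra|]. left; apply atan_increasing; lra. }
    apply Rabs_def1; lra.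
Qed.

Lemma RInt_odd (f : R -> R) n : (forall x, continuous f x) -> (forall x, f (- x) = - f x) ->
  RInt f (- n) n = 0.
Proof.
  intros Hc Ho.
  assert (E0 : forall y, f y = -1 * f (- y)) by (intros; rewrite Ho; ring).
  assert (E : RInt f (- n) n = - RInt f (- n) n).
  { transitivity (RInt (fun y => scal (-1) (f (- y))) n (- n)).
    - rewrite (RInt_comp (V := R_CompleteNormedModule) f (fun x => - x) (fun _ => -1)).
      + f_equal; ring.
      + intros; apply Hc.
      + intros; split; [auto_derive; trivial; ring| apply continuous_const].
    - rewrite <- (opp_RInt_swap (V := R_CompleteNormedModule)) by
        (apply continuous_ex_RInt; intros;
         apply (continuous_ext f); [exact E0|apply Hc]).
      unfold opp; simpl. f_equal. apply RInt_ext. intros y _. rewrite Ho.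
      unfold scal; simpl; unfold mult; simpl. ring. }
  lra.
Qed.

Lemma II_FTC f F M (l1 l2 : R) : dominated f M ->
  (forall x, is_derive F x (f x)) ->
  is_lim_seq (fun n => F (INR n)) l1 -> is_lim_seq (fun n => F (- INR n)) l2 ->
  II f = l1 - l2.
Proof.
  intros H HF H1 H2. apply (II_unique _ M _ H).
  apply is_lim_seq_ext with (fun n => F (INR n) - F (- INR n)).
  - intros n. symmetry. apply (is_RInt_unique (V := R_CompleteNormedModule)).
    apply (is_RInt_derive (V := R_CompleteNormedModule) F f); intros; [apply HF|apply H].
  - apply is_lim_seq_minus'; trivial.
Qed.

Lemma RInt_param_continuous (F : R -> R -> R) a b c : a <= b ->
  (forall y, a <= y <= b -> continuity_2d_pt F c y) ->
  locally c (fun x => ex_RInt (F x) a b) ->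
  continuous (fun x => RInt (F x) a b) c.
Proof.
  intros Hab HF Hex.
  apply continuity_pt_filterlim. apply continuity_pt_locally. intros eps.
  assert (He : 0 < eps / (b - a + 1)) by (apply Rdiv_lt_0_compat; [apply cond_pos|lra]).
  destruct (uniform_continuity_2d_1d' F a b c HF (mkposreal _ He)) as [d Hd].
  simpl in Hd.
  destruct Hex as [d1 Hex].
  assert (Hm : 0 < Rmin d d1) by (apply Rmin_pos; apply cond_pos).
  exists (mkposreal _ Hm). intros x Hx. simpl in Hx.
  unfold ball in Hx; simpl in Hx; unfold AbsRing_ball, abs, minus, plus, opp in Hx; simpl in Hx.
  assert (Hx1 : Rabs (x + - c) < d) by (eapply Rlt_le_trans; [apply Hx|apply Rmin_l]).
  assert (Hx2 : Rabs (x + - c) < d1) by (eapply Rlt_le_trans; [apply Hx|apply Rmin_r]).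
  assert (E1 : ex_RInt (F x) a b) by (apply Hex; exact Hx2).
  assert (E2 : ex_RInt (F c) a b) by (apply Hex; apply ball_center).
  rewrite <- (RInt_minus (V := R_CompleteNormedModule) (F x) (F c)) by trivial.
  eapply Rle_lt_trans.
  - apply (abs_RInt_le_const _ a b (eps / (b - a + 1))); trivial.
    + apply (ex_RInt_minus (V := R_NormedModule)); trivial.
    + intros y Hy. left. unfold minus, plus, opp; simpl.
      apply Rabs_def2 in Hx1. pose proof (cond_pos d).
      apply Hd; trivial; try lra. rewrite Rminus_diag, Rabs_R0; trivial.
  - assert (E : eps / (b - a + 1) * (b - a + 1) = eps) by (field; lra). nra.
Qed.

Lemma II_param_continuous (F : R -> R -> R) c M d : 0 < d ->
  (forall x, Rabs (x - c) < d -> dominated (F x) M) ->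
  (forall y, continuity_2d_pt F c y) ->
  continuous (fun x => II (F x)) c.
Proof.
  intros Hd Hdom Hc.
  assert (Hcc : dominated (F c) M) by (apply Hdom; rewrite Rminus_diag, Rabs_R0; trivial).
  pose proof (dominated_nonneg _ _ Hcc) as HM.
  apply continuity_pt_filterlim. apply continuity_pt_locally. intros eps.
  (* Each tail is at most [M] times this number, so the two tails together stay below eps / 3. The
     tails at [x], the tails at [c] and the change on the compact part each receive a third. *)
  assert (He : 0 < eps / (6 * (M + 1))) by (apply Rdiv_lt_0_compat; [apply cond_pos|lra]).
  pose proof atan_lim as HL. apply is_lim_seq_spec in HL.
  destruct (HL (mkposreal _ He)) as [n Hn]. specialize (Hn n (Nat.le_refl n)). simpl in Hn.
  apply Rabs_def2 in Hn.
  assert (E : eps / (6 * (M + 1)) * (6 * (M + 1)) = eps) by (field; lra).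
  set (q := eps / (6 * (M + 1))) in *.
  assert (T : forall x, Rabs (x - c) < d -> Rabs (II (F x) - RInt (F x) (- INR n) (INR n)) < eps / 3).
  { intros x Hx. eapply Rle_lt_trans; [apply (II_tail _ M), Hdom, Hx|].
    rewrite atan_opp. pose proof (cond_pos eps). nra. }
  pose proof (pos_INR n) as Hpn.
  assert (Hcont : continuous (fun x => RInt (F x) (- INR n) (INR n)) c).
  { apply RInt_param_continuous; try lra; auto.
    exists (mkposreal d Hd). intros x Hx. eapply dominated_ex_RInt. apply Hdom. exact Hx. }
  apply continuity_pt_filterlim in Hcont.
  assert (He3 : 0 < eps / 3) by (pose proof (cond_pos eps); lra).
  apply (proj1 (continuity_pt_locally _ _)) with (eps := mkposreal _ He3) in Hcont.
  destruct Hcont as [d1 Hd1]. simpl in Hd1.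
  assert (Hm : 0 < Rmin d d1) by (apply Rmin_pos; trivial; apply cond_pos).
  exists (mkposreal _ Hm). intros x Hx. simpl in Hx.
  unfold ball in Hx; simpl in Hx; unfold AbsRing_ball, abs, minus, plus, opp in Hx; simpl in Hx.
  assert (Hx1 : Rabs (x - c) < d) by (eapply Rlt_le_trans; [apply Hx|apply Rmin_l]).
  assert (Hx2 : Rabs (x + - c) < d1) by (eapply Rlt_le_trans; [apply Hx|apply Rmin_r]).
  specialize (Hd1 x Hx2).
  pose proof (T x Hx1) as T1.
  assert (T2 := T c ltac:(rewrite Rminus_diag, Rabs_R0; trivial)).
  apply Rabs_def2 in T1. apply Rabs_def2 in T2. apply Rabs_def2 in Hd1.
  apply Rabs_def1; lra.
Qed.

(** * Complex differentiation *)

Lemma im_le_Cmod (c : C) : Rabs (Im c) <= Cmod c.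
Proof. eapply Rle_trans; [apply Rmax_r|apply Rmax_Cmod]. Qed.

Lemma Cmod_le_re_im (c : C) : Cmod c <= Rabs (Re c) + Rabs (Im c).
Proof.
  apply Rsqr_incr_0_var.
  - unfold Cmod. rewrite Rsqr_sqrt by nra. unfold Rsqr.
    replace (fst c ^ 2) with (Rabs (Re c) * Rabs (Re c)).
    2: { rewrite <- Rabs_mult, Rabs_right; [unfold Re; ring|unfold Re; nra]. }
    replace (snd c ^ 2) with (Rabs (Im c) * Rabs (Im c)).
    2: { rewrite <- Rabs_mult, Rabs_right; [unfold Im; ring|unfold Im; nra]. }
    pose proof (Rabs_pos (Re c)). pose proof (Rabs_pos (Im c)). nra.
  - pose proof (Rabs_pos (Re c)). pose proof (Rabs_pos (Im c)). lra.
Qed.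

Lemma Cmod_triangle_inv (a b : C) : Cmod a - Cmod b <= Cmod (a - b).
Proof.
  pose proof (Cmod_triangle (a - b) b).
  replace (a - b + b)%C with a in H by ring. lra.
Qed.

Lemma Cmod_sub_sym (a b : C) : Cmod (a - b) = Cmod (b - a).
Proof. rewrite <- Cmod_opp. f_equal. ring. Qed.

Lemma C_eta (z : C) : z = (Re z, Im z).
Proof. destruct z; reflexivity. Qed.

Definition Ccont (f : C -> C) (z : C) : Prop :=
  forall eps, 0 < eps -> exists d, 0 < d /\
    forall z', Cmod (z' - z) < d -> Cmod (f z' - f z) < eps.

(* Caratheodory's form of the derivative: with it the chain, product and inverse rules are algebra. *)
Definition Cdiff (f : C -> C) (z l : C) : Prop :=
  exists phi : C -> C, phi z = l /\ Ccont phi z /\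
    exists d, 0 < d /\ forall z', Cmod (z' - z) < d ->
      (f z' - f z = phi z' * (z' - z))%C.

Lemma Ccont_const c z : Ccont (fun _ => c) z.
Proof.
  intros e He. exists 1; split; [lra|]. intros z' _.
  replace (c - c)%C with (RtoC 0) by ring. rewrite Cmod_0. trivial.
Qed.

Lemma Ccont_id z : Ccont (fun z => z) z.
Proof. intros e He. exists e; auto. Qed.

Lemma Ccont_ext f g z : (forall w, f w = g w) -> Ccont f z -> Ccont g z.
Proof.
  intros E H e He. destruct (H e He) as [d [Hd H']]. exists d; split; trivial.
  intros; rewrite <- !E; auto.
Qed.

Lemma Ccont_ext_loc f g z d : 0 < d -> (forall w, Cmod (w - z) < d -> f w = g w) ->
  Ccont f z -> Ccont g z.
Proof.
  intros Hd E H e He. destruct (H e He) as [d' [Hd' H']].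
  exists (Rmin d d'); split; [apply Rmin_pos; trivial|].
  intros w Hw. rewrite <- !E; trivial.
  - apply H'. eapply Rlt_le_trans; [apply Hw|apply Rmin_r].
  - replace (z - z)%C with (RtoC 0) by ring. rewrite Cmod_0. trivial.
  - eapply Rlt_le_trans; [apply Hw|apply Rmin_l].
Qed.

Lemma Ccont_plus f g z : Ccont f z -> Ccont g z -> Ccont (fun z => f z + g z)%C z.
Proof.
  intros H1 H2 e He.
  destruct (H1 (e / 2) ltac:(lra)) as [d1 [Hd1 H1']].
  destruct (H2 (e / 2) ltac:(lra)) as [d2 [Hd2 H2']].
  exists (Rmin d1 d2); split; [apply Rmin_pos; trivial|]. intros w Hw.
  replace (f w + g w - (f z + g z))%C with ((f w - f z) + (g w - g z))%C by ring.
  eapply Rle_lt_trans; [apply Cmod_triangle|].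
  specialize (H1' w ltac:(eapply Rlt_le_trans; [apply Hw|apply Rmin_l])).
  specialize (H2' w ltac:(eapply Rlt_le_trans; [apply Hw|apply Rmin_r])). lra.
Qed.

Lemma Ccont_mult f g z : Ccont f z -> Ccont g z -> Ccont (fun z => f z * g z)%C z.
Proof.
  intros H1 H2 e He.
  pose proof (Cmod_ge_0 (f z)) as F0. pose proof (Cmod_ge_0 (g z)) as G0.
  set (M := Cmod (f z) + Cmod (g z) + 1).
  assert (HM : 1 <= M) by (unfold M; lra).
  set (q := Rmin 1 (e / (2 * M))).
  assert (Hq : 0 < q) by (apply Rmin_pos; [lra|apply Rdiv_lt_0_compat; lra]).
  assert (Hq1 : q <= 1) by apply Rmin_l.
  assert (Hq2 : q * (2 * M) <= e).
  { replace e with (e / (2 * M) * (2 * M)) by (field; lra).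
    apply Rmult_le_compat_r; [lra|apply Rmin_r]. }
  destruct (H1 q Hq) as [d1 [Hd1 H1']].
  destruct (H2 q Hq) as [d2 [Hd2 H2']].
  exists (Rmin d1 d2); split; [apply Rmin_pos; trivial|]. intros w Hw.
  replace (f w * g w - f z * g z)%C with
    ((f w - f z) * (g w - g z) + (f w - f z) * g z + f z * (g w - g z))%C by ring.
  specialize (H1' w ltac:(eapply Rlt_le_trans; [apply Hw|apply Rmin_l])).
  specialize (H2' w ltac:(eapply Rlt_le_trans; [apply Hw|apply Rmin_r])).
  eapply Rle_lt_trans; [apply Cmod_triangle|].
  eapply Rle_lt_trans; [apply Rplus_le_compat_r, Cmod_triangle|].
  rewrite !Cmod_mult.
  pose proof (Cmod_ge_0 (f w - f z)). pose proof (Cmod_ge_0 (g w - g z)).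
  set (A := Cmod (f w - f z)) in *. set (B := Cmod (g w - g z)) in *.
  assert (A * B <= q * 1) by (apply Rmult_le_compat; lra).
  assert (A * Cmod (g z) <= q * Cmod (g z)) by (apply Rmult_le_compat_r; lra).
  assert (Cmod (f z) * B <= Cmod (f z) * q) by (apply Rmult_le_compat_l; lra).
  assert (q * 1 + q * Cmod (g z) + Cmod (f z) * q = q * M) by (unfold M; ring).
  nra.
Qed.

Lemma Ccont_comp f g z : Ccont f (g z) -> Ccont g z -> Ccont (fun z => f (g z)) z.
Proof.
  intros H1 H2 e He. destruct (H1 e He) as [d [Hd H1']].
  destruct (H2 d Hd) as [d' [Hd' H2']]. exists d'; split; auto.
Qed.

Lemma Ccont_neq_0 f z : Ccont f z -> f z <> RtoC 0 ->
  exists d, 0 < d /\ forall z', Cmod (z' - z) < d -> Cmod (f z) / 2 < Cmod (f z').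
Proof.
  intros H Hf. apply Cmod_gt_0 in Hf.
  destruct (H (Cmod (f z) / 2) ltac:(lra)) as [d [Hd Hd']]. exists d; split; trivial.
  intros z' Hz'. specialize (Hd' z' Hz').
  pose proof (Cmod_triangle_inv (f z) (f z')). rewrite Cmod_sub_sym in H0. lra.
Qed.

Lemma Ccont_inv f z : Ccont f z -> f z <> RtoC 0 -> Ccont (fun z => / f z)%C z.
Proof.
  intros H Hf e He.
  destruct (Ccont_neq_0 f z H Hf) as [d1 [Hd1 H1]].
  pose proof (proj1 (Cmod_gt_0 _) Hf) as Hp. set (m := Cmod (f z)) in *.
  destruct (H (e * m * m / 2)) as [d2 [Hd2 H2]].
  { assert (0 < m * m) by nra. assert (0 < e * (m * m)) by nra. nra. }
  exists (Rmin d1 d2); split; [apply Rmin_pos; trivial|]. intros w Hw.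
  specialize (H1 w ltac:(eapply Rlt_le_trans; [apply Hw|apply Rmin_l])).
  specialize (H2 w ltac:(eapply Rlt_le_trans; [apply Hw|apply Rmin_r])).
  assert (Hfw : f w <> RtoC 0) by (apply Cmod_gt_0; lra).
  replace (/ f w - / f z)%C with ((f z - f w) / (f w * f z))%C by (field; auto).
  assert (Hn : (f w * f z)%C <> RtoC 0) by (apply Cmult_neq_0; trivial).
  rewrite Cmod_div, Cmod_mult by trivial. fold m. rewrite Cmod_sub_sym.
  apply Rmult_lt_reg_r with (Cmod (f w) * m); [nra|].
  unfold Rdiv. rewrite Rmult_assoc, Rinv_l, Rmult_1_r by nra.
  eapply Rlt_trans; [apply H2|].
  assert (0 < e * m) by nra. nra.
Qed.

Lemma Cdiff_Ccont f z l : Cdiff f z l -> Ccont f z.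
Proof.
  intros [phi [Hl [Hc [d [Hd H]]]]].
  assert (H0 : Ccont (fun z' => phi z' * (z' - z) + f z)%C z).
  { apply Ccont_plus; [|apply Ccont_const]. apply Ccont_mult; trivial.
    apply (Ccont_plus (fun z => z)); [apply Ccont_id|apply Ccont_const]. }
  apply (Ccont_ext_loc _ f z d Hd) in H0; trivial.
  intros w Hw. rewrite <- H by trivial. ring.
Qed.

Lemma Cdiff_ext f g z l : (forall w, f w = g w) -> Cdiff f z l -> Cdiff g z l.
Proof.
  intros E [phi [Hl [Hc [d [Hd H]]]]]. exists phi; do 2 (split; trivial).
  exists d; split; trivial. intros; rewrite <- !E; auto.
Qed.

Lemma Cdiff_eq f z l l' : l = l' -> Cdiff f z l -> Cdiff f z l'.
Proof. intros ->; trivial. Qed.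

Lemma Cdiff_const c z : Cdiff (fun _ => c) z (RtoC 0).
Proof.
  exists (fun _ => RtoC 0); split; trivial. split; [apply Ccont_const|].
  exists 1; split; [lra|]. intros; ring.
Qed.

Lemma Cdiff_id z : Cdiff (fun z => z) z (RtoC 1).
Proof.
  exists (fun _ => RtoC 1); split; trivial. split; [apply Ccont_const|].
  exists 1; split; [lra|]. intros; ring.
Qed.

Lemma Cdiff_plus f g z l m : Cdiff f z l -> Cdiff g z m ->
  Cdiff (fun z => f z + g z)%C z (l + m)%C.
Proof.
  intros [p [Hl [Hc [d [Hd H]]]]] [p' [Hl' [Hc' [d' [Hd' H']]]]].
  exists (fun z => p z + p' z)%C; split; [congruence|]. split; [apply Ccont_plus; trivial|].
  exists (Rmin d d'); split; [apply Rmin_pos; trivial|]. intros w Hw.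
  rewrite Cmult_plus_distr_r, <- H, <- H'; [ring| |];
    (eapply Rlt_le_trans; [apply Hw|]); [apply Rmin_r|apply Rmin_l].
Qed.

Lemma Cdiff_mult f g z l m : Cdiff f z l -> Cdiff g z m ->
  Cdiff (fun z => f z * g z)%C z (l * g z + f z * m)%C.
Proof.
  intros Hf Hg. pose proof (Cdiff_Ccont _ _ _ Hg) as Cg.
  destruct Hf as [p [Hl [Hc [d [Hd H]]]]]. destruct Hg as [p' [Hl' [Hc' [d' [Hd' H']]]]].
  exists (fun w => p w * g w + f z * p' w)%C; split; [rewrite Hl, Hl'; trivial|].
  split; [apply Ccont_plus; apply Ccont_mult; trivial; apply Ccont_const|].
  exists (Rmin d d'); split; [apply Rmin_pos; trivial|]. intros w Hw.
  replace ((p w * g w + f z * p' w) * (w - z))%C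
    with (p w * (w - z) * g w + f z * (p' w * (w - z)))%C by ring.
  rewrite <- H, <- H'; [ring| |];
    (eapply Rlt_le_trans; [apply Hw|]); [apply Rmin_r|apply Rmin_l].
Qed.

Lemma Cdiff_scal c f z l : Cdiff f z l -> Cdiff (fun z => c * f z)%C z (c * l)%C.
Proof.
  intros H. eapply Cdiff_eq; [|apply Cdiff_mult; [apply Cdiff_const|apply H]]. cbv beta; ring.
Qed.

Lemma Cdiff_minus f g z l m : Cdiff f z l -> Cdiff g z m ->
  Cdiff (fun z => f z - g z)%C z (l - m)%C.
Proof.
  intros Hf Hg. apply (Cdiff_scal (- (1))%C) in Hg.
  apply (Cdiff_ext (fun z => f z + - (1) * g z)%C); [intros; ring|].
  eapply Cdiff_eq; [|apply Cdiff_plus; eassumption]. ring.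
Qed.

Lemma Cdiff_inv f z l : Cdiff f z l -> f z <> RtoC 0 ->
  Cdiff (fun z => / f z)%C z (- l / (f z * f z))%C.
Proof.
  intros Hf Hn. pose proof (Cdiff_Ccont _ _ _ Hf) as Cf.
  destruct Hf as [p [Hl [Hc [d [Hd H]]]]].
  destruct (Ccont_neq_0 _ _ Cf Hn) as [d' [Hd' H']].
  exists (fun w => (- (1)) * p w * / (f w * f z))%C; split.
  { rewrite Hl. unfold Cdiv. ring. }
  split.
  { apply Ccont_mult; [apply Ccont_mult; [apply Ccont_const|trivial]|].
    apply (Ccont_inv (fun w => f w * f z)%C).
    - apply Ccont_mult; trivial; apply Ccont_const.
    - apply Cmult_neq_0; trivial. }
  exists (Rmin d d'); split; [apply Rmin_pos; trivial|]. intros w Hw.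
  assert (Hfw : f w <> RtoC 0).
  { apply Cmod_gt_0. eapply Rlt_trans; [|apply H'].
    - apply Cmod_gt_0 in Hn. lra.
    - eapply Rlt_le_trans; [apply Hw|apply Rmin_r]. }
  replace (- (1) * p w * / (f w * f z) * (w - z))%C
    with (- (1) * (p w * (w - z)) * / (f w * f z))%C by ring.
  rewrite <- H; [field; auto|]. eapply Rlt_le_trans; [apply Hw|apply Rmin_l].
Qed.

Lemma Cdiff_comp f g z l m : Cdiff f (g z) l -> Cdiff g z m ->
  Cdiff (fun z => f (g z)) z (l * m)%C.
Proof.
  intros Hf Hg. pose proof (Cdiff_Ccont _ _ _ Hg) as Cg.
  destruct Hf as [p [Hl [Hc [d [Hd H]]]]]. destruct Hg as [p' [Hl' [Hc' [d' [Hd' H']]]]].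
  destruct (Cg d Hd) as [d1 [Hd1 H1]].
  exists (fun w => p (g w) * p' w)%C; split; [rewrite Hl, Hl'; trivial|].
  split; [apply Ccont_mult; trivial; apply Ccont_comp; trivial|].
  exists (Rmin d1 d'); split; [apply Rmin_pos; trivial|]. intros w Hw.
  rewrite H. 2: apply H1; eapply Rlt_le_trans; [apply Hw|apply Rmin_l].
  rewrite H'. 2: eapply Rlt_le_trans; [apply Hw|apply Rmin_r]. ring.
Qed.

Lemma is_derive_of_linear_bound (f : R -> R) x l :
  (forall eps, 0 < eps -> exists d, 0 < d /\ forall h, Rabs h < d ->
     Rabs (f (x + h) - f x - l * h) <= eps * Rabs h) -> is_derive f x l.
Proof.
  intros H. apply is_derive_Reals. intros eps He.
  destruct (H (eps / 2) ltac:(lra)) as [d [Hd H']].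
  exists (mkposreal d Hd). intros h Hh Hhd. simpl in Hhd.
  specialize (H' h Hhd).
  replace ((f (x + h) - f x) / h - l) with ((f (x + h) - f x - l * h) / h) by (field; trivial).
  unfold Rdiv. rewrite Rabs_mult, Rabs_inv.
  pose proof (Rabs_pos_lt h Hh).
  apply Rmult_lt_reg_r with (Rabs h); trivial.
  rewrite Rmult_assoc, Rinv_l, Rmult_1_r by lra. nra.
Qed.

Lemma Cdiff_line f z l (w : C) : Cdiff f z l -> Cmod w = 1 ->
  is_derive (fun t : R => Re (f (z + t * w)%C)) 0 (Re (l * w)%C) /\
  is_derive (fun t : R => Im (f (z + t * w)%C)) 0 (Im (l * w)%C).
Proof.
  intros [p [Hl [Hc [d [Hd H]]]]] Hw.
  assert (K : forall eps, 0 < eps -> exists d, 0 < d /\ forall h, Rabs h < d ->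
     Cmod (f (z + (0 + h)%R * w) - f (z + 0%R * w) - (l * w) * h)%C <= eps * Rabs h).
  { intros eps He. destruct (Hc eps He) as [d1 [Hd1 H1]].
    exists (Rmin d d1); split; [apply Rmin_pos; trivial|]. intros h Hh.
    rewrite Rplus_0_l. replace (z + 0%R * w)%C with z by ring.
    assert (E : Cmod (z + h * w - z) = Rabs h).
    { replace (z + h * w - z)%C with (h * w)%C by ring. rewrite Cmod_mult, Cmod_R, Hw. ring. }
    rewrite H. 2: rewrite E; eapply Rlt_le_trans; [apply Hh|apply Rmin_l].
    replace (p (z + h * w) * (z + h * w - z) - l * w * h)%C
      with ((p (z + h * w) - l) * (w * h))%C by ring.
    rewrite !Cmod_mult, Cmod_R, Hw, Rmult_1_l. rewrite <- Hl.
    apply Rmult_le_compat_r; [apply Rabs_pos|]. left; apply H1.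
    rewrite E. eapply Rlt_le_trans; [apply Hh|apply Rmin_r]. }
  split; apply is_derive_of_linear_bound; intros eps He;
    destruct (K eps He) as [d1 [Hd1 H1]]; exists d1; split; trivial; intros h Hh;
    (eapply Rle_trans; [|apply (H1 h Hh)]).
  - eapply Rle_trans; [|apply re_le_Cmod]. right. f_equal.
    unfold Cminus. rewrite !re_plus, !re_opp, re_scal_r. ring.
  - eapply Rle_trans; [|apply im_le_Cmod]. right. f_equal.
    unfold Cminus. rewrite !im_plus, !im_opp, im_scal_r. ring.
Qed.

Lemma is_derive_translate (f : R -> R) (x l : R) :
  is_derive (fun t => f (x + t)) 0 l -> is_derive f x l.
Proof.
  intros H. apply (is_derive_ext (fun y => f (x + (y - x)))).
  { intros; f_equal; ring. }
  evar_last.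
  - apply (is_derive_comp (fun t => f (x + t)) (fun y => y - x) x l 1).
    + rewrite Rminus_diag. exact H.
    + apply (is_derive_ext (fun y : R => y + - x)); [intros; reflexivity|]. evar_last; [apply (is_derive_plus (K := R_AbsRing) (V := R_NormedModule)); [apply is_derive_id|apply is_derive_const]|]. apply Rplus_0_r.
  - change (1 * l = l). ring.
Qed.

Lemma Cdiff_dx f x y l : Cdiff f (x, y) l ->
  is_derive (fun x => Re (f (x, y))) x (Re l) /\ is_derive (fun x => Im (f (x, y))) x (Im l).
Proof.
  intros H. destruct (Cdiff_line f _ l (RtoC 1) H Cmod_1) as [H1 H2].
  rewrite Cmult_1_r in H1, H2.
  split; apply is_derive_translate.
  - eapply is_derive_ext; [|exact H1]. intros t. simpl. do 2 f_equal.
    unfold Cplus, Cmult, RtoC; simpl. f_equal; ring.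
  - eapply is_derive_ext; [|exact H2]. intros t. simpl. do 2 f_equal.
    unfold Cplus, Cmult, RtoC; simpl. f_equal; ring.
Qed.

(** The same [l] read in the direction [Ci]. Together with [Cdiff_dx] this gives the Cauchy-Riemann
    equations in the form used by [real_shift]. *)
Lemma Cdiff_dy f x y l : Cdiff f (x, y) l ->
  is_derive (fun y => Re (f (x, y))) y (- Im l) /\ is_derive (fun y => Im (f (x, y))) y (Re l).
Proof.
  intros H. destruct (Cdiff_line f _ l Ci H Cmod_Ci) as [H1 H2].
  rewrite re_mult_Ci in H1. replace (Im (l * Ci)%C) with (Re l) in H2.
  2: { rewrite im_mult. simpl. ring. }
  split; apply is_derive_translate.
  - eapply is_derive_ext; [|exact H1]. intros t. simpl. do 2 f_equal.
    unfold Cplus, Cmult, RtoC, Ci; simpl. f_equal; ring.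
  - eapply is_derive_ext; [|exact H2]. intros t. simpl. do 2 f_equal.
    unfold Cplus, Cmult, RtoC, Ci; simpl. f_equal; ring.
Qed.

Lemma Ccont_2d f x y : Ccont f (x, y) ->
  continuity_2d_pt (fun u v => Re (f (u, v))) x y /\
  continuity_2d_pt (fun u v => Im (f (u, v))) x y.
Proof.
  intros H.
  assert (K : forall eps : posreal, exists d : posreal, forall u v,
    Rabs (u - x) < d -> Rabs (v - y) < d -> Cmod (f (u, v) - f (x, y)) < eps).
  { intros eps. destruct (H eps (cond_pos eps)) as [d [Hd H']].
    assert (Hd2 : 0 < d / 2) by lra. exists (mkposreal _ Hd2). simpl. intros u v Hu Hv.
    apply H'. eapply Rle_lt_trans; [apply Cmod_le_re_im|].
    unfold Cminus. rewrite re_plus, im_plus, re_opp, im_opp. simpl.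
    unfold Rminus in Hu, Hv. lra. }
  split; intros eps; destruct (K eps) as [d Hd]; exists d; intros u v Hu Hv;
    (eapply Rle_lt_trans; [|apply (Hd u v Hu Hv)]).
  - eapply Rle_trans; [|apply re_le_Cmod]. right. unfold Cminus. rewrite re_plus, re_opp. reflexivity.
  - eapply Rle_trans; [|apply im_le_Cmod]. right. unfold Cminus. rewrite im_plus, im_opp. reflexivity.
Qed.

Lemma continuous_Ccont (f g : R * R -> R) (z : C) :
  continuous f z -> continuous g z -> Ccont (fun z => (f z, g z)) z.
Proof.
  intros Hf Hg e He.
  assert (He2 : 0 < e / 2) by lra.
  destruct (Hf _ (locally_ball (f z) (mkposreal _ He2))) as [d1 H1].
  destruct (Hg _ (locally_ball (g z) (mkposreal _ He2))) as [d2 H2].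
  exists (Rmin d1 d2). split; [apply Rmin_pos; apply cond_pos|]. intros w Hw.
  assert (B : Rabs (fst w - fst z) < Rmin d1 d2 /\ Rabs (snd w - snd z) < Rmin d1 d2).
  { split; (eapply Rle_lt_trans; [|apply Hw]).
    - replace (fst w - fst z) with (Re (w - z)%C); [apply re_le_Cmod|].
      unfold Cminus; rewrite re_plus, re_opp; reflexivity.
    - replace (snd w - snd z) with (Im (w - z)%C); [apply im_le_Cmod|].
      unfold Cminus; rewrite im_plus, im_opp; reflexivity. }
  assert (F1 : Rabs (f w - f z) < e / 2).
  { apply H1. split; (eapply Rlt_le_trans; [apply B|apply Rmin_l]). }
  assert (F2 : Rabs (g w - g z) < e / 2).
  { apply H2. split; (eapply Rlt_le_trans; [apply B|apply Rmin_r]). }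
  eapply Rle_lt_trans; [apply Cmod_le_re_im|].
  unfold Cminus. rewrite re_plus, im_plus, re_opp, im_opp. simpl.
  unfold Rminus in F1, F2. lra.
Qed.

(** * Complex exponential, logarithm and powers *)

Lemma Cexp_plus a b : Cexp (a + b) = (Cexp a * Cexp b)%C.
Proof.
  unfold Cexp. rewrite re_plus, im_plus, exp_plus, cos_plus, sin_plus.
  unfold Cmult; simpl. f_equal; ring.
Qed.

Lemma Cexp_RtoC x : Cexp (RtoC x) = RtoC (exp x).
Proof.
  unfold Cexp. rewrite re_RtoC, im_RtoC, cos_0, sin_0. unfold RtoC; f_equal; ring.
Qed.

Lemma Cexp_0 : Cexp (RtoC 0) = RtoC 1.
Proof. rewrite Cexp_RtoC, exp_0. reflexivity. Qed.

Lemma Cmod_Cexp z : Cmod (Cexp z) = exp (Re z).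
Proof.
  unfold Cmod, Cexp; simpl.
  replace (exp (Re z) * cos (Im z) * (exp (Re z) * cos (Im z) * 1) +
     exp (Re z) * sin (Im z) * (exp (Re z) * sin (Im z) * 1))
    with ((exp (Re z)) ^ 2 * (Rsqr (sin (Im z)) + Rsqr (cos (Im z)))) by (unfold Rsqr; ring).
  rewrite sin2_cos2, Rmult_1_r. rewrite sqrt_pow2; trivial. left; apply exp_pos.
Qed.

Lemma Cexp_neq_0 z : Cexp z <> RtoC 0.
Proof. apply Cmod_gt_0. rewrite Cmod_Cexp. apply exp_pos. Qed.

Lemma Cexp_opp z : Cexp (- z) = (/ Cexp z)%C.
Proof.
  assert (H : (Cexp z * Cexp (- z) = 1)%C).
  { rewrite <- Cexp_plus, <- Cexp_0. f_equal. ring. }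
  replace (Cexp (- z)) with (/ Cexp z * (Cexp z * Cexp (- z)))%C
    by (field; apply Cexp_neq_0).
  rewrite H. ring.
Qed.

Lemma exp_incr x y : x <= y -> exp x <= exp y.
Proof. intros [h| ->]; [left; apply exp_increasing; trivial|lra]. Qed.

Lemma Cmod_Cexp_le z : Cmod (Cexp z) <= exp (Cmod z).
Proof.
  rewrite Cmod_Cexp. apply exp_incr.
  eapply Rle_trans; [apply Rle_abs|apply re_le_Cmod].
Qed.

Lemma norm_mvt (c1 c2 d1 d2 G g : R -> R) :
  (forall t, 0 <= t <= 1 -> is_derive c1 t (d1 t)) ->
  (forall t, 0 <= t <= 1 -> is_derive c2 t (d2 t)) ->
  (forall t, 0 <= t <= 1 -> is_derive G t (g t)) ->
  (forall t, 0 <= t <= 1 -> Cmod (d1 t, d2 t) <= g t) ->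
  Cmod (c1 1 - c1 0, c2 1 - c2 0) <= G 1 - G 0.
Proof.
  intros H1 H2 HG Hb.
  set (p := c1 1 - c1 0). set (q := c2 1 - c2 0). set (m := Cmod (p, q)).
  assert (Hm : 0 <= m) by apply Cmod_ge_0.
  assert (Hmm : m * m = p * p + q * q).
  { unfold m, Cmod; simpl. rewrite sqrt_sqrt; [ring|nra]. }
  (* Projecting the path on the direction of its increment reduces the vector inequality to the real mean value theorem. *)
  set (psi := fun t => p * c1 t + q * c2 t - m * G t).
  destruct (MVT_gen psi 0 1 (fun t => p * d1 t + q * d2 t - m * g t)) as [t [Ht E]].
  - intros t. rewrite Rmin_left, Rmax_right by lra. intros Ht.
    unfold psi. assert (Ht' : 0 <= t <= 1) by lra.
    apply (is_derive_minus (V := R_NormedModule) (fun t => p * c1 t + q * c2 t)).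
    + apply (is_derive_plus (V := R_NormedModule)); apply is_derive_scal; auto.
    + apply is_derive_scal; auto.
  - intros t. rewrite Rmin_left, Rmax_right by lra. intros Ht.
    apply continuity_pt_filterlim.
    apply (real_derive_continuous).
    exists (p * d1 t + q * d2 t - m * g t). unfold psi.
    apply (is_derive_minus (V := R_NormedModule) (fun t => p * c1 t + q * c2 t)).
    + apply (is_derive_plus (V := R_NormedModule)); apply is_derive_scal; auto.
    + apply is_derive_scal; auto.
  - rewrite Rmin_left, Rmax_right in Ht by lra.
    pose proof (Hb t Ht) as Hbt.
    assert (CS : p * d1 t + q * d2 t <= m * Cmod (d1 t, d2 t)).
    { assert (Cmod ((p, (- q)%R) * (d1 t, d2 t))%C = m * Cmod (d1 t, d2 t)).
      { rewrite Cmod_mult. f_equal. unfold m, Cmod; simpl. f_equal. ring. }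
      rewrite <- H. eapply Rle_trans; [|apply re_le_Cmod].
      eapply Rle_trans; [|apply Rle_abs]. rewrite re_mult. simpl. lra. }
    assert (psi 1 - psi 0 <= 0).
    { rewrite E. assert (m * Cmod (d1 t, d2 t) <= m * g t) by (apply Rmult_le_compat_l; trivial). lra. }
    unfold psi in H.
    assert (K : m * m <= m * (G 1 - G 0)) by (rewrite Hmm; unfold p, q in *; lra).
    destruct Hm as [Hm|Hm].
    + apply Rmult_le_reg_l with m; trivial.
    (* A zero increment leaves nothing to divide by. The majorant [g] is non-negative, so the mean
       value theorem for [G] alone suffices. *)
    + rewrite <- Hm. assert (G0 : 0 <= G 1 - G 0); [|lra].
      destruct (MVT_gen G 0 1 g) as [u [Hu E']].
      * intros u. rewrite Rmin_left, Rmax_right by lra. intros. apply HG; lra.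
      * intros u. rewrite Rmin_left, Rmax_right by lra. intros Hu.
        apply continuity_pt_filterlim.
        apply (real_derive_continuous).
        exists (g u); apply HG; lra.
      * rewrite Rmin_left, Rmax_right in Hu by lra.
        rewrite E'. assert (0 <= g u); [|lra].
        eapply Rle_trans; [apply Cmod_ge_0|apply (Hb u Hu)].
Qed.

Lemma Cexp_line_derive (z : C) (t : R) :
  is_derive (fun t : R => Re (Cexp (t * z))) t (Re (z * Cexp (t * z))) /\
  is_derive (fun t : R => Im (Cexp (t * z))) t (Im (z * Cexp (t * z))).
Proof.
  destruct z as [x y].
  split.
  - apply (is_derive_ext (fun t => exp (t * x) * cos (t * y))).
    { intros s. unfold Cexp. rewrite re_scal_l, im_scal_l. reflexivity. }
    auto_derive; trivial. unfold Cexp. rewrite re_mult. simpl.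
    replace (t * x - 0 * y) with (t * x) by ring.
    replace (t * y + 0 * x) with (t * y) by ring. ring.
  - apply (is_derive_ext (fun t => exp (t * x) * sin (t * y))).
    { intros s. unfold Cexp. rewrite re_scal_l, im_scal_l. reflexivity. }
    auto_derive; trivial. unfold Cexp. rewrite im_mult. simpl.
    replace (t * x - 0 * y) with (t * x) by ring.
    replace (t * y + 0 * x) with (t * y) by ring. ring.
Qed.

Fixpoint exp_sum (n : nat) (z : C) : C :=
  match n with
  | O => RtoC 0
  | S k => (exp_sum k z + z ^ k * / INR (fact k))%C
  end.

Lemma INR_fact_pos k : 0 < INR (fact k).
Proof. apply lt_0_INR, lt_O_fact. Qed.

Lemma exp_sum_1 z : exp_sum 1 z = RtoC 1.
Proof. simpl. field. Qed.

Lemma is_derive_pow_S n (t : R) : is_derive (fun s => s ^ S n) t (INR (S n) * t ^ n).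
Proof. auto_derive; trivial. exact (Rmult_1_l _). Qed.

(** Differentiation along the ray lowers the number of terms by one, which drives the induction of
    [Cexp_remainder]. *)
Lemma exp_sum_line_derive n (z : C) (t : R) :
  is_derive (fun t : R => Re (exp_sum (S n) (t * z))) t (Re (z * exp_sum n (t * z))) /\
  is_derive (fun t : R => Im (exp_sum (S n) (t * z))) t (Im (z * exp_sum n (t * z))).
Proof.
  induction n as [|n [IH1 IH2]].
  - split.
    + apply (is_derive_ext (fun _ => 1)).
      * intros s. rewrite exp_sum_1. reflexivity.
      * change (exp_sum 0 (t * z)) with (RtoC 0). rewrite Cmult_0_r. apply (is_derive_const (V := R_NormedModule)).
    + apply (is_derive_ext (fun _ => 0)).
      * intros s. rewrite exp_sum_1. reflexivity.
      * change (exp_sum 0 (t * z)) with (RtoC 0). rewrite Cmult_0_r. apply (is_derive_const (V := R_NormedModule)).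
  - set (c := (z ^ S n * / INR (fact (S n)))%C).
    assert (Ec : forall s : R, ((s * z) ^ S n * / INR (fact (S n)) = (s ^ S n)%R * c)%C).
    { intros s. unfold c. rewrite RtoC_pow, Cpow_mult_l. ring. }
    assert (Ed : ((INR (S n) * t ^ n)%R * c = z * ((t * z) ^ n * / INR (fact n)))%C).
    { unfold c. rewrite Cpow_mult_l, <- RtoC_pow. rewrite fact_simpl, mult_INR, !RtoC_mult.
      rewrite Cpow_S. field.
      split; intros E; apply RtoC_inj in E; [pose proof (INR_fact_pos n)|pose proof (pos_INR n); rewrite S_INR in E]; lra. }
    assert (Dp : is_derive (fun s => s ^ S n) t (INR (S n) * t ^ n)).
    { apply is_derive_pow_S. }
    assert (Erhs : (z * exp_sum (S n) (t * z) = z * exp_sum n (t * z) + (INR (S n) * t ^ n)%R * c)%C).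
    { rewrite Ed. simpl. ring. }
    rewrite Erhs. split.
    + apply (is_derive_ext (fun s : R => Re (exp_sum (S n) (s * z)) + s ^ S n * Re c)).
      { intros s. change (exp_sum (S (S n)) (s * z)) with
          (exp_sum (S n) (s * z) + (s * z) ^ S n * / INR (fact (S n)))%C.
        rewrite Ec, re_plus, re_scal_l. reflexivity. }
      rewrite re_plus, re_scal_l. apply (is_derive_plus (V := R_NormedModule)); trivial.
      apply (is_derive_ext (fun s => Re c * s ^ S n)); [intros; apply Rmult_comm|].
      rewrite (Rmult_comm _ (Re c)). apply is_derive_scal; trivial.
    + apply (is_derive_ext (fun s : R => Im (exp_sum (S n) (s * z)) + s ^ S n * Im c)).
      { intros s. change (exp_sum (S (S n)) (s * z)) with
          (exp_sum (S n) (s * z) + (s * z) ^ S n * / INR (fact (S n)))%C.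
        rewrite Ec, im_plus, im_scal_l. reflexivity. }
      rewrite im_plus, im_scal_l. apply (is_derive_plus (V := R_NormedModule)); trivial.
      apply (is_derive_ext (fun s => Im c * s ^ S n)); [intros; apply Rmult_comm|].
      rewrite (Rmult_comm _ (Im c)). apply is_derive_scal; trivial.
Qed.

Lemma exp_sum_0 n : exp_sum (S n) 0 = RtoC 1.
Proof.
  induction n as [|n IH].
  - apply exp_sum_1.
  - change (exp_sum (S (S n)) 0) with (exp_sum (S n) 0 + 0 ^ S n * / INR (fact (S n)))%C.
    rewrite IH, Cpow_S. ring.
Qed.

(** Along the segment from 0 to [z] the derivative of the remainder after n + 1 terms is [z] times
    the remainder after n terms, and [norm_mvt] integrates the inductive bound [K * t ^ n]. *)
Lemma Cexp_remainder n : forall z,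
  Cmod (Cexp z - exp_sum n z) <= Cmod z ^ n / INR (fact n) * exp (Cmod z).
Proof.
  induction n as [|n IH]; intros z.
  - simpl. replace (Cexp z - 0)%C with (Cexp z) by ring.
    replace (1 / 1 * exp (Cmod z)) with (exp (Cmod z)) by field. apply Cmod_Cexp_le.
  - pose proof (Cmod_ge_0 z) as Hz.
    set (K := Cmod z ^ S n / INR (fact n) * exp (Cmod z)).
    pose proof (norm_mvt
      (fun t : R => Re (Cexp (t * z)) - Re (exp_sum (S n) (t * z)))
      (fun t : R => Im (Cexp (t * z)) - Im (exp_sum (S n) (t * z)))
      (fun t : R => Re (z * Cexp (t * z)) - Re (z * exp_sum n (t * z)))
      (fun t : R => Im (z * Cexp (t * z)) - Im (z * exp_sum n (t * z)))
      (fun t : R => K / INR (S n) * t ^ S n)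
      (fun t : R => K * t ^ n)) as M.
    assert (HS : 0 < INR (S n)) by (rewrite S_INR; pose proof (pos_INR n); lra).
    pose proof (INR_fact_pos n) as Hf.
    eapply Rle_trans; [|eapply Rle_trans; [apply M|]].
    + right. f_equal.
      replace (RtoC 1 * z)%C with z by ring. replace (RtoC 0 * z)%C with (RtoC 0) by ring.
      rewrite exp_sum_0, Cexp_0. rewrite (C_eta (Cexp z - _)%C).
      unfold Cminus. rewrite re_plus, im_plus, re_opp, im_opp. f_equal; lra.
    + intros t _. apply (is_derive_minus (V := R_NormedModule));
        [apply Cexp_line_derive|apply exp_sum_line_derive].
    + intros t _. apply (is_derive_minus (V := R_NormedModule));
        [apply Cexp_line_derive|apply exp_sum_line_derive].
    + intros t _. replace (K * t ^ n) with (K / INR (S n) * (INR (S n) * t ^ n)) by (field; lra).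
      apply is_derive_scal, is_derive_pow_S.
    + intros t Ht.
      replace (Re (z * Cexp (t * z)) - Re (z * exp_sum n (t * z)), Im (z * Cexp (t * z)) - Im (z * exp_sum n (t * z)))
        with (z * (Cexp (t * z) - exp_sum n (t * z)))%C.
      2: { rewrite (C_eta (z * _)%C). 
           replace (z * (Cexp (t * z) - exp_sum n (t * z)))%C
             with (z * Cexp (t * z) - z * exp_sum n (t * z))%C by ring.
           unfold Cminus. rewrite re_plus, im_plus, re_opp, im_opp. reflexivity. }
      rewrite Cmod_mult.
      eapply Rle_trans; [apply Rmult_le_compat_l; [apply Hz|apply IH]|].
      rewrite Cmod_mult, Cmod_R, Rabs_right by lra.
      rewrite Rpow_mult_distr. unfold K.
      replace (Cmod z * (t ^ n * Cmod z ^ n / INR (fact n) * exp (t * Cmod z)))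
        with (Cmod z ^ S n / INR (fact n) * t ^ n * exp (t * Cmod z)) by (simpl; field; lra).
      replace (Cmod z ^ S n / INR (fact n) * exp (Cmod z) * t ^ n)
        with (Cmod z ^ S n / INR (fact n) * t ^ n * exp (Cmod z)) by ring.
      apply Rmult_le_compat_l.
      * apply Rmult_le_pos; [|apply pow_le; lra].
        apply Rmult_le_pos; [apply pow_le; lra|]. left; apply Rinv_0_lt_compat; trivial.
      * apply exp_incr. nra.
    + right. rewrite pow1, pow_i by lia. unfold K. rewrite fact_simpl, mult_INR. field. lra.
Qed.

Lemma exp_sum_term x k : 0 <= x -> x ^ k / INR (fact k) <= exp x.
Proof.
  revert x; induction k as [|k IH]; intros x Hx.
  - simpl. pose proof (exp_ineq1_le x). replace (1 / 1) with 1 by field. lra.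
  - (* d/dt of the difference is non-negative by the induction hypothesis *)
    assert (HS : 0 < INR (S k)) by (rewrite S_INR; pose proof (pos_INR k); lra).
    pose proof (INR_fact_pos k) as Hf.
    assert (D : forall t, is_derive (fun t => exp t - t ^ S k / INR (fact (S k))) t
      (exp t - t ^ k / INR (fact k))).
    { intros t.
      apply (is_derive_minus (V := R_NormedModule) exp (fun t => t ^ S k / INR (fact (S k)))); [apply is_derive_exp|].
      apply (is_derive_ext (fun t => / INR (fact (S k)) * t ^ S k)); [intros; apply Rmult_comm|].
      replace (t ^ k / INR (fact k)) with (/ INR (fact (S k)) * (INR (S k) * t ^ k))
        by (rewrite fact_simpl, mult_INR; field; lra).
      apply is_derive_scal, is_derive_pow_S.
    }
    destruct (MVT_gen (fun t => exp t - t ^ S k / INR (fact (S k))) 0 x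
      (fun t => exp t - t ^ k / INR (fact k))) as [t [Ht E]].
    + intros t _. apply D.
    + intros t _. apply continuity_pt_filterlim.
      apply (real_derive_continuous (fun t => exp t - t ^ S k / INR (fact (S k)))).
      exists (exp t - t ^ k / INR (fact k)). apply D.

    + rewrite Rmin_left, Rmax_right in Ht by lra.
      specialize (IH t (proj1 Ht)). rewrite exp_0, pow_i in E by lia.
      replace (0 / INR (fact (S k))) with 0 in E by (field; pose proof (INR_fact_pos (S k)); lra).
      nra.
Qed.

(** The n-th term of the series of [exp (2 * Cmod z)] is at most its sum, so the factorial can be
    traded for a geometric factor times an exponential whose rate 3 does not depend on n. With z = w
    Log(b + iy) that exponential is a power growth, which the kernels absorb. *)
Lemma Cexp_remainder_geom n z :
  Cmod (Cexp z - exp_sum n z) <= (/ 2) ^ n * exp (3 * Cmod z).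
Proof.
  eapply Rle_trans; [apply Cexp_remainder|].
  pose proof (Cmod_ge_0 z) as Hz.
  pose proof (exp_sum_term (2 * Cmod z) n ltac:(lra)) as H.
  rewrite Rpow_mult_distr in H. pose proof (INR_fact_pos n).
  replace (3 * Cmod z) with (2 * Cmod z + Cmod z) by ring. rewrite exp_plus.
  pose proof (exp_pos (Cmod z)). rewrite <- Rmult_assoc.
  apply Rmult_le_compat_r; [lra|].
  assert (H2 : 0 < 2 ^ n) by (apply pow_lt; lra).
  rewrite pow_inv. apply Rmult_le_reg_l with (2 ^ n); trivial.
  rewrite <- Rmult_assoc, Rinv_r by lra. lra.
Qed.

Lemma Cdiff_Cexp z : Cdiff Cexp z (Cexp z).
Proof.
  (* Difference quotient of the exponential at 0, completed by its limit. The remainder after two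
     terms gives its continuity there. *)
  set (q := fun h => if excluded_middle_informative (h = RtoC 0) then RtoC 1
            else ((Cexp h - 1) / h)%C).
  assert (Q : forall h, (Cexp h - 1 = q h * h)%C).
  { intros h. unfold q. destruct excluded_middle_informative as [->|n].
    - rewrite Cexp_0. ring.
    - field. trivial. }
  assert (Q1 : forall h, Cmod (q h - 1) <= Cmod h * exp (Cmod h)).
  { intros h. unfold q. destruct excluded_middle_informative as [->|n].
    - replace (1 - 1)%C with (RtoC 0) by ring. rewrite Cmod_0. lra.
    - replace ((Cexp h - 1) / h - 1)%C with ((Cexp h - exp_sum 2 h) / h)%C.
      2: { change (exp_sum 2 h) with (exp_sum 1 h + h ^ 1 * / 1)%C. rewrite exp_sum_1. simpl. field. trivial. }
      rewrite Cmod_div by trivial. apply Cmod_gt_0 in n.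
      apply Rmult_le_reg_r with (Cmod h); trivial.
      unfold Rdiv; rewrite Rmult_assoc, Rinv_l, Rmult_1_r by lra.
      eapply Rle_trans; [apply Cexp_remainder|]. simpl.
      pose proof (exp_pos (Cmod h)). nra. }
  exists (fun w => Cexp z * q (w - z))%C. split; [|split].
  - replace (z - z)%C with (RtoC 0) by ring. unfold q.
    destruct excluded_middle_informative; [ring|congruence].
  - apply Ccont_mult; [apply Ccont_const|]. intros e He.
    exists (Rmin 1 (e / 4)). split; [apply Rmin_pos; lra|]. intros w Hw.
    replace (z - z)%C with (RtoC 0) by ring.
    replace (q 0) with (RtoC 1).
    2: { unfold q; destruct excluded_middle_informative; [trivial|congruence]. }
    eapply Rle_lt_trans; [apply Q1|].
    assert (H1 : Cmod (w - z) < 1) by (eapply Rlt_le_trans; [apply Hw|apply Rmin_l]).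
    assert (H2 : Cmod (w - z) < e / 4) by (eapply Rlt_le_trans; [apply Hw|apply Rmin_r]).
    pose proof (Cmod_ge_0 (w - z)).
    assert (exp (Cmod (w - z)) <= 3) by (eapply Rle_trans; [apply exp_incr; left; apply H1|apply exp_le_3]).
    pose proof (exp_pos (Cmod (w - z))). nra.
  - exists 1; split; [lra|]. intros w _. rewrite <- Cmult_assoc, <- Q.
    replace w with (z + (w - z))%C at 1 by ring. rewrite Cexp_plus. ring.
Qed.

(** The principal logarithm on the half-plane Re z > 0 only, where the argument is the arctangent of
    the slope. The bases b + iy with b > 0 never leave this half-plane. *)
Definition Clog (z : C) : C := (ln (Cmod z), atan (Im z / Re z)).

Lemma Cmod_pos_re z : 0 < Re z -> 0 < Cmod z.
Proof. intros H. eapply Rlt_le_trans; [|apply re_le_Cmod]. rewrite Rabs_right; lra. Qed.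

Lemma Cexp_Clog z : 0 < Re z -> Cexp (Clog z) = z.
Proof.
  intros H. unfold Cexp, Clog; simpl. rewrite exp_ln by (apply Cmod_pos_re; trivial).
  rewrite cos_atan, sin_atan. destruct z as [x y]; simpl in *.
  assert (E : Cmod (x, y) = x * sqrt (1 + (y / x) * (y / x))).
  { unfold Cmod; simpl.
    replace (x * (x * 1) + y * (y * 1)) with (x ^ 2 * (1 + (y / x) * (y / x))) by (field; lra).
    rewrite sqrt_mult by nra. rewrite sqrt_pow2; lra. }
  assert (0 < sqrt (1 + (y / x) * (y / x))) by (apply sqrt_lt_R0; nra).
  rewrite E. f_equal; [unfold Rsqr; field; lra|unfold Rsqr; field; lra].
Qed.

Lemma Clog_RtoC x : 0 < x -> Clog (RtoC x) = RtoC (ln x).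
Proof.
  intros H. unfold Clog. rewrite Cmod_R, Rabs_right, re_RtoC, im_RtoC by lra.
  replace (0 / x) with 0 by (field; lra). rewrite atan_0. reflexivity.
Qed.

Lemma Ccont_Clog z : 0 < Re z -> Ccont Clog z.
Proof.
  intros H. apply (continuous_Ccont (fun z => ln (Cmod z)) (fun z => atan (Im z / Re z))).
  - apply (continuous_comp (U := prod_UniformSpace R_UniformSpace R_UniformSpace) (fun z : R * R => fst z ^ 2 + snd z ^ 2) (fun x => ln (sqrt x))).
    + apply (continuous_plus (V := R_NormedModule));
        apply (continuous_comp (U := prod_UniformSpace R_UniformSpace R_UniformSpace) _ (fun x => x ^ 2));
        try apply continuous_fst; try apply continuous_snd;
        apply (real_derive_continuous); auto_derive; trivial.
    + apply (real_derive_continuous).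
      assert (0 < fst z ^ 2 + snd z ^ 2) by (unfold Re in H; nra).
      auto_derive. split; trivial. split; trivial. apply sqrt_lt_R0; trivial.
  - apply (continuous_comp (U := prod_UniformSpace R_UniformSpace R_UniformSpace) (fun z : R * R => snd z * / fst z) atan).
    + apply (continuous_mult (U := prod_UniformSpace R_UniformSpace R_UniformSpace) (K := R_AbsRing)).
      * apply continuous_snd.
      * apply (continuous_comp (U := prod_UniformSpace R_UniformSpace R_UniformSpace) fst Rinv).
        apply continuous_fst. apply continuous_Rinv. exact (Rgt_not_eq _ _ H).
    + apply (real_derive_continuous).
      auto_derive; trivial.
Qed.

Lemma Ccont_re_pos z : 0 < Re z -> forall z', Cmod (z' - z) < Re z -> 0 < Re z'.
Proof.
  intros H z' H'. pose proof (re_le_Cmod (z' - z)) as K.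
  unfold Cminus in K at 1. rewrite re_plus, re_opp in K.
  assert (K' := Rle_lt_trans _ _ _ K H'). apply Rabs_def2 in K'. lra.
Qed.

(** Inverse function rule in Caratheodory's form: the slope function of [Cexp] at [Clog z], composed
    with [Clog] and inverted, is a slope function for [Clog]. *)
Lemma Cdiff_Clog z : 0 < Re z -> Cdiff Clog z (/ z)%C.
Proof.
  intros H. destruct (Cdiff_Cexp (Clog z)) as [p [Hp [Hc [d [Hd Hd']]]]].
  rewrite Cexp_Clog in * by trivial.
  pose proof (Ccont_Clog z H) as HL.
  assert (Hz : z <> RtoC 0) by (apply Cmod_gt_0, Cmod_pos_re, H).
  pose proof (Ccont_comp p Clog z Hc HL) as Hpc.
  assert (Hpz : p (Clog z) <> RtoC 0) by (rewrite Hp; trivial).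
  exists (fun w => / p (Clog w))%C. split; [rewrite Hp; trivial|].
  split; [apply (Ccont_inv (fun w => p (Clog w))); trivial|].
  destruct (HL d Hd) as [d1 [Hd1 H1]].
  destruct (Ccont_neq_0 _ _ Hpc Hpz) as [d2 [Hd2 H2]].
  exists (Rmin (Re z) (Rmin d1 d2)); split; [repeat apply Rmin_pos; trivial|].
  intros w Hw.
  assert (W1 : 0 < Re w) by (apply (Ccont_re_pos z); trivial; eapply Rlt_le_trans; [apply Hw|apply Rmin_l]).
  assert (W2 : Cmod (w - z) < Rmin d1 d2) by (eapply Rlt_le_trans; [apply Hw|apply Rmin_r]).
  specialize (H1 w ltac:(eapply Rlt_le_trans; [apply W2|apply Rmin_l])).
  specialize (H2 w ltac:(eapply Rlt_le_trans; [apply W2|apply Rmin_r])).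
  assert (Hpw : p (Clog w) <> RtoC 0).
  { apply Cmod_gt_0. apply Cmod_gt_0 in Hpz. lra. }
  specialize (Hd' (Clog w) H1). rewrite Cexp_Clog in Hd' by trivial.
  rewrite Hd'. field. trivial.
Qed.

Definition cpower (z a : C) : C := Cexp (a * Clog z).

Lemma Cdiff_cpower a z : 0 < Re z -> Cdiff (fun z => cpower z a) z (a * cpower z (a - 1))%C.
Proof.
  intros H.
  eapply Cdiff_eq; [|apply (Cdiff_comp Cexp (fun z => a * Clog z)%C);
    [apply Cdiff_Cexp|apply Cdiff_scal, Cdiff_Clog, H]].
  unfold cpower. replace ((a - 1) * Clog z)%C with (a * Clog z + - Clog z)%C by ring.
  rewrite Cexp_plus, Cexp_opp, Cexp_Clog by trivial. ring.
Qed.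

Lemma Rcpow_cpower x s : 0 < x -> Rcpow x s = cpower (RtoC x) s.
Proof. intros H. unfold Rcpow, cpower. rewrite Clog_RtoC by trivial. reflexivity. Qed.

(** * Shifting vertical lines of integration *)

Lemma continuity_2d_pt_snd (u : R -> R -> R) x y :
  continuity_2d_pt u x y -> continuous (u x) y.
Proof.
  intros H. apply continuity_pt_filterlim, continuity_pt_locally. intros eps.
  destruct (H eps) as [d Hd]. exists d. intros z Hz. apply Hd; [|exact Hz].
  rewrite Rminus_diag, Rabs_R0. apply cond_pos.
Qed.

(** Write J(x) for the integral of [u x] over [-n, n]. Since [a] is both the x-derivative of [u] and
    the y-derivative of [v], J'(x) = v(x, n) - v(x, -n), of size at most 2B, and the strip has width
    1. *)
Lemma real_shift (u v a : R -> R -> R) (n B d : R) : 0 < d -> 0 <= n ->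
  (forall x y, - d < x < 1 + d -> continuity_2d_pt u x y) ->
  (forall x y, 0 < x < 1 -> x <> / 2 ->
     is_derive (fun x => u x y) x (a x y) /\ is_derive (v x) y (a x y) /\
     continuity_2d_pt a x y) ->
  (forall x, 0 < x < 1 -> Rabs (v x n) <= B /\ Rabs (v x (- n)) <= B) ->
  Rabs (RInt (u 1) (- n) n - RInt (u 0) (- n) n) <= 2 * B.
Proof.
  intros Hd Hn Hu Ha Hv.
  set (J := fun x => RInt (u x) (- n) n).
  assert (Hex : forall x, - d < x < 1 + d -> ex_RInt (u x) (- n) n).
  { intros x Hx. apply continuous_ex_RInt. intros y. apply continuity_2d_pt_snd, Hu, Hx. }
  assert (Jc : forall x, 0 <= x <= 1 -> continuity_pt J x).
  { intros x Hx. apply continuity_pt_filterlim. apply (RInt_param_continuous u); try lra.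
    - intros y _. apply Hu; lra.
    - exists (mkposreal d Hd). intros z Hz. apply Hex.
      assert (Hz' : Rabs (z - x) < d) by exact Hz. apply Rabs_def2 in Hz'. lra. }
  assert (Jd : forall x, 0 < x < 1 -> x <> / 2 -> is_derive J x (v x n - v x (- n))).
  { intros x Hx Hx2.
    set (r := Rmin (Rmin x (1 - x)) (Rabs (x - / 2))).
    assert (Hr : 0 < r) by (repeat apply Rmin_pos; try lra; apply Rabs_pos_lt; lra).
    assert (Hnear : forall z, Rabs (z - x) < r -> 0 < z < 1 /\ z <> / 2).
    { intros z Hz.
      assert (H1 : r <= x) by (eapply Rle_trans; [apply Rmin_l|apply Rmin_l]).
      assert (H2 : r <= 1 - x) by (eapply Rle_trans; [apply Rmin_l|apply Rmin_r]).
      assert (H3 : r <= Rabs (x - / 2)) by apply Rmin_r.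
      split; [apply Rabs_def2 in Hz; lra|]. intros ->.
      rewrite Rabs_minus_sym in Hz. lra. }
    replace (v x n - v x (- n)) with (RInt (fun t => Derive (fun z => u z t) x) (- n) n).
    - apply (is_derive_RInt_param u).
      + exists (mkposreal r Hr). intros z Hz t _. destruct (Hnear z Hz) as [N1 N2].
        eexists. exact (proj1 (Ha z t N1 N2)).
      + intros t _. apply (continuity_2d_pt_ext_loc a); [|apply Ha; trivial].
        exists (mkposreal r Hr). intros z w Hz _. destruct (Hnear z Hz).
        symmetry. apply is_derive_unique, Ha; trivial.
      + exists (mkposreal r Hr). intros z Hz. destruct (Hnear z Hz). apply Hex. lra.
    - rewrite (RInt_ext (V := R_CompleteNormedModule) _ (a x)).
      + apply (is_RInt_unique (V := R_CompleteNormedModule)).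
        apply (is_RInt_derive (V := R_CompleteNormedModule) (v x) (a x)); intros t _.
        * exact (proj1 (proj2 (Ha x t Hx Hx2))).
        * apply continuity_2d_pt_snd, Ha; trivial.
      + intros t _. apply is_derive_unique, Ha; trivial. }
  (* The two halves are treated separately because no derivative of J is known at 1/2; continuity of
     J joins them. *)
  assert (K : forall p q, 0 <= p -> q <= 1 -> q = p + / 2 -> (q <= / 2 \/ / 2 <= p) ->
    Rabs (J q - J p) <= B).
  { intros p q Hp Hq Hpq Hside.
    (* The intermediate point may be an endpoint, where no derivative of J is known; the candidate
       derivative is set to 0 there, which respects the bound. *)
    destruct (MVT_gen J p q (fun x => if Req_EM_T x p then 0 else if Req_EM_T x q then 0
       else v x n - v x (- n))) as [c [Hc E]].
    - intros x. rewrite Rmin_left, Rmax_right by lra. intros Hx.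
      destruct (Req_EM_T x p); [lra|]. destruct (Req_EM_T x q); [lra|]. apply Jd; lra.
    - intros x. rewrite Rmin_left, Rmax_right by lra. intros Hx. apply Jc; lra.
    - rewrite Rmin_left, Rmax_right in Hc by lra. rewrite E.
      assert (HB : 0 <= B).
      { destruct (Hv (/ 4) ltac:(lra)) as [h _]. pose proof (Rabs_pos (v (/ 4) n)). lra. }
      destruct (Req_EM_T c p); [rewrite Rmult_0_l, Rabs_R0; trivial|].
      destruct (Req_EM_T c q); [rewrite Rmult_0_l, Rabs_R0; trivial|].
      destruct (Hv c ltac:(lra)) as [h1 h2].
      rewrite Rabs_mult. replace (q - p) with (/ 2) by lra.
      rewrite (Rabs_right (/ 2)) by lra.
      assert (Rabs (v c n - v c (- n)) <= 2 * B); [|lra].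
      apply Rabs_le_between in h1. apply Rabs_le_between in h2. apply Rabs_le_between. lra. }
  replace (RInt (u 1) (- n) n - RInt (u 0) (- n) n) with ((J 1 - J (/ 2)) + (J (/ 2) - J 0))
    by (unfold J; ring).
  eapply Rle_trans; [apply Rabs_triang|].
  pose proof (K (/ 2) 1 ltac:(lra) ltac:(lra) ltac:(lra) ltac:(lra)).
  pose proof (K 0 (/ 2) ltac:(lra) ltac:(lra) ltac:(lra) ltac:(lra)). lra.
Qed.

(** * Complex-valued integrals over the real line *)

Definition CII (f : R -> C) : C := (II (fun x => Re (f x)), II (fun x => Im (f x))).

Definition Cdominated (f : R -> C) (M : R) : Prop :=
  dominated (fun x => Re (f x)) M /\ dominated (fun x => Im (f x)) M.

Lemma Ccont_dominated (g : C -> C) x M : (forall y, Ccont g (x, y)) ->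
  (forall y, Cmod (g (x, y)) <= M / (1 + y ^ 2)) -> Cdominated (fun y => g (x, y)) M.
Proof.
  intros Hc Hb. split; split; intros y.
  - apply (continuity_2d_pt_snd (fun x y => Re (g (x, y)))), Ccont_2d, Hc.
  - eapply Rle_trans; [apply re_le_Cmod|apply Hb].
  - apply (continuity_2d_pt_snd (fun x y => Im (g (x, y)))), Ccont_2d, Hc.
  - eapply Rle_trans; [apply im_le_Cmod|apply Hb].
Qed.

Lemma CII_ext f g : (forall x, f x = g x) -> CII f = CII g.
Proof. intros H. unfold CII. f_equal; apply II_ext; intros; rewrite H; reflexivity. Qed.

Lemma Cdominated_ext f g M : (forall x, f x = g x) -> Cdominated f M -> Cdominated g M.
Proof.
  intros E [H1 H2]; split.
  - apply (dominated_ext (fun x => Re (f x))); trivial. intros; rewrite E; reflexivity.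
  - apply (dominated_ext (fun x => Im (f x))); trivial. intros; rewrite E; reflexivity.
Qed.

Lemma CII_bound f M : Cdominated f M -> Cmod (CII f) <= 2 * PI * M.
Proof.
  intros [H1 H2]. eapply Rle_trans; [apply Cmod_le_re_im|]. simpl.
  apply II_bound in H1. apply II_bound in H2. lra.
Qed.

(** The weight keeps its own constant [M0], so the integral is controlled by a uniform bound on [H].
    This converts the size of powers on a remote vertical line into the size of the integral. *)
Lemma CII_weight_bound (H : R -> C) (s : R -> R) a M0 M : dominated s M0 ->
  Cdominated (fun y => H y * s y)%C M -> (forall y, Cmod (H y) <= a) ->
  Cmod (CII (fun y => H y * s y)%C) <= 2 * PI * (a * M0).
Proof.
  intros HM [[C1 _] [C2 _]] Ha. apply CII_bound.
  assert (B : forall y, Cmod (H y * s y) <= a * M0 / (1 + y ^ 2)).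
  { intros y. rewrite Cmod_mult, Cmod_R. unfold Rdiv. rewrite Rmult_assoc.
    apply Rmult_le_compat; trivial; [apply Cmod_ge_0|apply Rabs_pos|]. apply HM. }
  split; split; trivial; intros y; (eapply Rle_trans; [|apply B]);
    [apply re_le_Cmod|apply im_le_Cmod].
Qed.

Lemma Cdominated_plus f g M N : Cdominated f M -> Cdominated g N ->
  Cdominated (fun x => f x + g x)%C (M + N).
Proof.
  intros [H1 H2] [H3 H4]; split.
  - apply (dominated_ext (fun x => Re (f x) + Re (g x))); [intros; rewrite re_plus; reflexivity|].
    apply dominated_plus; trivial.
  - apply (dominated_ext (fun x => Im (f x) + Im (g x))); [intros; rewrite im_plus; reflexivity|].
    apply dominated_plus; trivial.
Qed.

Lemma CII_plus f g M N : Cdominated f M -> Cdominated g N ->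
  CII (fun x => f x + g x)%C = (CII f + CII g)%C.
Proof.
  intros [H1 H2] [H3 H4]. unfold CII, Cplus; simpl. f_equal.
  - rewrite <- (II_plus _ _ M N) by trivial. apply II_ext; intros; apply re_plus.
  - rewrite <- (II_plus _ _ M N) by trivial. apply II_ext; intros; apply im_plus.
Qed.

Lemma Cdominated_scal f M c : Cdominated f M ->
  Cdominated (fun x => c * f x)%C ((Rabs (Re c) + Rabs (Im c)) * M).
Proof.
  intros [H1 H2]; split.
  - apply (dominated_ext (fun x => Re c * Re (f x) + (- Im c) * Im (f x))).
    { intros; rewrite re_mult; ring. }
    rewrite Rmult_plus_distr_r. rewrite <- (Rabs_Ropp (Im c)).
    apply dominated_plus; apply dominated_scal; trivial.
  - apply (dominated_ext (fun x => Re c * Im (f x) + Im c * Re (f x))).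
    { intros; rewrite im_mult; ring. }
    rewrite Rmult_plus_distr_r. apply dominated_plus; apply dominated_scal; trivial.
Qed.

Lemma CII_scal f M c : Cdominated f M -> CII (fun x => c * f x)%C = (c * CII f)%C.
Proof.
  intros [H1 H2]. unfold CII, Cmult; simpl. f_equal.
  - rewrite (II_ext _ (fun x => Re c * Re (f x) - Im c * Im (f x))) by (intros; apply re_mult).
    erewrite II_minus; [|apply dominated_scal; eassumption|apply dominated_scal; eassumption].
    erewrite !II_scal by eassumption. reflexivity.
  - rewrite (II_ext _ (fun x => Re c * Im (f x) + Im c * Re (f x))) by (intros; apply im_mult).
    erewrite II_plus; [|apply dominated_scal; eassumption|apply dominated_scal; eassumption].
    erewrite !II_scal by eassumption. reflexivity.
Qed.

Lemma CII_minus f g M N : Cdominated f M -> Cdominated g N ->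
  CII (fun x => f x - g x)%C = (CII f - CII g)%C.
Proof.
  intros H1 H2.
  rewrite (CII_ext _ (fun x => f x + - (1) * g x)%C) by (intros; ring).
  erewrite CII_plus; [|eassumption|apply Cdominated_scal; eassumption].
  erewrite CII_scal by eassumption. ring.
Qed.

Lemma inv_square_lim M : is_lim_seq (fun n => M / (1 + INR n ^ 2)) 0.
Proof.
  apply (is_lim_seq_le_le_loc (fun n => - Rabs M * / (INR n)) _ (fun n => Rabs M * / (INR n))).
  - exists 1%nat. intros n Hn. apply le_INR in Hn. simpl in Hn.
    assert (Hi : / (1 + INR n ^ 2) <= / INR n) by (apply Rinv_le_contravar; nra).
    assert (Hp : 0 < / (1 + INR n ^ 2)) by (apply Rinv_0_lt_compat; nra).
    pose proof (Rle_abs M). pose proof (Rle_abs (- M)). rewrite Rabs_Ropp in *.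
    pose proof (Rabs_pos M). unfold Rdiv. split; nra.
  - replace (Finite 0) with (Rbar_mult (- Rabs M) 0) by (simpl; f_equal; ring).
    apply is_lim_seq_scal_l. apply (is_lim_seq_inv _ p_infty); [apply is_lim_seq_INR|discriminate].
  - replace (Finite 0) with (Rbar_mult (Rabs M) 0) by (simpl; f_equal; ring).
    apply is_lim_seq_scal_l. apply (is_lim_seq_inv _ p_infty); [apply is_lim_seq_INR|discriminate].
Qed.

Lemma II_eq_of_small f g M N K : dominated f M -> dominated g N ->
  (forall n, (1 <= n)%nat ->
    Rabs (RInt f (- INR n) (INR n) - RInt g (- INR n) (INR n)) <= K / (1 + INR n ^ 2)) ->
  II f = II g.
Proof.
  intros H1 H2 H.
  assert (L : is_lim_seq (fun n => Rabs (RInt f (- INR n) (INR n) - RInt g (- INR n) (INR n)))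
    (Rabs (II f - II g))).
  { apply (is_lim_seq_abs _ (Finite _)). apply is_lim_seq_minus'; eapply II_lim; eassumption. }
  assert (L' : is_lim_seq (fun n => Rabs (RInt f (- INR n) (INR n) - RInt g (- INR n) (INR n))) 0).
  { apply (is_lim_seq_le_le_loc (fun _ => 0) _ (fun n => K / (1 + INR n ^ 2))).
    - exists 1%nat. intros n Hn. split; [apply Rabs_pos|apply H; trivial].
    - apply is_lim_seq_const.
    - apply inv_square_lim. }
  apply is_lim_seq_unique in L. apply is_lim_seq_unique in L'. rewrite L in L'.
  injection L' as L'. apply Rminus_diag_uniq.
  destruct (Req_dec (II f - II g) 0); trivial. apply Rabs_no_R0 in H0. lra.
Qed.

(* Cauchy's theorem on tall rectangles; the removable point [1/2] lies on the line [x = 1/2], off which the vertical integral is differentiable in [x]. *)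
Lemma strip_shift (g G : C -> C) (M M0 M1 d : R) : 0 < d ->
  (forall x y, - d < x < 1 + d -> Ccont g (x, y)) ->
  (forall x y, 0 < x < 1 -> x <> / 2 -> Cdiff g (x, y) (G (x, y)) /\ Ccont G (x, y)) ->
  (forall x y, 0 < x < 1 -> 1 <= Rabs y -> Cmod (g (x, y)) <= M / (1 + y ^ 2)) ->
  Cdominated (fun y => g (0, y)) M0 -> Cdominated (fun y => g (1, y)) M1 ->
  CII (fun y => g (1, y)) = CII (fun y => g (0, y)).
Proof.
  intros Hd Hc HG Hb [D1 D2] [D3 D4]. unfold CII.
  assert (HB : forall (n : nat) x, (1 <= n)%nat -> 0 < x < 1 ->
     Cmod (g (x, INR n)) <= M / (1 + INR n ^ 2) /\ Cmod (g (x, - INR n)) <= M / (1 + INR n ^ 2)).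
  { intros n x Hn Hx. apply le_INR in Hn. simpl in Hn. split.
    - apply Hb; trivial. rewrite Rabs_right; lra.
    - replace (INR n ^ 2) with ((- INR n) ^ 2) by ring. apply Hb; trivial.
      rewrite Rabs_Ropp, Rabs_right; lra. }
  f_equal.
  - apply (II_eq_of_small _ _ M1 M0 (2 * M)); trivial. intros n Hn.
    unfold Rdiv; rewrite Rmult_assoc.
    apply (real_shift (fun x y => Re (g (x, y))) (fun x y => Im (g (x, y)))
      (fun x y => Re (G (x, y))) (INR n) (M / (1 + INR n ^ 2)) d); trivial.
    + apply pos_INR.
    + intros x y Hx. apply Ccont_2d, Hc, Hx.
    + intros x y Hx Hx2. destruct (HG x y Hx Hx2) as [h1 h2]. split; [|split].
      * apply (Cdiff_dx _ _ _ _ h1).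
      * apply (Cdiff_dy _ _ _ _ h1).
      * apply (Ccont_2d _ _ _ h2).
    + intros x Hx. destruct (HB n x Hn Hx). split; (eapply Rle_trans; [apply im_le_Cmod|trivial]).
  (* The imaginary part of g is the real part of -ig, whose imaginary part is - Re g. *)
  - apply (II_eq_of_small _ _ M1 M0 (2 * M)); trivial. intros n Hn.
    unfold Rdiv; rewrite Rmult_assoc.
    apply (real_shift (fun x y => Im (g (x, y))) (fun x y => - Re (g (x, y)))
      (fun x y => Im (G (x, y))) (INR n) (M / (1 + INR n ^ 2)) d); trivial.
    + apply pos_INR.
    + intros x y Hx. apply Ccont_2d, Hc, Hx.
    + intros x y Hx Hx2. destruct (HG x y Hx Hx2) as [h1 h2]. split; [|split].
      * apply (Cdiff_dx _ _ _ _ h1).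
      * destruct (Cdiff_dy _ _ _ _ h1) as [h3 _].
        apply (is_derive_opp (V := R_NormedModule)) in h3. unfold opp in h3; simpl in h3.
        rewrite Ropp_involutive in h3. exact h3.
      * apply (Ccont_2d _ _ _ h2).
    + intros x Hx. destruct (HB n x Hn Hx).
      split; rewrite Rabs_Ropp; (eapply Rle_trans; [apply re_le_Cmod|trivial]).
Qed.

Lemma Cdiff_path f f' (z w : C) (t : R) : Cdiff f (z + t * w)%C f' ->
  is_derive (fun t : R => Re (f (z + t * w)%C)) t (Re (w * f')%C) /\
  is_derive (fun t : R => Im (f (z + t * w)%C)) t (Im (w * f')%C).
Proof.
  intros H.
  assert (D : Cdiff (fun u => f (z + u * w)%C) (t, 0) (w * f')%C).
  { eapply Cdiff_eq; [|apply (Cdiff_comp f (fun u => z + u * w)%C); [exact H|]].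
    2: { apply Cdiff_plus; [apply Cdiff_const|].
         apply Cdiff_mult; [apply Cdiff_id|apply Cdiff_const]. }
    cbv beta; ring. }
  exact (Cdiff_dx _ _ _ _ D).
Qed.

Lemma path_mvt (f f' : C -> C) (z w : C) (G g : R -> R) :
  (forall t, 0 <= t <= 1 -> Cdiff f (z + t * w)%C (f' (z + t * w)%C)) ->
  (forall t, 0 <= t <= 1 -> is_derive G t (g t)) ->
  (forall t, 0 <= t <= 1 -> Cmod (w * f' (z + t * w))%C <= g t) ->
  Cmod (f (z + w) - f z)%C <= G 1 - G 0.
Proof.
  intros Hf HG Hb.
  eapply Rle_trans; [|apply (norm_mvt
    (fun t : R => Re (f (z + t * w)%C)) (fun t : R => Im (f (z + t * w)%C))
    (fun t : R => Re (w * f' (z + t * w))%C) (fun t : R => Im (w * f' (z + t * w))%C) G g); trivial].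
  - right. f_equal. rewrite (C_eta (f (z + w) - f z)%C).
    replace (z + 1 * w)%C with (z + w)%C by ring. replace (z + 0 * w)%C with z by ring.
    unfold Cminus. rewrite re_plus, im_plus, re_opp, im_opp. reflexivity.
  - intros t Ht. apply Cdiff_path, Hf, Ht.
  - intros t Ht. apply Cdiff_path, Hf, Ht.
Qed.

(** The bound on [f'] is integrated along the segment from [c]; the gain 1/(k+1) is given away. It
    turns continuity of the highest derivative into a little-o Taylor remainder. *)
Lemma little_o_primitive (f f' : C -> C) (c : C) (k : nat) (eps d : R) :
  0 <= eps -> (forall w, Cmod w < d -> Cdiff f (c + w)%C (f' (c + w)%C)) ->
  f c = RtoC 0 ->
  (forall w, Cmod w < d -> Cmod (f' (c + w)%C) <= eps * Cmod w ^ k) ->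
  forall w, Cmod w < d -> Cmod (f (c + w)%C) <= eps * Cmod w ^ S k.
Proof.
  intros He Hf H0 Hb w Hw.
  assert (HS : 0 < INR (S k)) by (rewrite S_INR; pose proof (pos_INR k); lra).
  pose proof (Cmod_ge_0 w) as W0.
  assert (Hs : forall t : R, 0 <= t <= 1 -> Cmod (t * w) < d).
  { intros t Ht. rewrite Cmod_mult, Cmod_R, Rabs_right by lra. nra. }
  set (K := eps * Cmod w ^ S k).
  assert (HK : 0 <= K) by (apply Rmult_le_pos; trivial; apply pow_le; trivial).
  replace (f (c + w)%C) with (f (c + w) - f c)%C by (rewrite H0; ring).
  eapply Rle_trans.
  - apply (path_mvt f f' c w (fun t => K / INR (S k) * t ^ S k) (fun t => K * t ^ k)).
    + intros t Ht. apply Hf, Hs, Ht.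
    + intros t _. replace (K * t ^ k) with (K / INR (S k) * (INR (S k) * t ^ k)) by (field; lra).
      apply is_derive_scal, is_derive_pow_S.
    + intros t Ht. rewrite Cmod_mult.
      eapply Rle_trans; [apply Rmult_le_compat_l; [trivial|apply Hb, Hs, Ht]|].
      rewrite Cmod_mult, Cmod_R, Rabs_right, Rpow_mult_distr by lra.
      right. unfold K. simpl. ring.
  - rewrite pow1, pow_i by lia.
    assert (1 <= INR (S k)) by (rewrite S_INR; pose proof (pos_INR k); lra).
    apply Rmult_le_reg_r with (INR (S k)); trivial.
    replace ((K / INR (S k) * 1 - K / INR (S k) * 0) * INR (S k)) with K by (field; lra).
    nra.
Qed.

(** As |Log z| differs from |ln |z|| by less than pi/2, this is polynomial growth in |z| and 1/|z|.
    Measured through |Log z| it holds at once for z, Log z and all complex powers, and products add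
    the exponents. *)
Definition growth (h : C -> C) (K : R) (m : nat) : Prop :=
  0 <= K /\ forall z, 0 < Re z -> Cmod (h z) <= K * exp (INR m * Cmod (Clog z)).

Lemma growth_le h K m K' m' : K <= K' -> (m <= m')%nat -> growth h K m -> growth h K' m'.
Proof.
  intros HK Hm [H0 H]. split; [lra|]. intros z Hz. eapply Rle_trans; [apply H, Hz|].
  apply Rmult_le_compat; trivial; [left; apply exp_pos|].
  apply exp_incr. apply Rmult_le_compat_r; [apply Cmod_ge_0|]. apply le_INR; trivial.
Qed.

Lemma growth_plus h1 h2 K1 K2 m : growth h1 K1 m -> growth h2 K2 m ->
  growth (fun z => h1 z + h2 z)%C (K1 + K2) m.
Proof.
  intros [A1 B1] [A2 B2]. split; [lra|]. intros z Hz.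
  eapply Rle_trans; [apply Cmod_triangle|]. specialize (B1 z Hz). specialize (B2 z Hz). lra.
Qed.

Lemma growth_minus h1 h2 K1 K2 m : growth h1 K1 m -> growth h2 K2 m ->
  growth (fun z => h1 z - h2 z)%C (K1 + K2) m.
Proof.
  intros [A1 B1] [A2 B2]. split; [lra|]. intros z Hz.
  eapply Rle_trans; [apply Cmod_triangle|]. rewrite Cmod_opp.
  specialize (B1 z Hz). specialize (B2 z Hz). lra.
Qed.

Lemma growth_mult h1 h2 K1 K2 m1 m2 : growth h1 K1 m1 -> growth h2 K2 m2 ->
  growth (fun z => h1 z * h2 z)%C (K1 * K2) (m1 + m2).
Proof.
  intros [A1 B1] [A2 B2]. split; [nra|]. intros z Hz.
  rewrite Cmod_mult, plus_INR, Rmult_plus_distr_r, exp_plus.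
  replace (K1 * K2 * (exp (INR m1 * Cmod (Clog z)) * exp (INR m2 * Cmod (Clog z)))) with
   (K1 * exp (INR m1 * Cmod (Clog z)) * (K2 * exp (INR m2 * Cmod (Clog z)))) by ring.
  apply Rmult_le_compat; auto; apply Cmod_ge_0.
Qed.

Lemma growth_const c : growth (fun _ => c) (Cmod c) 0.
Proof.
  split; [apply Cmod_ge_0|]. intros z _. simpl. rewrite Rmult_0_l, exp_0. lra.
Qed.

Lemma growth_id : growth (fun z => z) 1 1.
Proof.
  split; [lra|]. intros z Hz. rewrite <- (Cexp_Clog z) at 1 by trivial.
  simpl. rewrite !Rmult_1_l. apply Cmod_Cexp_le.
Qed.

Lemma Cmod_cpower_le z a m : Cmod a <= INR m ->
  Cmod (cpower z a) <= exp (INR m * Cmod (Clog z)).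
Proof.
  intros H. unfold cpower. eapply Rle_trans; [apply Cmod_Cexp_le|].
  rewrite Cmod_mult. apply exp_incr. apply Rmult_le_compat_r; [apply Cmod_ge_0|trivial].
Qed.

Lemma growth_cpower a m : Cmod a <= INR m -> growth (fun z => cpower z a) 1 m.
Proof. intros H. split; [lra|]. intros z _. rewrite Rmult_1_l. apply Cmod_cpower_le, H. Qed.

(** With q = 1 + B + |y| one has |Log z| <= |ln b| + ln q + 2, the 2 bounding the argument. The
    resulting q^m, with q^2 more to pay for 1 + y^2, is at most (m+2)! e^q, and e^q exp(-pi |y|) <=
    e^(1+B). *)
Definition strip_const (m : nat) (b B : R) : R :=
  exp (INR m * (Rabs (ln b) + 2)) * (INR (fact (m + 2)) * exp (1 + B)).

Lemma Clog_strip_bound (m : nat) (b B x y : R) : 0 < b -> b <= x <= B ->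
  exp (INR m * Cmod (Clog (x, y))) * exp (- (PI * Rabs y)) <= strip_const m b B / (1 + y ^ 2).
Proof.
  intros Hb [Hx1 Hx2].
  pose proof (Rabs_pos y) as Hy. set (q := 1 + B + Rabs y).
  assert (Hq : 1 <= q) by (unfold q; lra).
  assert (Hc0 : 0 < Cmod (x, y)) by (apply Cmod_pos_re; simpl; lra).
  assert (HL : Cmod (Clog (x, y)) <= Rabs (ln b) + ln q + 2).
  { eapply Rle_trans; [apply Cmod_le_re_im|]. simpl.
    pose proof (atan_bound (y / x)). pose proof PI_4.
    assert (Rabs (atan (y / x)) <= 2) by (apply Rabs_le_between; lra).
    assert (Hc1 : Cmod (x, y) <= q).
    { eapply Rle_trans; [apply Cmod_le_re_im|]. simpl. rewrite Rabs_right by lra. unfold q; lra. }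
    assert (Hc2 : b <= Cmod (x, y)).
    { eapply Rle_trans; [|apply re_le_Cmod]. simpl. rewrite Rabs_right; lra. }
    assert (ln b <= ln (Cmod (x, y))) by (apply ln_le; trivial).
    assert (ln (Cmod (x, y)) <= ln q) by (apply ln_le; trivial).
    assert (0 <= ln q) by (rewrite <- ln_1; apply ln_le; lra).
    pose proof (Rle_abs (- ln b)). rewrite Rabs_Ropp in *.
    pose proof (Rabs_pos (ln b)).
    assert (Rabs (ln (Cmod (x, y))) <= Rabs (ln b) + ln q) by (apply Rabs_le_between; lra).
    lra. }
  assert (HE : exp (INR m * Cmod (Clog (x, y))) <= exp (INR m * (Rabs (ln b) + 2)) * q ^ m).
  { rewrite <- Rpower_pow by lra. unfold Rpower. rewrite <- exp_plus. apply exp_incr.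
    pose proof (pos_INR m). nra. }
  pose proof (exp_sum_term q (m + 2) ltac:(lra)) as HT.
  pose proof (INR_fact_pos (m + 2)) as Hf.
  assert (HT2 : q ^ (m + 2) <= INR (fact (m + 2)) * exp q).
  { apply (Rmult_le_compat_l (INR (fact (m + 2)))) in HT; [|lra].
    replace (INR (fact (m + 2)) * (q ^ (m + 2) / INR (fact (m + 2)))) with (q ^ (m + 2)) in HT
      by (field; lra). trivial. }
  assert (Hy2 : 1 + y ^ 2 <= q ^ 2).
  { replace (y ^ 2) with (Rabs y ^ 2) by (rewrite pow2_abs; ring). unfold q; nra. }
  assert (Hpi : exp q * exp (- (PI * Rabs y)) <= exp (1 + B)).
  { rewrite <- exp_plus. apply exp_incr. unfold q. pose proof PI2_1. nra. }
  apply Rmult_le_reg_r with (1 + y ^ 2); [nra|].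
  unfold Rdiv. rewrite Rmult_assoc with (r2 := / (1 + y ^ 2)), Rinv_l, Rmult_1_r by nra.
  unfold strip_const. set (E := exp (INR m * (Rabs (ln b) + 2))) in *.
  assert (E0 : 0 < E) by apply exp_pos.
  pose proof (exp_pos (- (PI * Rabs y))) as P0.
  apply Rle_trans with (E * q ^ m * exp (- (PI * Rabs y)) * (q ^ 2)).
  { apply Rmult_le_compat; trivial.
    - apply Rmult_le_pos; left; apply exp_pos.
    - nra.
    - apply Rmult_le_compat_r; lra. }
  replace (E * q ^ m * exp (- (PI * Rabs y)) * q ^ 2) with
    (E * (q ^ (m + 2) * exp (- (PI * Rabs y)))) by (rewrite pow_add; ring).
  apply Rmult_le_compat_l; [lra|].
  apply Rle_trans with (INR (fact (m + 2)) * exp q * exp (- (PI * Rabs y))).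
  - apply Rmult_le_compat_r; lra.
  - rewrite Rmult_assoc. apply Rmult_le_compat_l; lra.
Qed.

Lemma C_shift_pair (b x y : R) : (b + (x, y))%C = (b + x, y)%R.
Proof. unfold Cplus, RtoC; simpl. f_equal; ring. Qed.

Lemma growth_strip_bound h K m b B (x y : R) (w : C) D : 0 < b -> b <= x <= B ->
  growth h K m -> 0 <= D -> Cmod w <= D * exp (- (PI * Rabs y)) ->
  Cmod (h (x, y) * w) <= K * D * strip_const m b B / (1 + y ^ 2).
Proof.
  intros Hb Hx [HK Hh] HD Hw. rewrite Cmod_mult.
  pose proof (Clog_strip_bound m b B x y Hb Hx) as H.
  assert (Hh' := Hh (x, y) ltac:(simpl; lra)).
  eapply Rle_trans; [apply Rmult_le_compat; [apply Cmod_ge_0|apply Cmod_ge_0|apply Hh'|apply Hw]|].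
  replace (K * exp (INR m * Cmod (Clog (x, y))) * (D * exp (- (PI * Rabs y)))) with
   (K * D * (exp (INR m * Cmod (Clog (x, y))) * exp (- (PI * Rabs y)))) by ring.
  unfold Rdiv. rewrite (Rmult_assoc (K * D) (strip_const m b B)).
  apply Rmult_le_compat_l; [nra|apply H].
Qed.

(** The kernel has a pole of order at most [k] at 1/2, and [h] is required to be o(|w|^k) rather
    than O(|w|^k): the product then tends to 0 at the pole, which is the value the code assigns to
    it there. The constant 16 is the square of the 4 in [kern_decay], so that it serves both
    kernels. *)
Lemma shift_kernel (ka ka' h h' : C -> C) (b K : R) (m k : nat) : 0 < b ->
  (forall z, - / 2 < Re z < 1 + / 2 -> z <> (/ 2)%R -> Cdiff ka z (ka' z) /\ Ccont ka' z) ->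
  (forall x y, 0 <= x <= 1 -> (1 <= Rabs y \/ x = 0 \/ x = 1) ->
     Cmod (ka (x, y)) <= 16 * exp (- (PI * Rabs y))) ->
  (forall z, 0 <= Re z <= 1 -> z <> (/ 2)%R -> Cmod (ka z) * Cmod (z - (/ 2)%R) ^ k <= 1) ->
  (forall z, 0 < Re z -> Cdiff h z (h' z) /\ Ccont h' z) -> growth h K m ->
  h (b + / 2)%R = RtoC 0 ->
  (forall eps, 0 < eps -> exists d, 0 < d /\ forall w, Cmod w < d ->
      Cmod (h ((b + / 2)%R + w)%C) <= eps * Cmod w ^ k) ->
  CII (fun y => h (b + (1, y))%C * ka (1, y))%C = CII (fun y => h (b + (0, y))%C * ka (0, y))%C.
Proof.
  intros Hb Hka Hkd Hks Hh Hg Hc Ho.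
  (* This margin keeps b + z in the right half-plane and z in the strip where 1/2 is the only
     singular point. *)
  set (d := Rmin (b / 2) (/ 2)).
  assert (Hd : 0 < d) by (apply Rmin_pos; lra).
  assert (Hd1 : d <= b / 2) by apply Rmin_l. assert (Hd2 : d <= / 2) by apply Rmin_r.
  assert (Hcont : forall x y, - d < x < 1 + d -> Ccont (fun z => h (b + z) * ka z)%C (x, y)).
  { intros x y Hx.
    destruct (excluded_middle_informative ((x, y) = RtoC (/ 2))) as [E|E].
    (* At the pole the product is 0 times the default value of [ka]. Nearby, |ka| |z - 1/2|^k <= 1
       leaves at most e / 2. *)
    - rewrite E. intros e He. destruct (Ho (e / 2) ltac:(lra)) as [r [Hr H]].
      exists (Rmin r (/ 2)). split; [apply Rmin_pos; lra|]. intros z Hz.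
      assert (Z1 : Cmod (z - (/ 2)%R) < r) by (eapply Rlt_le_trans; [apply Hz|apply Rmin_l]).
      assert (Z2 : Cmod (z - (/ 2)%R) < / 2) by (eapply Rlt_le_trans; [apply Hz|apply Rmin_r]).
      rewrite <- RtoC_plus, Hc.
      destruct (excluded_middle_informative (z = (/ 2)%R)) as [->|Ez].
      { rewrite <- RtoC_plus, Hc. replace (0 * ka (/ 2)%R - 0 * ka (/ 2)%R)%C with (RtoC 0) by ring.
        rewrite Cmod_0; trivial. }
      replace (h (b + z) * ka z - 0 * ka (/ 2)%R)%C with (h (b + z) * ka z)%C by ring.
      rewrite Cmod_mult.
      assert (HR : 0 <= Re z <= 1).
      { pose proof (re_le_Cmod (z - (/ 2)%R)) as Q. unfold Cminus in Q at 1.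
        rewrite re_plus, re_opp, re_RtoC in Q.
        assert (Q' := Rle_lt_trans _ _ _ Q Z2). apply Rabs_def2 in Q'. lra. }
      specialize (Hks z HR Ez). specialize (H _ Z1).
      replace ((b + / 2)%R + (z - (/ 2)%R))%C with (b + z)%C in H by (rewrite RtoC_plus; ring).
      pose proof (Cmod_ge_0 (ka z)).
      apply Rle_lt_trans with (e / 2 * Cmod (z - (/ 2)%R) ^ k * Cmod (ka z)).
      + apply Rmult_le_compat_r; trivial.
      + nra.
    - apply Ccont_mult.
      + apply (Ccont_comp h (fun z => b + z)%C).
        * destruct (Hh (b + (x, y))%C) as [Hh1 _].
          { rewrite C_shift_pair; simpl; lra. }
          apply (Cdiff_Ccont _ _ _ Hh1).
        * apply (Ccont_plus (fun _ => RtoC b) (fun z => z)); [apply Ccont_const|apply Ccont_id].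
      + destruct (Hka (x, y)) as [H1 _]; trivial; [simpl; lra|]. apply (Cdiff_Ccont _ _ _ H1). }
  assert (Hbound : forall x y, 0 <= x <= 1 -> (1 <= Rabs y \/ x = 0 \/ x = 1) ->
     Cmod (h (b + (x, y)) * ka (x, y))%C <= K * 16 * strip_const m b (b + 1) / (1 + y ^ 2)).
  { intros x y Hx Hy. rewrite C_shift_pair. apply growth_strip_bound; trivial; try lra.
    apply Hkd; trivial. }
  apply (strip_shift (fun z => h (b + z) * ka z)%C
    (fun z => (h' (b + z) * 1) * ka z + h (b + z) * ka' z)%C
    (K * 16 * strip_const m b (b + 1)) (K * 16 * strip_const m b (b + 1))
    (K * 16 * strip_const m b (b + 1)) d); trivial.
  - intros x y Hx Hx2.
    assert (Exy : (x, y) <> RtoC (/ 2)) by (intros E; injection E; intros; lra).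
    destruct (Hka (x, y)) as [H1 H2]; trivial; [simpl; lra|].
    destruct (Hh (b + (x, y))%C) as [H3 H4]; [rewrite C_shift_pair; simpl; lra|].
    assert (Hsh : Ccont (fun z => b + z)%C (x, y)).
    { apply (Ccont_plus (fun _ => RtoC b) (fun z => z)); [apply Ccont_const|apply Ccont_id]. }
    split.
    + apply (Cdiff_mult (fun z => h (b + z))%C ka); trivial. apply (Cdiff_comp h (fun z => b + z)%C (x, y)); trivial.
      eapply Cdiff_eq; [|apply Cdiff_plus; [apply Cdiff_const|apply Cdiff_id]]. ring.
    + assert (Q1 : Ccont (fun z => h' (b + z)%C) (x, y))
        by (apply (Ccont_comp h' (fun z => b + z)%C (x, y)); trivial).
      assert (Q2 : Ccont (fun z => h (b + z)%C) (x, y)).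
      { apply (Ccont_comp h (fun z => b + z)%C (x, y)); trivial. apply (Cdiff_Ccont _ _ _ H3). }
      pose proof (Cdiff_Ccont _ _ _ H1) as Q3.
      apply (Ccont_plus (fun z => h' (b + z) * 1 * ka z)%C (fun z => h (b + z) * ka' z)%C).
      * apply (Ccont_mult (fun z => h' (b + z) * 1)%C ka); trivial.
        apply (Ccont_mult (fun z => h' (b + z))%C); trivial. apply Ccont_const.
      * apply (Ccont_mult (fun z => h (b + z))%C); trivial.
  - intros x y Hx Hy. apply Hbound; auto; lra.
  - apply (Ccont_dominated (fun z => h (b + z) * ka z)%C).
    + intros; apply Hcont; lra.
    + intros; apply Hbound; auto; lra.
  - apply (Ccont_dominated (fun z => h (b + z) * ka z)%C).
    + intros; apply Hcont; lra.
    + intros; apply Hbound; auto; lra.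
Qed.

(** * The kernels 1/cos and 1/cos^2 *)

(** This is cos(pi z), followed by its derivative. The scaling puts the zeros at the half-integers,
    so that 1/2 is the only one in the closed unit strip. *)
Definition ccos (z : C) : C := ((Cexp (Ci * PI * z) + Cexp (- (Ci * PI * z))) * / 2)%C.
Definition ccos' (z : C) : C := ((Cexp (Ci * PI * z) - Cexp (- (Ci * PI * z))) * (Ci * PI * / 2))%C.

Lemma ccos_pair x y :
  ccos (x, y) = (cos (PI * x) * cosh (PI * y), - (sin (PI * x) * sinh (PI * y))).
Proof.
  unfold ccos. replace (Ci * PI * (x, y))%C with (- (PI * y), PI * x).
  2: { unfold Ci, RtoC, Cmult; simpl; f_equal; ring. }
  rewrite <- RtoC_inv by lra. unfold Cexp, Copp, Cplus, Cmult; simpl.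
  rewrite Ropp_involutive, cos_neg, sin_neg. unfold cosh, sinh. f_equal; field.
Qed.

Lemma cosh_pos x : 0 < cosh x.
Proof. unfold cosh. pose proof (exp_pos x). pose proof (exp_pos (- x)). lra. Qed.

Lemma cosh_sq x : cosh x ^ 2 = 1 + sinh x ^ 2.
Proof.
  unfold cosh, sinh. assert (E : exp x * exp (- x) = 1) by (rewrite <- exp_plus, Rplus_opp_r; apply exp_0).
  nra.
Qed.

Lemma ccos_sq x y : Cmod (ccos (x, y)) ^ 2 = cos (PI * x) ^ 2 + sinh (PI * y) ^ 2.
Proof.
  rewrite ccos_pair, Cmod2_alt. simpl Re. simpl Im.
  pose proof (sin2_cos2 (PI * x)) as H. unfold Rsqr in H. pose proof (cosh_sq (PI * y)).
  rewrite Rpow_mult_distr, H0.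
  replace ((- (sin (PI * x) * sinh (PI * y))) ^ 2) with (sin (PI * x) * sin (PI * x) * sinh (PI * y) ^ 2) by ring.
  replace (sin (PI * x) * sin (PI * x)) with (1 - cos (PI * x) * cos (PI * x)) by lra. ring.
Qed.

Lemma ccos_0 y : ccos (0, y) = RtoC (cosh (PI * y)).
Proof.
  rewrite ccos_pair, Rmult_0_r, cos_0, sin_0. unfold RtoC. f_equal; ring.
Qed.

Lemma ccos_1 y : ccos (1, y) = RtoC (- cosh (PI * y)).
Proof.
  rewrite ccos_pair, Rmult_1_r, cos_PI, sin_PI. unfold RtoC. f_equal; ring.
Qed.

Lemma sinh_ge u : 0 <= u -> u <= sinh u.
Proof.
  intros Hu.
  destruct (MVT_gen (fun t => sinh t - t) 0 u (fun t => cosh t - 1)) as [t [Ht E]].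
  - intros t _. unfold sinh, cosh. auto_derive; trivial. field.
  - intros t _. apply continuity_pt_filterlim.
    apply (real_derive_continuous (fun t => sinh t - t)).
    unfold sinh. auto_derive; trivial.
  - rewrite Rmin_left, Rmax_right in Ht by lra.
    assert (1 <= cosh t).
    { pose proof (cosh_pos t). pose proof (cosh_sq t). nra. }
    rewrite sinh_0 in E. nra.
Qed.

Lemma sinh_odd u : sinh (- u) = - sinh u.
Proof. unfold sinh. rewrite Ropp_involutive. field. Qed.

Lemma sinh_sq_ge u : u ^ 2 <= sinh u ^ 2.
Proof.
  destruct (Rle_dec 0 u) as [h|h].
  - pose proof (sinh_ge u h). nra.
  - pose proof (sinh_ge (- u) ltac:(lra)). rewrite sinh_odd in H. nra.
Qed.

(** In sin v >= v - v^3/6 the bound v^2 <= 4 leaves v/3, and pi > 3. The weak constant is enough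
    because the argument in [ccos_lower] carries a factor pi. *)
Lemma sin_lower v : 0 <= v <= PI / 2 -> v <= PI * sin v.
Proof.
  intros [H1 H2]. pose proof PI_4. pose proof PI2_3_2.
  assert (Hv4 : v <= 4) by lra.
  destruct (pre_sin_bound v 0 H1 Hv4) as [H3 _].
  unfold sin_approx in H3. simpl in H3. unfold sin_term in H3. simpl in H3.
  assert (H4 : v - v * v * v / 6 <= sin v) by (eapply Rle_trans; [|apply H3]; right; field).
  assert (v * v <= 4) by nra.
  assert (v / 3 <= sin v) by nra. nra.
Qed.

(** In |cos pi z|^2 = cos^2(pi x) + sinh^2(pi y) the two squares dominate (x - 1/2)^2 and y^2
    separately. Hence the kernel has a pole of order at most one, with constant 1. *)
Lemma ccos_lower z : 0 <= Re z <= 1 -> Cmod (z - (/ 2)%R) <= Cmod (ccos z).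
Proof.
  destruct z as [x y]; simpl Re. intros Hx.
  apply Rsqr_incr_0_var; [|apply Cmod_ge_0]. unfold Rsqr.
  assert (E1 : Cmod ((x, y) - (/ 2)%R) * Cmod ((x, y) - (/ 2)%R) = (x - / 2) ^ 2 + y ^ 2).
  { transitivity (Cmod ((x, y) - (/ 2)%R) ^ 2); [ring|].
    rewrite Cmod2_alt. unfold Cminus. rewrite re_plus, im_plus, re_opp, im_opp, re_RtoC, im_RtoC.
    simpl Re. simpl Im. ring. }
  assert (E2 : Cmod (ccos (x, y)) * Cmod (ccos (x, y)) = cos (PI * x) ^ 2 + sinh (PI * y) ^ 2)
    by (rewrite <- ccos_sq; ring).
  rewrite E1, E2. pose proof PI2_1 as HP.
  pose proof (sinh_sq_ge (PI * y)) as Hs.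
  assert (y ^ 2 <= (PI * y) ^ 2) by (assert (1 <= PI ^ 2) by nra; pose proof (pow2_ge_0 y); rewrite Rpow_mult_distr; nra).
  assert ((x - / 2) ^ 2 <= cos (PI * x) ^ 2); [|lra].
  replace (cos (PI * x)) with (sin (PI * (/ 2 - x))).
  2: { rewrite <- sin_shift. f_equal. field. }
  destruct (Rle_dec x (/ 2)) as [h|h].
  - pose proof (sin_lower (PI * (/ 2 - x)) ltac:(nra)).
    assert (/ 2 - x <= sin (PI * (/ 2 - x))) by nra. nra.
  - pose proof (sin_lower (PI * (x - / 2)) ltac:(nra)).
    assert (x - / 2 <= sin (PI * (x - / 2))) by nra.
    replace (PI * (/ 2 - x)) with (- (PI * (x - / 2))) by ring. rewrite sin_neg. nra.
Qed.

Lemma ccos_neq_0 z : - / 2 < Re z < 1 + / 2 -> z <> RtoC (/ 2) -> ccos z <> RtoC 0.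
Proof.
  destruct z as [x y]; simpl Re. intros Hx Hz H.
  pose proof (ccos_sq x y) as E. rewrite H, Cmod_0 in E. pose proof PI_RGT_0 as HP.
  pose proof (sinh_sq_ge (PI * y)).
  assert (Hy : y = 0).
  { assert ((PI * y) ^ 2 = 0) by nra. assert (PI * y = 0) by nra. nra. }
  subst y. assert (Hc : cos (PI * x) = 0) by nra.
  destruct (Rtotal_order x (/ 2)) as [h|[h|h]].
  - pose proof (cos_gt_0 (PI * x) ltac:(nra) ltac:(nra)). lra.
  - apply Hz. subst x. reflexivity.
  - pose proof (cos_lt_0 (PI * x) ltac:(nra) ltac:(nra)). lra.
Qed.

Lemma Cdiff_ccos z : Cdiff ccos z (ccos' z).
Proof.
  assert (D : Cdiff (fun z => Ci * PI * z)%C z (Ci * PI)%C).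
  { eapply Cdiff_eq; [|apply Cdiff_scal, Cdiff_id]. ring. }
  assert (D' : Cdiff (fun z => - (Ci * PI * z))%C z (- (Ci * PI))%C).
  { eapply Cdiff_eq; [|eapply Cdiff_ext; [|apply (Cdiff_scal (- (Ci * PI))%C); apply Cdiff_id]];
    [ring|intros; cbv beta; ring]. }
  unfold ccos. eapply Cdiff_eq.
  2: { apply (Cdiff_mult (fun z => Cexp (Ci * PI * z) + Cexp (- (Ci * PI * z)))%C (fun _ => / 2)%C).
       - apply Cdiff_plus.
         + apply (Cdiff_comp Cexp (fun z => Ci * PI * z)%C); [apply Cdiff_Cexp|exact D].
         + apply (Cdiff_comp Cexp (fun z => - (Ci * PI * z))%C); [apply Cdiff_Cexp|exact D'].
       - apply Cdiff_const. }
  unfold ccos'. cbv beta. ring.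
Qed.

Lemma Ccont_ccos' z : Ccont ccos' z.
Proof.
  unfold ccos'. apply (Ccont_mult (fun z => Cexp (Ci * PI * z) - Cexp (- (Ci * PI * z)))%C); [|apply Ccont_const].
  assert (D : Ccont (fun z => Ci * PI * z)%C z).
  { apply (Ccont_mult (fun _ => Ci * PI)%C); [apply Ccont_const|apply Ccont_id]. }
  assert (D' : Ccont (fun z => - (Ci * PI * z))%C z).
  { apply (Ccont_ext (fun z => - (Ci * PI) * z)%C); [intros; ring|].
    apply (Ccont_mult (fun _ => - (Ci * PI))%C); [apply Ccont_const|apply Ccont_id]. }
  apply (Ccont_ext (fun z => Cexp (Ci * PI * z) + - (1) * Cexp (- (Ci * PI * z)))%C); [intros; ring|].
  apply (Ccont_plus (fun z => Cexp (Ci * PI * z))%C).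
  - apply (Ccont_comp Cexp (fun z => Ci * PI * z)%C); trivial. apply (Cdiff_Ccont _ _ _ (Cdiff_Cexp _)).
  - apply (Ccont_mult (fun _ => - (1))%C); [apply Ccont_const|].
    apply (Ccont_comp Cexp (fun z => - (Ci * PI * z))%C); trivial. apply (Cdiff_Ccont _ _ _ (Cdiff_Cexp _)).
Qed.

Definition kern (z : C) : C := (/ ccos z)%C.
Definition kern' (z : C) : C := (- ccos' z / (ccos z * ccos z))%C.

Lemma Cdiff_kern z : - / 2 < Re z < 1 + / 2 -> z <> RtoC (/ 2) ->
  Cdiff kern z (kern' z) /\ Ccont kern' z.
Proof.
  intros H1 H2. pose proof (ccos_neq_0 z H1 H2) as Hn. split.
  - apply (Cdiff_inv ccos); trivial. apply Cdiff_ccos.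
  - apply (Ccont_ext (fun z => (- (1) * ccos' z) * / (ccos z * ccos z))%C).
    { intros w. unfold kern', Cdiv. ring. }
    pose proof (Cdiff_Ccont _ _ _ (Cdiff_ccos z)) as Hc.
    apply (Ccont_mult (fun z => - (1) * ccos' z)%C).
    + apply (Ccont_mult (fun _ => - (1))%C); [apply Ccont_const|apply Ccont_ccos'].
    + apply (Ccont_inv (fun z => ccos z * ccos z)%C); [apply Ccont_mult; trivial|].
      apply Cmult_neq_0; trivial.
Qed.

Lemma cosh_lower u : exp (Rabs u) / 2 <= cosh u.
Proof.
  unfold cosh. pose proof (exp_pos u). pose proof (exp_pos (- u)).
  unfold Rabs. destruct Rcase_abs; lra.
Qed.

(** No such bound holds near the pole, hence the two cases. For |y| >= 1 one uses |cos pi z|^2 >=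
    cosh^2(pi y) - 1, where exp(pi |y|) >= 3 leaves room for the constant 4; on the edges the
    modulus is exactly cosh(pi y). *)
Lemma kern_decay x y : 0 <= x <= 1 -> (1 <= Rabs y \/ x = 0 \/ x = 1) ->
  Cmod (kern (x, y)) <= 4 * exp (- (PI * Rabs y)).
Proof.
  intros Hx Hy.
  assert (H : exp (PI * Rabs y) / 4 <= Cmod (ccos (x, y))).
  { pose proof PI_RGT_0 as HP.
    assert (EA : Rabs (PI * y) = PI * Rabs y) by (rewrite Rabs_mult, (Rabs_right PI); lra).
    pose proof (cosh_lower (PI * y)) as HC. rewrite EA in HC. pose proof (exp_pos (PI * Rabs y)).
    pose proof (cosh_pos (PI * y)).
    destruct Hy as [Hy|[-> | ->]].
    - apply Rsqr_incr_0_var; [|apply Cmod_ge_0].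
      replace (Rsqr (Cmod (ccos (x, y)))) with (Cmod (ccos (x, y)) ^ 2) by (unfold Rsqr; ring).
      rewrite ccos_sq. unfold Rsqr.
      pose proof (cosh_sq (PI * y)) as Hq.
      assert (3 <= exp (PI * Rabs y)).
      { eapply Rle_trans; [|apply exp_ineq1_le]. pose proof PI2_1. nra. }
      assert (exp (PI * Rabs y) / 2 * (exp (PI * Rabs y) / 2) <= cosh (PI * y) ^ 2) by nra.
      nra.
    - rewrite ccos_0, Cmod_R, (Rabs_right (cosh (PI * y))) by (apply Rle_ge, Rlt_le, cosh_pos). clear Hx. lra.
    - rewrite ccos_1, Cmod_R, Rabs_Ropp, (Rabs_right (cosh (PI * y))) by (apply Rle_ge, Rlt_le, cosh_pos). clear Hx. lra. }
  pose proof (exp_pos (PI * Rabs y)).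
  unfold kern. rewrite Cmod_inv. 2: apply Cmod_gt_0; lra.
  rewrite exp_Ropp. replace (4 * / exp (PI * Rabs y)) with (/ (exp (PI * Rabs y) / 4)) by (field; lra).
  apply Rinv_le_contravar; lra.
Qed.

Lemma kern_sing z : 0 <= Re z <= 1 -> z <> RtoC (/ 2) -> Cmod (kern z) * Cmod (z - (/ 2)%R) <= 1.
Proof.
  intros H1 H2. pose proof (ccos_lower z H1) as H.
  assert (H3 : 0 < Cmod (z - (/ 2)%R)).
  { apply Cmod_gt_0. intros E. apply H2, Ceq_minus, E. }
  unfold kern. rewrite Cmod_inv by (apply Cmod_gt_0; lra).
  apply Rmult_le_reg_l with (Cmod (ccos z)); [lra|].
  rewrite <- Rmult_assoc, Rinv_r by lra. lra.
Qed.

Definition sech (y : R) : R := / cosh (PI * y).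

Lemma sech_pos y : 0 < sech y.
Proof. apply Rinv_0_lt_compat, cosh_pos. Qed.

Lemma kern_0 y : kern (0, y) = RtoC (sech y).
Proof. unfold kern, sech. rewrite ccos_0, RtoC_inv; trivial. pose proof (cosh_pos (PI * y)); lra. Qed.

Lemma kern_1 y : kern (1, y) = RtoC (- sech y).
Proof.
  unfold kern, sech. pose proof (cosh_pos (PI * y)).
  rewrite ccos_1, <- RtoC_inv by lra. f_equal. field. lra.
Qed.

Lemma sech_even y : sech (- y) = sech y.
Proof. unfold sech, cosh. replace (PI * - y) with (- (PI * y)) by ring. rewrite Ropp_involutive. f_equal. lra. Qed.

Lemma sech_exp y : sech y = 2 * exp (PI * y) / (1 + exp (PI * y) ^ 2).
Proof.
  unfold sech, cosh. rewrite exp_Ropp. pose proof (exp_pos (PI * y)). field. split; nra.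
Qed.

Definition holo (h h' : C -> C) : Prop :=
  forall z, 0 < Re z -> Cdiff h z (h' z) /\ Ccont h' z.

(** The minus sign is that of cos(pi(1 + iy)) = -cosh(pi y); it turns the recurrence of [A_int] into
    a sum. *)
Lemma shift_sech (h h' : C -> C) (b K : R) (m : nat) : 0 < b ->
  holo h h' -> growth h K m -> h (b + / 2)%R = RtoC 0 ->
  (forall eps, 0 < eps -> exists d, 0 < d /\ forall w, Cmod w < d ->
      Cmod (h ((b + / 2)%R + w)%C) <= eps * Cmod w ^ 1) ->
  CII (fun y => h (b + 1, y)%R * (- sech y)%R)%C = CII (fun y => h (b, y) * sech y)%C.
Proof.
  intros Hb Hh Hg Hc Ho.
  pose proof (shift_kernel kern kern' h h' b K m 1 Hb Cdiff_kern) as S.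
  transitivity (CII (fun y => h (b + (1, y)) * kern (1, y))%C).
  { apply CII_ext. intros y. rewrite kern_1, C_shift_pair. reflexivity. }
  rewrite S; trivial.
  - apply CII_ext. intros y. rewrite kern_0, C_shift_pair, Rplus_0_r. reflexivity.
  - intros x y Hx Hy. eapply Rle_trans; [apply kern_decay; trivial|].
    pose proof (exp_pos (- (PI * Rabs y))). lra.
  - intros z Hz1 Hz2. rewrite pow_1. apply kern_sing; trivial.
Qed.

Lemma shift_sech2 (h h' : C -> C) (b K : R) (m : nat) : 0 < b ->
  holo h h' -> growth h K m -> h (b + / 2)%R = RtoC 0 ->
  (forall eps, 0 < eps -> exists d, 0 < d /\ forall w, Cmod w < d ->
      Cmod (h ((b + / 2)%R + w)%C) <= eps * Cmod w ^ 2) ->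
  CII (fun y => h (b + 1, y)%R * (sech y ^ 2)%R)%C = CII (fun y => h (b, y) * (sech y ^ 2)%R)%C.
Proof.
  intros Hb Hh Hg Hc Ho.
  pose proof (shift_kernel (fun z => kern z * kern z)%C
    (fun z => kern' z * kern z + kern z * kern' z)%C h h' b K m 2 Hb) as S.
  transitivity (CII (fun y => h (b + (1, y)) * (kern (1, y) * kern (1, y)))%C).
  { apply CII_ext. intros y. rewrite kern_1, C_shift_pair, <- RtoC_mult. do 2 f_equal. ring. }
  rewrite S; trivial.
  - apply CII_ext. intros y. rewrite kern_0, C_shift_pair, Rplus_0_r, <- RtoC_mult.
    do 2 f_equal. ring.
  - intros z H1 H2. destruct (Cdiff_kern z H1 H2) as [D1 D2].
    pose proof (Cdiff_Ccont _ _ _ D1) as D3. split.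
    + apply Cdiff_mult; trivial.
    + apply (Ccont_plus (fun z => kern' z * kern z)%C); apply Ccont_mult; trivial.
  - intros x y Hx Hy. pose proof (kern_decay x y Hx Hy) as H. rewrite Cmod_mult.
    pose proof (exp_pos (- (PI * Rabs y))) as P.
    assert (exp (- (PI * Rabs y)) <= 1).
    { rewrite <- exp_0. apply exp_incr. pose proof (Rabs_pos y). pose proof PI_RGT_0. nra. }
    pose proof (Cmod_ge_0 (kern (x, y))). nra.
  - intros z Hz1 Hz2. rewrite Cmod_mult. pose proof (kern_sing z Hz1 Hz2).
    pose proof (Cmod_ge_0 (kern z)). pose proof (Cmod_ge_0 (z - (/ 2)%R)).
    assert (0 <= Cmod (kern z) * Cmod (z - (/ 2)%R)) by (apply Rmult_le_pos; trivial).
    replace (Cmod (kern z) * Cmod (kern z) * Cmod (z - (/ 2)%R) ^ 2) with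
      ((Cmod (kern z) * Cmod (z - (/ 2)%R)) * (Cmod (kern z) * Cmod (z - (/ 2)%R))) by ring.
    nra.
Qed.

Lemma kern_line_Ccont y : Ccont kern (0, y).
Proof.
  destruct (Cdiff_kern (0, y)) as [H _].
  - simpl; lra.
  - intros E; injection E; intros; lra.
  - apply (Cdiff_Ccont _ _ _ H).
Qed.

Lemma sech_decay y : sech y <= 4 * exp (- (PI * Rabs y)).
Proof.
  pose proof (kern_decay 0 y ltac:(lra) ltac:(lra)) as H.
  rewrite kern_0, Cmod_R, Rabs_right in H; trivial. left; apply sech_pos.
Qed.

Lemma exp_neg_le_1 y : exp (- (PI * Rabs y)) <= 1.
Proof.
  rewrite <- exp_0. apply exp_incr. pose proof (Rabs_pos y). pose proof PI_RGT_0. nra.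
Qed.

Lemma holo_line_Ccont (h h' : C -> C) b y : 0 < b -> holo h h' ->
  Ccont (fun z => h (b + z)%C) (0, y).
Proof.
  intros Hb Hh. apply (Ccont_comp h (fun z => b + z)%C (0, y)).
  - destruct (Hh (b + (0, y))%C) as [D _]; [rewrite C_shift_pair; simpl; lra|].
    apply (Cdiff_Ccont _ _ _ D).
  - apply (Ccont_plus (fun _ => RtoC b) (fun z => z)); [apply Ccont_const|apply Ccont_id].
Qed.

Lemma dominated_sech h h' K m b : 0 < b -> holo h h' -> growth h K m ->
  Cdominated (fun y => h (b, y) * sech y)%C (K * 16 * strip_const m b b).
Proof.
  intros Hb Hh Hg.
  apply (Cdominated_ext (fun y => (fun z => h (b + z) * kern z)%C (0, y))).
  { intros y. cbv beta. rewrite C_shift_pair, Rplus_0_r, kern_0. reflexivity. }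
  apply (Ccont_dominated (fun z => h (b + z) * kern z)%C).
  - intros y. apply (Ccont_mult (fun z => h (b + z))%C); [|apply kern_line_Ccont].
    apply (holo_line_Ccont h h'); trivial.
  - intros y. rewrite C_shift_pair, Rplus_0_r, kern_0.
    apply growth_strip_bound; trivial; try lra.
    rewrite Cmod_R, Rabs_right by (left; apply sech_pos).
    pose proof (sech_decay y). pose proof (exp_pos (- (PI * Rabs y))). lra.
Qed.

Lemma dominated_sech2 h h' K m b : 0 < b -> holo h h' -> growth h K m ->
  Cdominated (fun y => h (b, y) * (sech y ^ 2)%R)%C (K * 16 * strip_const m b b).
Proof.
  intros Hb Hh Hg.
  apply (Cdominated_ext (fun y => (fun z => h (b + z) * (kern z * kern z))%C (0, y))).
  { intros y. cbv beta. rewrite C_shift_pair, Rplus_0_r, kern_0, <- RtoC_mult. do 2 f_equal. ring. }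
  apply (Ccont_dominated (fun z => h (b + z) * (kern z * kern z))%C).
  - intros y. apply (Ccont_mult (fun z => h (b + z))%C).
    + apply (holo_line_Ccont h h'); trivial.
    + apply Ccont_mult; apply kern_line_Ccont.
  - intros y. rewrite C_shift_pair, Rplus_0_r, kern_0, <- RtoC_mult.
    apply growth_strip_bound; trivial; try lra.
    pose proof (sech_pos y). rewrite Cmod_R, Rabs_right by nra.
    pose proof (sech_decay y). pose proof (exp_pos (- (PI * Rabs y))).
    pose proof (exp_neg_le_1 y). nra.
Qed.

Lemma holo_const c : holo (fun _ => c) (fun _ => RtoC 0).
Proof. intros z _. split; [apply Cdiff_const|apply Ccont_const]. Qed.

Lemma holo_id : holo (fun z => z) (fun _ => RtoC 1).
Proof. intros z _. split; [apply Cdiff_id|apply Ccont_const]. Qed.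

Lemma exists_INR_ge (x : R) : exists m, x <= INR m.
Proof. destruct (INR_unbounded x) as [m Hm]. exists m; lra. Qed.

Lemma Ccont_cpower a z : 0 < Re z -> Ccont (fun z => cpower z a) z.
Proof. intros H. apply (Cdiff_Ccont _ _ _ (Cdiff_cpower a z H)). Qed.

Lemma holo_cpower a : holo (fun z => cpower z a) (fun z => a * cpower z (a - 1))%C.
Proof.
  intros z Hz. split; [apply Cdiff_cpower, Hz|].
  apply (Ccont_mult (fun _ => a)); [apply Ccont_const|apply Ccont_cpower, Hz].
Qed.

Lemma dominated_cpower_sech2 a b : 0 < b ->
  exists M, Cdominated (fun y => cpower (b, y) a * (sech y ^ 2)%R)%C M.
Proof.
  intros Hb. destruct (exists_INR_ge (Cmod a)) as [m Hm].
  eexists. apply (dominated_sech2 (fun z => cpower z a) _ 1 m b Hb (holo_cpower a)).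
  apply growth_cpower, Hm.
Qed.

Lemma CII_RtoC (f : R -> R) : CII (fun y => RtoC (f y)) = RtoC (II f).
Proof.
  unfold CII, RtoC. f_equal.
  rewrite (II_ext _ (fun _ => 0)) by (intros; reflexivity).
  unfold II. erewrite Lim_seq_ext; [rewrite (Lim_seq_const 0); reflexivity|].
  intros n. cbv beta. rewrite (RInt_const (V := R_CompleteNormedModule)).
  unfold scal; simpl; unfold mult; simpl. ring.
Qed.

Lemma dominated_of_C (f : R -> R) M : Cdominated (fun y => RtoC (f y)) M -> dominated f M.
Proof. intros [H _]. apply (dominated_ext (fun y => Re (RtoC (f y)))); trivial. Qed.

Lemma C_of_dominated (f : R -> R) M : dominated f M -> Cdominated (fun y => RtoC (f y)) M.
Proof.
  intros H. split; trivial.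
  split; intros x; simpl; [apply continuous_const|]. rewrite Rabs_R0.
  apply Rmult_le_pos; [apply (dominated_nonneg _ _ H)|]. left; apply Rinv_0_lt_compat; nra.
Qed.

Lemma dominated_real_sech : exists M, dominated sech M.
Proof.
  eexists. apply dominated_of_C.
  eapply Cdominated_ext; [|apply (dominated_sech (fun _ => RtoC 1) _ _ 0 1 ltac:(lra) (holo_const _) (growth_const _))].
  intros y. cbv beta. ring.
Qed.

Lemma dominated_real_sech2 : exists M, dominated (fun y => sech y ^ 2) M.
Proof.
  eexists. apply dominated_of_C.
  eapply Cdominated_ext; [|apply (dominated_sech2 (fun _ => RtoC 1) _ _ 0 1 ltac:(lra) (holo_const _) (growth_const _))].
  intros y. cbv beta. ring.
Qed.

Lemma dominated_id_sech : exists M, dominated (fun y => y * sech y) M.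
Proof.
  destruct (dominated_sech (fun z => z) _ _ 1 1 ltac:(lra) holo_id growth_id) as [_ H].
  eexists. eapply dominated_ext; [|apply H]. intros y. cbv beta. rewrite im_scal_r. reflexivity.
Qed.

Lemma dominated_id_sech2 : exists M, dominated (fun y => y * sech y ^ 2) M.
Proof.
  destruct (dominated_sech2 (fun z => z) _ _ 1 1 ltac:(lra) holo_id growth_id) as [_ H].
  eexists. eapply dominated_ext; [|apply H]. intros y. cbv beta. rewrite im_scal_r. reflexivity.
Qed.

Lemma II_odd (f : R -> R) M : dominated f M -> (forall x, f (- x) = - f x) -> II f = 0.
Proof.
  intros H Ho. apply (II_unique f M 0 H).
  apply (is_lim_seq_ext (fun _ => 0)); [|apply is_lim_seq_const].
  intros n. symmetry. apply RInt_odd; trivial. apply H.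
Qed.

Lemma exp_lin_lim c : 0 < c -> is_lim_seq (fun n => exp (c * INR n)) p_infty.
Proof.
  intros Hc. apply (is_lim_seq_le_p_loc (fun n => c * INR n)).
  - exists 0%nat. intros n _. pose proof (exp_ineq1_le (c * INR n)). lra.
  - replace p_infty with (Rbar_mult c p_infty).
    + apply is_lim_seq_scal_l, is_lim_seq_INR.
    + simpl. destruct (Rle_dec 0 c) as [h|h]; [|lra].
      destruct (Rle_lt_or_eq_dec 0 c h); [trivial|lra].
Qed.

Lemma exp_lin_lim_0 c : 0 < c -> is_lim_seq (fun n => exp (c * - INR n)) 0.
Proof.
  intros Hc. apply (is_lim_seq_ext (fun n => / exp (c * INR n))).
  { intros n. rewrite <- exp_Ropp. f_equal. ring. }
  apply (is_lim_seq_inv _ p_infty); [apply exp_lin_lim, Hc|discriminate].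
Qed.

Lemma II_sech : II sech = 1.
Proof.
  destruct dominated_real_sech as [M HM]. pose proof PI_RGT_0 as HP.
  rewrite (II_FTC sech (fun y => 2 / PI * atan (exp (PI * y))) M 1 0 HM).
  - ring.
  - intros y. rewrite sech_exp. auto_derive; trivial. field.
    split; [pose proof (exp_pos (PI * y)); nra|lra].
  - replace (Finite 1) with (Finite (2 / PI * (PI / 2))) by (f_equal; field; lra).
    apply is_lim_seq_mult'; [apply is_lim_seq_const|].
    apply (is_lim_seq_le_le (fun n => atan (INR n)) _ (fun _ => PI / 2)).
    + intros n. split; [|left; apply atan_bound].
      pose proof (pos_INR n). pose proof (exp_ineq1_le (PI * INR n)). pose proof PI2_1.
      left; apply atan_increasing. nra.
    + apply atan_lim.
    + apply is_lim_seq_const.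
  - apply is_lim_seq_scal_0.
    rewrite <- atan_0. apply (is_lim_seq_continuous atan _ 0).
    + apply continuity_pt_filterlim. apply (real_derive_continuous atan). auto_derive; trivial.
    + apply exp_lin_lim_0, HP.
Qed.

Lemma II_sech2 : II (fun y => sech y ^ 2) = 2 / PI.
Proof.
  destruct dominated_real_sech2 as [M HM]. pose proof PI_RGT_0 as HP.
  (* Up to a constant this primitive is tanh(pi y)/pi, written so that both limits are immediate. *)
  rewrite (II_FTC _ (fun y => - (2 / PI) * / (1 + exp ((2 * PI) * y))) M 0 (- (2 / PI)) HM).
  - ring.
  - intros y. rewrite sech_exp.
    replace (exp (PI * y) ^ 2) with (exp (2 * PI * y)).
    2: { simpl. rewrite Rmult_1_r, <- exp_plus. f_equal. ring. }
    pose proof (exp_pos (2 * PI * y)).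
    auto_derive; [lra|].
    replace ((2 * exp (PI * y) / (1 + exp (2 * PI * y))) ^ 2)
      with (4 * (exp (PI * y) * exp (PI * y)) / (1 + exp (2 * PI * y)) ^ 2) by (field; lra).
    rewrite <- exp_plus. replace (PI * y + PI * y) with (2 * PI * y) by ring. field. lra.
  - apply is_lim_seq_scal_0.
    apply (is_lim_seq_inv _ p_infty); [|discriminate].
    apply (is_lim_seq_plus _ _ 1 p_infty); [apply is_lim_seq_const|apply exp_lin_lim; lra|reflexivity].
  - replace (Finite (- (2 / PI))) with (Finite (- (2 / PI) * / (1 + 0))) by (f_equal; field; lra).
    apply is_lim_seq_mult'; [apply is_lim_seq_const|].
    apply (is_lim_seq_inv _ (Finite (1 + 0))); [|intros E; injection E; lra].
    apply is_lim_seq_plus'; [apply is_lim_seq_const|apply exp_lin_lim_0; lra].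
Qed.

(** * Taylor remainders and the class of admissible integrands *)

Lemma re_add_pos (c : R) (w : C) : Cmod w < c -> 0 < Re (c + w)%C.
Proof.
  intros H. rewrite re_plus, re_RtoC. pose proof (re_le_Cmod w) as K.
  assert (K' := Rle_lt_trans _ _ _ K H). apply Rabs_def2 in K'. lra.
Qed.

Lemma taylor1 (f f1 : C -> C) (c : R) : 0 < c -> holo f f1 ->
  forall eps, 0 < eps -> exists d, 0 < d /\ forall w, Cmod w < d ->
    Cmod (f (c + w) - f c - f1 c * (c + w - c))%C <= eps * Cmod w ^ 1.
Proof.
  intros Hc Hf eps He.
  destruct (Hf (RtoC c) ltac:(rewrite re_RtoC; trivial)) as [_ Cf1].
  destruct (Cf1 eps He) as [d [Hd Hd']].
  exists (Rmin c d). split; [apply Rmin_pos; trivial|].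
  apply (little_o_primitive (fun z => f z - f c - f1 c * (z - c))%C (fun z => f1 z - f1 c)%C c 0).
  - lra.
  - intros w Hw. assert (Hw1 : Cmod w < c) by (eapply Rlt_le_trans; [apply Hw|apply Rmin_l]).
    destruct (Hf (c + w)%C (re_add_pos c w Hw1)) as [D _].
    eapply Cdiff_eq; [|apply Cdiff_minus; [apply Cdiff_minus; [apply D|apply Cdiff_const]|
      apply Cdiff_scal, Cdiff_minus; [apply Cdiff_id|apply Cdiff_const]]]. ring.
  - ring.
  - intros w Hw. simpl. rewrite Rmult_1_r. left. apply Hd'.
    replace (c + w - c)%C with w by ring. eapply Rlt_le_trans; [apply Hw|apply Rmin_r].
Qed.

Lemma taylor2 (f f1 f2 : C -> C) (c : R) : 0 < c -> holo f f1 -> holo f1 f2 ->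
  forall eps, 0 < eps -> exists d, 0 < d /\ forall w, Cmod w < d ->
    Cmod (f (c + w) - f c - f1 c * (c + w - c) - f2 c * / 2 * ((c + w - c) * (c + w - c)))%C
      <= eps * Cmod w ^ 2.
Proof.
  intros Hc Hf Hf1 eps He.
  destruct (taylor1 f1 f2 c Hc Hf1 eps He) as [d [Hd Hd']].
  exists (Rmin c d). split; [apply Rmin_pos; trivial|].
  apply (little_o_primitive
    (fun z => f z - f c - f1 c * (z - c) - f2 c * / 2 * ((z - c) * (z - c)))%C
    (fun z => f1 z - f1 c - f2 c * (z - c))%C c 1).
  - lra.
  - intros w Hw. assert (Hw1 : Cmod w < c) by (eapply Rlt_le_trans; [apply Hw|apply Rmin_l]).
    destruct (Hf (c + w)%C (re_add_pos c w Hw1)) as [D _].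
    assert (L : Cdiff (fun z => z - c)%C (c + w)%C (1 - 0)%C)
      by (apply Cdiff_minus; [apply Cdiff_id|apply Cdiff_const]).
    eapply Cdiff_eq; [|apply Cdiff_minus; [apply Cdiff_minus; [apply Cdiff_minus;
       [apply D|apply Cdiff_const]|apply Cdiff_scal, L]|
      apply Cdiff_scal, Cdiff_mult; apply L]]. cbv beta. field.
  - ring.
  - intros w Hw. apply Hd'. eapply Rlt_le_trans; [apply Hw|apply Rmin_r].
Qed.

Definition hol (h : C -> C) : Prop := exists h', holo h h'.

Lemma hol_Ccont h z : hol h -> 0 < Re z -> Ccont h z.
Proof. intros [h' H] Hz. destruct (H z Hz) as [D _]. apply (Cdiff_Ccont _ _ _ D). Qed.

Lemma hol_ext f g : (forall z, f z = g z) -> hol f -> hol g.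
Proof.
  intros E [f' H]. exists f'. intros z Hz. destruct (H z Hz) as [D Cc].
  split; trivial. apply (Cdiff_ext f); trivial.
Qed.

Lemma hol_const c : hol (fun _ => c).
Proof. eexists; apply holo_const. Qed.

Lemma hol_id : hol (fun z => z).
Proof. eexists; apply holo_id. Qed.

Lemma hol_plus f g : hol f -> hol g -> hol (fun z => f z + g z)%C.
Proof.
  intros [f' Hf] [g' Hg]. exists (fun z => f' z + g' z)%C. intros z Hz.
  destruct (Hf z Hz), (Hg z Hz). split; [apply Cdiff_plus; trivial|apply Ccont_plus; trivial].
Qed.

Lemma hol_mult f g : hol f -> hol g -> hol (fun z => f z * g z)%C.
Proof.
  intros Hf Hg. pose proof (fun z => hol_Ccont f z Hf) as Cf. pose proof (fun z => hol_Ccont g z Hg) as Cg.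
  destruct Hf as [f' Hf], Hg as [g' Hg]. exists (fun z => f' z * g z + f z * g' z)%C. intros z Hz.
  destruct (Hf z Hz), (Hg z Hz). split; [apply Cdiff_mult; trivial|].
  apply (Ccont_plus (fun z => f' z * g z)%C); apply Ccont_mult; auto.
Qed.

Lemma hol_minus f g : hol f -> hol g -> hol (fun z => f z - g z)%C.
Proof.
  intros Hf Hg. apply (hol_ext (fun z => f z + - (1) * g z)%C); [intros; ring|].
  apply hol_plus; trivial. apply hol_mult; trivial. apply hol_const.
Qed.

Lemma hol_Clog : hol Clog.
Proof.
  exists (fun z => / z)%C. intros z Hz. split; [apply Cdiff_Clog, Hz|].
  apply (Ccont_inv (fun z => z)); [apply Ccont_id|]. apply Cmod_gt_0, Cmod_pos_re, Hz.
Qed.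

Lemma hol_cpower a : hol (fun z => cpower z a).
Proof. eexists; apply holo_cpower. Qed.

Lemma growth_Clog : growth Clog 1 1.
Proof.
  split; [lra|]. intros z _. simpl. rewrite !Rmult_1_l.
  pose proof (exp_ineq1_le (Cmod (Clog z))). lra.
Qed.

Lemma growth_weak h K m m' : (m <= m')%nat -> growth h K m -> growth h K m'.
Proof. intros. eapply growth_le; [apply Rle_refl|eassumption|trivial]. Qed.

(** A class closed under sums, differences and products that contains constants, z, Log z and all
    powers. Taylor remainders and exponential partial sums are therefore integrable against the
    kernels without any separate estimate. *)
Definition tame (h : C -> C) : Prop := hol h /\ exists K m, growth h K m.

Lemma tame_const c : tame (fun _ => c).
Proof. split; [apply hol_const|]. do 2 eexists; apply growth_const. Qed.

Lemma tame_id : tame (fun z => z).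
Proof. split; [apply hol_id|]. do 2 eexists; apply growth_id. Qed.

Lemma tame_Clog : tame Clog.
Proof. split; [apply hol_Clog|]. do 2 eexists; apply growth_Clog. Qed.

Lemma tame_cpower a : tame (fun z => cpower z a).
Proof.
  split; [apply hol_cpower|]. destruct (exists_INR_ge (Cmod a)) as [m Hm].
  do 2 eexists; apply growth_cpower, Hm.
Qed.

Lemma tame_minus f g : tame f -> tame g -> tame (fun z => f z - g z)%C.
Proof.
  intros [Hf [K [m Gf]]] [Hg [K' [m' Gg]]]. split; [apply hol_minus; trivial|].
  exists (K + K'), (m + m')%nat. apply growth_minus.
  - apply (growth_weak _ _ m); [lia|trivial].
  - apply (growth_weak _ _ m'); [lia|trivial].
Qed.

Lemma tame_plus f g : tame f -> tame g -> tame (fun z => f z + g z)%C.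
Proof.
  intros [Hf [K [m Gf]]] [Hg [K' [m' Gg]]]. split; [apply hol_plus; trivial|].
  exists (K + K'), (m + m')%nat. apply growth_plus.
  - apply (growth_weak _ _ m); [lia|trivial].
  - apply (growth_weak _ _ m'); [lia|trivial].
Qed.

Lemma tame_mult f g : tame f -> tame g -> tame (fun z => f z * g z)%C.
Proof.
  intros [Hf [K [m Gf]]] [Hg [K' [m' Gg]]]. split; [apply hol_mult; trivial|].
  do 2 eexists. apply growth_mult; eassumption.
Qed.

Lemma tame_pow f n : tame f -> tame (fun z => f z ^ n)%C.
Proof.
  intros Hf. induction n as [|n IH]; [apply (tame_const 1)|].
  apply (tame_mult f (fun z => f z ^ n)%C); trivial.
Qed.

Lemma tame_sech h b : 0 < b -> tame h -> exists M, Cdominated (fun y => h (b, y) * sech y)%C M.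
Proof.
  intros Hb [[h' Hh] [K [m Hg]]]. eexists. apply (dominated_sech h h' K m); trivial.
Qed.

Lemma tame_sech2 h b : 0 < b -> tame h ->
  exists M, Cdominated (fun y => h (b, y) * (sech y ^ 2)%R)%C M.
Proof.
  intros Hb [[h' Hh] [K [m Hg]]]. eexists. apply (dominated_sech2 h h' K m); trivial.
Qed.

(** Against an even weight the linear part is odd and integrates to 0. This evaluates what the
    subtracted Taylor polynomials contribute. *)
Lemma CII_affine (s : R -> R) M M' al be :
  dominated s M -> dominated (fun y => y * s y) M' -> (forall y, s (- y) = s y) ->
  CII (fun y => (al + be * (Ci * y)) * s y)%C = (al * RtoC (II s))%C /\
  exists N, Cdominated (fun y => (al + be * (Ci * y)) * s y)%C N.
Proof.
  intros H1 H2 He.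
  assert (E : forall y : R, (al * s y + be * Ci * (y * s y)%R = (al + be * (Ci * y)) * s y)%C)
    by (intros; rewrite RtoC_mult; ring).
  pose proof (Cdominated_scal _ _ al (C_of_dominated _ _ H1)) as D1.
  pose proof (Cdominated_scal _ _ (be * Ci)%C (C_of_dominated _ _ H2)) as D2.
  split.
  - rewrite <- (CII_ext _ _ E).
    rewrite (CII_plus _ _ _ _ D1 D2).
    rewrite (CII_scal _ _ _ (C_of_dominated _ _ H1)), (CII_scal _ _ _ (C_of_dominated _ _ H2)).
    rewrite !CII_RtoC. rewrite (II_odd _ _ H2).
    + ring.
    + intros y. rewrite He. ring.
  - eexists. eapply Cdominated_ext; [exact E|]. apply Cdominated_plus; [exact D1|exact D2].
Qed.

(** * Recurrences of the two kernel integrals in the base point *)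

Definition A_int (b : R) (a : C) : C := CII (fun y => cpower (b, y) a * sech y)%C.
Definition B_int (b : R) (a : C) : C := CII (fun y => cpower (b, y) a * (sech y ^ 2)%R)%C.

(** Let T be the first-order Taylor polynomial of f(z) = z^a at c = b + 1/2, and shift f - T. The
    two lines lie at c - 1/2 and c + 1/2, so T(c - 1/2 + iy) + T(c + 1/2 + iy) = 2 f(c) + 2 f'(c)
    iy, which integrates to 2 f(c). *)
Lemma A_int_rec b a : 0 < b ->
  (A_int b a + A_int (b + 1) a = 2 * cpower (b + / 2)%R a)%C.
Proof.
  intros Hb. set (c := b + / 2). assert (Hc : 0 < c) by (unfold c; lra).
  set (f := fun z => cpower z a). set (f1 := fun z => (a * cpower z (a - 1))%C).
  set (h := fun z => (f z - f c - f1 c * (z - c))%C).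
  assert (Th : tame h).
  { apply tame_minus; [apply tame_minus; [apply tame_cpower|apply tame_const]|].
    apply tame_mult; [apply tame_const|]. apply tame_minus; [apply tame_id|apply tame_const]. }
  assert (S : CII (fun y => h (b + 1, y)%R * (- sech y)%R)%C = CII (fun y => h (b, y) * sech y)%C).
  { destruct Th as [[h' Hh] [K [m Hg]]]. apply (shift_sech h h' b K m); trivial.
    - unfold h, f. fold c. ring.
    - apply (taylor1 f f1 c Hc (holo_cpower a)). }
  destruct (tame_sech h b Hb Th) as [M1 D1].
  destruct (tame_sech h (b + 1) ltac:(lra) Th) as [M2 D2].
  destruct (tame_sech f b Hb (tame_cpower a)) as [M3 D3].
  destruct (tame_sech f (b + 1) ltac:(lra) (tame_cpower a)) as [M4 D4].
  destruct dominated_real_sech as [M5 D5]. destruct dominated_id_sech as [M6 D6].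
  destruct (CII_affine sech _ _ (2 * f c) (2 * f1 c) D5 D6 sech_even) as [P [M7 D7]].
  rewrite II_sech in P.
  assert (Z : CII (fun y => h (b + 1, y)%R * sech y)%C = (- CII (fun y => h (b, y) * sech y))%C).
  { rewrite <- S. rewrite (CII_ext (fun y => h (b + 1, y)%R * (- sech y)%R)%C
      (fun y => - (1) * (h (b + 1, y)%R * sech y))%C) by (intros; rewrite RtoC_opp; ring).
    rewrite (CII_scal _ _ _ D2). ring. }
  assert (Q : CII (fun y => h (b, y) * sech y + h (b + 1, y)%R * sech y)%C =
    (A_int b a + A_int (b + 1) a - (2 * f c))%C).
  { rewrite (CII_ext _ (fun y => (f (b, y) * sech y + f (b + 1, y)%R * sech y)
       - (2 * f c + 2 * f1 c * (Ci * y)) * sech y)%C).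
    - rewrite (CII_minus _ _ _ _ (Cdominated_plus _ _ _ _ D3 D4) D7).
      rewrite (CII_plus _ _ _ _ D3 D4), P. unfold A_int, f. ring.
    - intros y. unfold h.
      replace (b, y) with ((c : C) - / 2 + Ci * y)%C.
      2: { rewrite <- RtoC_inv by lra. unfold c, Ci, RtoC, Cminus, Copp, Cplus, Cmult; simpl. f_equal; lra. }
      replace (b + 1, y)%R with ((c : C) + / 2 + Ci * y)%C.
      2: { rewrite <- RtoC_inv by lra. unfold c, Ci, RtoC, Cminus, Copp, Cplus, Cmult; simpl. f_equal; lra. }
      field. }
  rewrite (CII_plus _ _ _ _ D1 D2), Z in Q.
  replace (CII (fun y => h (b, y) * sech y) + - CII (fun y => h (b, y) * sech y))%C with (RtoC 0) in Q by ring.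
  symmetry in Q. apply Ceq_minus in Q. exact Q.
Qed.

Lemma sech2_even y : sech (- y) ^ 2 = sech y ^ 2.
Proof. rewrite sech_even. reflexivity. Qed.

(** With the second-order Taylor polynomial T at c one has T(c + 1/2 + iy) - T(c - 1/2 + iy) = f'(c)
    + f''(c) iy, so the double pole contributes f'(c) times the mass 2/pi. *)
Lemma B_int_rec b a : 0 < b ->
  (B_int (b + 1) a - B_int b a = (2 / PI)%R * (a * cpower (b + / 2)%R (a - 1)))%C.
Proof.
  intros Hb. set (c := b + / 2). assert (Hc : 0 < c) by (unfold c; lra).
  set (f := fun z => cpower z a). set (f1 := fun z => (a * cpower z (a - 1))%C).
  set (f2 := fun z => (a * ((a - 1) * cpower z (a - 1 - 1)))%C).
  set (h := fun z => (f z - f c - f1 c * (z - c) - f2 c * / 2 * ((z - c) * (z - c)))%C).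
  assert (Hf1 : holo f1 f2).
  { intros z Hz. destruct (holo_cpower (a - 1) z Hz) as [D Cc]. split.
    - apply Cdiff_scal, D.
    - apply (Ccont_mult (fun _ => a)); [apply Ccont_const|exact Cc]. }
  assert (Tl : tame (fun z => z - c)%C) by (apply tame_minus; [apply tame_id|apply tame_const]).
  assert (Th : tame h).
  { apply tame_minus; [apply tame_minus; [apply tame_minus; [apply tame_cpower|apply tame_const]|]|].
    - apply tame_mult; [apply tame_const|trivial].
    - apply tame_mult; [apply tame_const|]. apply tame_mult; trivial. }
  assert (S : CII (fun y => h (b + 1, y)%R * (sech y ^ 2)%R)%C = CII (fun y => h (b, y) * (sech y ^ 2)%R)%C).
  { destruct Th as [[h' Hh] [K [m Hg]]]. apply (shift_sech2 h h' b K m); trivial.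
    - unfold h, f. fold c. ring.
    - apply (taylor2 f f1 f2 c Hc (holo_cpower a) Hf1). }
  destruct (tame_sech2 h b Hb Th) as [M1 D1].
  destruct (tame_sech2 h (b + 1) ltac:(lra) Th) as [M2 D2].
  destruct (tame_sech2 f b Hb (tame_cpower a)) as [M3 D3].
  destruct (tame_sech2 f (b + 1) ltac:(lra) (tame_cpower a)) as [M4 D4].
  destruct dominated_real_sech2 as [M5 D5]. destruct dominated_id_sech2 as [M6 D6].
  destruct (CII_affine (fun y => sech y ^ 2) _ _ (f1 c) (f2 c) D5 D6 sech2_even) as [P [M7 D7]].
  rewrite II_sech2 in P.
  assert (Q : CII (fun y => h (b + 1, y)%R * (sech y ^ 2)%R - h (b, y) * (sech y ^ 2)%R)%C =
    (B_int (b + 1) a - B_int b a - f1 c * (2 / PI)%R)%C).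
  { rewrite (CII_ext _ (fun y => (f (b + 1, y)%R * (sech y ^ 2)%R - f (b, y) * (sech y ^ 2)%R)
       - (f1 c + f2 c * (Ci * y)) * (sech y ^ 2)%R)%C).
    - assert (D43 : exists N, Cdominated (fun y => f (b + 1, y)%R * (sech y ^ 2)%R - f (b, y) * (sech y ^ 2)%R)%C N).
      { eexists. eapply Cdominated_ext; [|apply (Cdominated_plus _ _ _ _ D4 (Cdominated_scal _ _ (- (1))%C D3))].
        intros y. cbv beta. ring. }
      destruct D43 as [N D43].
      rewrite (CII_minus _ _ _ _ D43 D7), (CII_minus _ _ _ _ D4 D3), P. unfold B_int, f. ring.
    - intros y. unfold h.
      replace (b, y) with ((c : C) - / 2 + Ci * y)%C.
      2: { rewrite <- RtoC_inv by lra. unfold c, Ci, RtoC, Cminus, Copp, Cplus, Cmult; simpl. f_equal; lra. }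
      replace (b + 1, y)%R with ((c : C) + / 2 + Ci * y)%C.
      2: { rewrite <- RtoC_inv by lra. unfold c, Ci, RtoC, Cminus, Copp, Cplus, Cmult; simpl. f_equal; lra. }
      field. }
  rewrite (CII_minus _ _ _ _ D2 D1), S in Q.
  replace (CII (fun y => h (b, y) * (sech y ^ 2)%R) - CII (fun y => h (b, y) * (sech y ^ 2)%R))%C with (RtoC 0) in Q by ring.
  symmetry in Q. apply Ceq_minus in Q. rewrite Q. unfold f1. ring.
Qed.

(** * Complex power series *)

Definition Clim (u : nat -> C) (l : C) : Prop :=
  is_lim_seq (fun n => Cmod (u n - l)) 0.

Fixpoint Csum (f : nat -> C) (n : nat) : C :=
  match n with O => RtoC 0 | S k => (Csum f k + f k)%C end.

Lemma Clim_squeeze u l (v : nat -> R) : (forall n, Cmod (u n - l) <= v n) ->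
  is_lim_seq v 0 -> Clim u l.
Proof.
  intros H Hv. apply (is_lim_seq_le_le (fun _ => 0) _ v); trivial.
  - intros n. split; [apply Cmod_ge_0|apply H].
  - apply is_lim_seq_const.
Qed.

Lemma Clim_ext u v l : (forall n, u n = v n) -> Clim u l -> Clim v l.
Proof. intros E H. apply (is_lim_seq_ext (fun n => Cmod (u n - l))); trivial. intros; rewrite E; trivial. Qed.

Lemma Clim_const c : Clim (fun _ => c) c.
Proof.
  apply (Clim_squeeze _ _ (fun _ => 0)); [|apply is_lim_seq_const].
  intros. replace (c - c)%C with (RtoC 0) by ring. rewrite Cmod_0. lra.
Qed.

Lemma Clim_plus u v l m : Clim u l -> Clim v m -> Clim (fun n => u n + v n)%C (l + m)%C.
Proof.
  intros H1 H2. apply (Clim_squeeze _ _ (fun n => Cmod (u n - l) + Cmod (v n - m))).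
  - intros n. replace (u n + v n - (l + m))%C with ((u n - l) + (v n - m))%C by ring.
    apply Cmod_triangle.
  - replace (Finite 0) with (Finite (0 + 0)) by (f_equal; ring). apply is_lim_seq_plus'; trivial.
Qed.

Lemma Clim_scal c u l : Clim u l -> Clim (fun n => c * u n)%C (c * l)%C.
Proof.
  intros H. apply (Clim_squeeze _ _ (fun n => Cmod c * Cmod (u n - l))).
  - intros n. replace (c * u n - c * l)%C with (c * (u n - l))%C by ring. rewrite Cmod_mult. lra.
  - apply is_lim_seq_scal_0; trivial.
Qed.

Lemma Clim_minus u v l m : Clim u l -> Clim v m -> Clim (fun n => u n - v n)%C (l - m)%C.
Proof.
  intros H1 H2. apply (Clim_ext (fun n => u n + - (1) * v n)%C); [intros; ring|].
  replace (l - m)%C with (l + - (1) * m)%C by ring. apply Clim_plus; trivial. apply Clim_scal; trivial.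
Qed.

Lemma Clim_unique u l m : Clim u l -> Clim u m -> l = m.
Proof.
  intros H1 H2. pose proof (Clim_minus _ _ _ _ H1 H2) as H.
  apply (Clim_ext _ (fun _ => RtoC 0)) in H; [|intros; ring].
  unfold Clim in H. apply is_lim_seq_unique in H. rewrite Lim_seq_const in H.
  injection H as H. apply Cmod_eq_0 in H.
  apply Ceq_minus. replace (l - m)%C with (- (0 - (l - m)))%C by ring. rewrite H. ring.
Qed.

Lemma Clim_incr u l : Clim (fun n => u (S n)) l <-> Clim u l.
Proof. unfold Clim. rewrite (is_lim_seq_incr_1 (fun n => Cmod (u n - l))). reflexivity. Qed.

Lemma Clim_re_im u l : Clim u l ->
  is_lim_seq (fun n => Re (u n)) (Re l) /\ is_lim_seq (fun n => Im (u n)) (Im l).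
Proof.
  intros H. split.
  - apply (is_lim_seq_ext (fun n => Re (u n - l)%C + Re l)).
    { intros n. unfold Cminus. rewrite re_plus, re_opp. ring. }
    replace (Finite (Re l)) with (Finite (0 + Re l)) by (f_equal; ring).
    apply is_lim_seq_plus'; [|apply is_lim_seq_const]. apply is_lim_seq_abs_0.
    apply (is_lim_seq_le_le (fun _ => 0) _ _ 0) with (3 := H); [|apply is_lim_seq_const].
    intros n; split; [apply Rabs_pos|apply re_le_Cmod].
  - apply (is_lim_seq_ext (fun n => Im (u n - l)%C + Im l)).
    { intros n. unfold Cminus. rewrite im_plus, im_opp. ring. }
    replace (Finite (Im l)) with (Finite (0 + Im l)) by (f_equal; ring).
    apply is_lim_seq_plus'; [|apply is_lim_seq_const]. apply is_lim_seq_abs_0.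
    apply (is_lim_seq_le_le (fun _ => 0) _ _ 0) with (3 := H); [|apply is_lim_seq_const].
    intros n; split; [apply Rabs_pos|apply im_le_Cmod].
Qed.

Lemma sum_n_Csum (f : nat -> C) n :
  @sum_n (NormedModule.AbelianMonoid C_AbsRing C_NormedModule) f n = Csum f (S n).
Proof.
  induction n as [|n IH].
  - rewrite sum_O. simpl. rewrite Cplus_0_l. reflexivity.
  - rewrite sum_Sn, IH. reflexivity.
Qed.

Lemma Clim_filterlim (u : nat -> C) (l : C) :
  Clim u l <-> filterlim u eventually (@locally (NormedModule.UniformSpace C_AbsRing C_NormedModule) l).
Proof.
  rewrite (filterlim_locally_ball_norm (K := C_AbsRing) (U := C_NormedModule) u l).
  unfold Clim. rewrite <- is_lim_seq_spec. unfold is_lim_seq', ball_norm.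
  split; intros H eps; destruct (H eps) as [N HN]; exists N; intros n Hn; specialize (HN n Hn).
  - rewrite Rminus_0_r, Rabs_right in HN by (apply Rle_ge, Cmod_ge_0).
    exact HN.
  - change (Cmod (u n - l) < eps) in HN. rewrite Rminus_0_r, Rabs_right by (apply Rle_ge, Cmod_ge_0). exact HN.
Qed.

Lemma is_series_Clim (f : nat -> C) l :
  @is_series C_AbsRing C_NormedModule f l <-> Clim (Csum f) l.
Proof.
  rewrite <- Clim_incr, Clim_filterlim. unfold is_series.
  split; intros H; (eapply filterlim_ext; [|exact H]); intros n; cbv beta; rewrite sum_n_Csum; reflexivity.
Qed.

Definition Cpsum (a : nat -> C) (z : C) (n : nat) : C := Csum (fun k => a k * z ^ k)%C n.

Lemma Csum_ext f g n : (forall k, f k = g k) -> Csum f n = Csum g n.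
Proof. intros H. induction n; simpl; [trivial|]. rewrite IHn, H. trivial. Qed.

Lemma pow_n_Cpow (z : C) n : pow_n (K := C_Ring) z n = (z ^ n)%C.
Proof. induction n; simpl; [reflexivity|]. rewrite <- IHn. reflexivity. Qed.

Lemma Cpseries_Clim a z l : Cpseries a z l <-> Clim (Cpsum a z) l.
Proof.
  unfold Cpseries, is_pseries. rewrite is_series_Clim. unfold Cpsum.
  assert (E : forall k, (pow_n (K := C_Ring) z k * a k = a k * z ^ k)%C)
    by (intros; rewrite pow_n_Cpow; ring).
  split; apply Clim_ext; intros n; apply Csum_ext; intros k; [exact (E k)|symmetry; exact (E k)].
Qed.

Lemma Cpseries_unique a z l m : Cpseries a z l -> Cpseries a z m -> l = m.
Proof. rewrite !Cpseries_Clim. apply Clim_unique. Qed.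

Lemma Cpseries_ext a b z l : (forall k, a k = b k) -> Cpseries a z l -> Cpseries b z l.
Proof.
  rewrite !Cpseries_Clim. intros H. apply Clim_ext. intros n. apply Csum_ext. intros; rewrite H; trivial.
Qed.

(** An expansion with infinite radius is demanded at every centre, so that no recentring theorem for
    power series is needed. *)
Definition entire (f : C -> C) : Prop :=
  forall z0, exists a, forall w, Cpseries a w (f (z0 + w)%C).

Lemma entire_ext f g : (forall z, f z = g z) -> entire f -> entire g.
Proof. intros E H z0. destruct (H z0) as [a Ha]. exists a. intros w. rewrite <- E. apply Ha. Qed.

Lemma Cpsum_plus a b z n : Cpsum (fun k => a k + b k)%C z n = (Cpsum a z n + Cpsum b z n)%C.
Proof. unfold Cpsum. induction n; simpl; [ring|]. rewrite IHn. ring. Qed.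

Lemma Cpsum_scal c a z n : Cpsum (fun k => c * a k)%C z n = (c * Cpsum a z n)%C.
Proof. unfold Cpsum. induction n; simpl; [ring|]. rewrite IHn. ring. Qed.

Lemma Cpseries_plus a b z l m : Cpseries a z l -> Cpseries b z m ->
  Cpseries (fun k => a k + b k)%C z (l + m)%C.
Proof.
  rewrite !Cpseries_Clim. intros H1 H2.
  apply (Clim_ext (fun n => Cpsum a z n + Cpsum b z n)%C); [intros; rewrite Cpsum_plus; trivial|].
  apply Clim_plus; trivial.
Qed.

Lemma Cpseries_scal c a z l : Cpseries a z l -> Cpseries (fun k => c * a k)%C z (c * l)%C.
Proof.
  rewrite !Cpseries_Clim. intros H1.
  apply (Clim_ext (fun n => c * Cpsum a z n)%C); [intros; rewrite Cpsum_scal; trivial|].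
  apply Clim_scal; trivial.
Qed.

Lemma Cpseries_minus a b z l m : Cpseries a z l -> Cpseries b z m ->
  Cpseries (fun k => a k - b k)%C z (l - m)%C.
Proof.
  intros H1 H2. apply (Cpseries_scal (- (1))%C) in H2.
  pose proof (Cpseries_plus _ _ _ _ _ H1 H2) as H.
  replace (l - m)%C with (l + - (1) * m)%C by ring.
  eapply Cpseries_ext; [|exact H]. intros; cbv beta; ring.
Qed.

Definition shift_coef (a : nat -> C) (k : nat) : C :=
  match k with O => RtoC 0 | S j => a j end.

Lemma Cpsum_shift a z n : Cpsum (shift_coef a) z (S n) = (z * Cpsum a z n)%C.
Proof.
  unfold Cpsum. induction n.
  - simpl. ring.
  - change (Csum (fun k => shift_coef a k * z ^ k) (S (S n)))%C with
      (Csum (fun k => shift_coef a k * z ^ k) (S n) + a n * z ^ S n)%C.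
    rewrite IHn. simpl. ring.
Qed.

Lemma Cpseries_shift a z l : Cpseries a z l -> Cpseries (shift_coef a) z (z * l)%C.
Proof.
  rewrite !Cpseries_Clim. intros H. apply Clim_incr.
  apply (Clim_ext (fun n => z * Cpsum a z n)%C); [intros; rewrite Cpsum_shift; trivial|].
  apply Clim_scal; trivial.
Qed.

Lemma Cpsum_decr a z n : (Cpsum a z (S n) - a 0%nat = z * Cpsum (fun k => a (S k)) z n)%C.
Proof.
  unfold Cpsum. induction n.
  - simpl. ring.
  - change (Csum (fun k => a k * z ^ k) (S (S n)))%C with
      (Csum (fun k => a k * z ^ k) (S n) + a (S n) * z ^ S n)%C.
    change (Csum (fun k => a (S k) * z ^ k) (S n))%C with
      (Csum (fun k => a (S k) * z ^ k) n + a (S n) * z ^ n)%C.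
    rewrite Cmult_plus_distr_l, <- IHn. rewrite Cpow_S. ring.
Qed.

Lemma Cpseries_decr a z l : z <> RtoC 0 -> Cpseries a z l ->
  Cpseries (fun k => a (S k)) z ((l - a 0%nat) / z)%C.
Proof.
  rewrite !Cpseries_Clim. intros Hz H. apply Clim_incr in H.
  apply (Clim_ext (fun n => / z * (Cpsum a z (S n) - a 0%nat))%C).
  { intros n. rewrite Cpsum_decr. field. trivial. }
  replace ((l - a 0%nat) / z)%C with (/ z * (l - a 0%nat))%C by (unfold Cdiv; ring).
  apply Clim_scal. apply Clim_minus; trivial. apply Clim_const.
Qed.

Lemma Cpseries_0 a : Cpseries a 0 (a 0%nat).
Proof.
  apply Cpseries_Clim, Clim_incr. apply (Clim_ext (fun _ => a 0%nat)); [|apply Clim_const].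
  intros n. symmetry. apply Ceq_minus. rewrite Cpsum_decr. ring.
Qed.

Lemma entire_plus f g : entire f -> entire g -> entire (fun z => f z + g z)%C.
Proof.
  intros Hf Hg z0. destruct (Hf z0) as [a Ha], (Hg z0) as [b Hb].
  eexists. intros w. apply Cpseries_plus; [apply Ha|apply Hb].
Qed.

Lemma entire_scal c f : entire f -> entire (fun z => c * f z)%C.
Proof.
  intros Hf z0. destruct (Hf z0) as [a Ha]. eexists. intros w. apply Cpseries_scal, Ha.
Qed.

Lemma entire_mult_linear c f : entire f -> entire (fun z => (z - c) * f z)%C.
Proof.
  intros Hf z0. destruct (Hf z0) as [a Ha]. eexists. intros w.
  replace ((z0 + w - c) * f (z0 + w))%C with ((z0 - c) * f (z0 + w) + w * f (z0 + w))%C by ring.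
  apply Cpseries_plus; [apply Cpseries_scal, Ha|apply Cpseries_shift, Ha].
Qed.

Lemma entire_reflect c f : entire f -> entire (fun z => f (c - z)%C).
Proof.
  intros Hf z0. destruct (Hf (c - z0)%C) as [a Ha].
  exists (fun k => (- (1)) ^ k * a k)%C. intros w.
  replace (c - (z0 + w))%C with (c - z0 + - w)%C by ring.
  specialize (Ha (- w)%C). apply Cpseries_Clim. apply Cpseries_Clim in Ha.
  eapply Clim_ext; [|exact Ha]. intros n. apply Csum_ext. intros k.
  replace (- w)%C with (- (1) * w)%C by ring. rewrite Cpow_mult_l. ring.
Qed.

Lemma geom_lim_0 q M : 0 <= q < 1 -> is_lim_seq (fun n => M * q ^ n) 0.
Proof.
  intros Hq. apply is_lim_seq_scal_0. apply is_lim_seq_geom.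
  rewrite Rabs_right; lra.
Qed.

Lemma entire_exp c : entire (fun z => Cexp (c * z)%C).
Proof.
  intros z0. exists (fun k => Cexp (c * z0) * (c ^ k * / INR (fact k)))%C. intros w.
  apply Cpseries_Clim.
  apply (Clim_ext (fun n => Cexp (c * z0) * exp_sum n (c * w))%C).
  { intros n. unfold Cpsum. induction n as [|n IH]; simpl; [ring|].
    rewrite <- IH. rewrite Cpow_mult_l. ring. }
  replace (Cexp (c * (z0 + w))) with (Cexp (c * z0) * Cexp (c * w))%C
    by (rewrite <- Cexp_plus; f_equal; ring).
  apply Clim_scal. apply (Clim_squeeze _ _ (fun n => exp (3 * Cmod (c * w)) * (/ 2) ^ n)).
  - intros n. rewrite Cmod_sub_sym, Rmult_comm. apply Cexp_remainder_geom.
  - apply geom_lim_0. lra.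
Qed.

(** Long division: the coefficients of f(w)/(w + d) when f has the coefficients [a]. This carries
    the division by s - 1 to centres other than 1. *)
Fixpoint div_coef (a : nat -> C) (d : C) (n : nat) : C :=
  match n with
  | O => (a 0%nat / d)%C
  | S k => ((a (S k) - div_coef a d k) / d)%C
  end.

Lemma Cpsum_div a d w n : d <> RtoC 0 ->
  ((w + d) * Cpsum (div_coef a d) w (S n) = Cpsum a w (S n) + div_coef a d n * w ^ S n)%C.
Proof.
  intros Hd. unfold Cpsum. induction n as [|n IH].
  - simpl. field. trivial.
  - change (Csum (fun k => div_coef a d k * w ^ k) (S (S n)))%C with
      (Csum (fun k => div_coef a d k * w ^ k) (S n) + div_coef a d (S n) * w ^ S n)%C.
    change (Csum (fun k => a k * w ^ k) (S (S n)))%C with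
      (Csum (fun k => a k * w ^ k) (S n) + a (S n) * w ^ S n)%C.
    rewrite Cmult_plus_distr_l, IH.
    change (div_coef a d (S n)) with ((a (S n) - div_coef a d n) / d)%C.
    rewrite (Cpow_S w (S n)). field. trivial.
Qed.

Lemma Cpseries_term_bounded a z l : Cpseries a z l ->
  exists T, 0 < T /\ forall n, Cmod (a n) * Cmod z ^ n <= T.
Proof.
  rewrite Cpseries_Clim. intros H.
  assert (H0 : Clim (fun n => a n * z ^ n)%C 0).
  { apply (Clim_ext (fun n => Cpsum a z (S n) - Cpsum a z n)%C).
    - intros n. unfold Cpsum. simpl. ring.
    - replace (RtoC 0) with (l - l)%C by ring. apply Clim_minus; trivial. apply Clim_incr; trivial. }
  unfold Clim in H0.
  destruct (is_lim_seq_spec (fun n => Cmod (a n * z ^ n - 0)) 0) as [_ S].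
  specialize (S H0 (mkposreal 1 Rlt_0_1)). destruct S as [N HN]. simpl in HN.
  assert (B : exists T, 1 <= T /\ forall n, (n < N)%nat -> Cmod (a n) * Cmod z ^ n <= T).
  { clear HN. induction N as [|N [T [HT IH]]].
    - exists 1. split; [lra|]. intros; lia.
    - exists (T + Cmod (a N) * Cmod z ^ N).
      assert (0 <= Cmod (a N) * Cmod z ^ N) by (apply Rmult_le_pos; [|apply pow_le]; apply Cmod_ge_0).
      split; [lra|]. intros n Hn. destruct (Nat.eq_dec n N) as [->|h]; [lra|].
      specialize (IH n ltac:(lia)). lra. }
  destruct B as [T [HT HB]]. exists T. split; [lra|]. intros n.
  destruct (Nat.lt_ge_cases n N) as [h|h]; [apply HB, h|].
  specialize (HN n h). rewrite Rminus_0_r, Rabs_right in HN by (apply Rle_ge, Cmod_ge_0).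
  replace (a n * z ^ n - 0)%C with (a n * z ^ n)%C in HN by ring.
  rewrite Cmod_mult, Cmod_pow in HN. lra.
Qed.

Lemma Cpseries_div a (f : C -> C) d : d <> RtoC 0 ->
  (forall w, Cpseries a w (f w)) ->
  forall w, Cmod w < Cmod d -> Cpseries (div_coef a d) w (f w / (w + d))%C.
Proof.
  intros Hd Ha w Hw.
  (* Convergence at twice the radius makes |a_n| |d|^n at most T / 2^n. The recursion then keeps the
     n-th quotient coefficient times |d|^(n+1) below 2T, so the remainder in [Cpsum_div] vanishes in
     the limit for |w| < |d|. *)
  destruct (Cpseries_term_bounded a (2 * d)%C _ (Ha _)) as [T [HT0 HT]].
  pose proof (proj1 (Cmod_gt_0 d) Hd) as Hm. set (m := Cmod d) in *.
  assert (HT' : forall n, Cmod (a n) * m ^ n <= T * (/ 2) ^ n).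
  { intros n. specialize (HT n). rewrite Cmod_mult, Cmod_R, Rabs_right, Rpow_mult_distr in HT by lra.
    fold m in HT. rewrite pow_inv. assert (P : 0 < 2 ^ n) by (apply pow_lt; lra).
    apply Rmult_le_reg_r with (2 ^ n); trivial.
    rewrite (Rmult_assoc T), Rinv_l by lra. lra. }
  assert (HC : forall n, Cmod (div_coef a d n) * m ^ S n <= T * (2 - (/ 2) ^ n)).
  { induction n as [|n IH].
    - change (div_coef a d 0) with (a 0%nat / d)%C. rewrite Cmod_div by trivial. fold m.
      specialize (HT' 0%nat). simpl in *. replace (Cmod (a 0%nat) / m * (m * 1)) with (Cmod (a 0%nat)) by (field; lra).
      lra.
    - change (div_coef a d (S n)) with ((a (S n) - div_coef a d n) / d)%C.
      rewrite Cmod_div by trivial. fold m.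
      replace (Cmod (a (S n) - div_coef a d n) / m * m ^ S (S n)) with
        (Cmod (a (S n) - div_coef a d n) * m ^ S n) by (simpl; field; lra).
      specialize (HT' (S n)).
      assert (P : 0 < m ^ S n) by (apply pow_lt; trivial).
      apply Rle_trans with ((Cmod (a (S n)) + Cmod (div_coef a d n)) * m ^ S n).
      + apply Rmult_le_compat_r; [lra|].
        eapply Rle_trans; [apply Cmod_triangle|]. rewrite Cmod_opp. lra.
      + change ((/ 2) ^ S n) with (/ 2 * (/ 2) ^ n) in *.
        rewrite Rmult_plus_distr_r. lra. }
  assert (Hwd : (w + d)%C <> RtoC 0).
  { intros E. assert (w = - d)%C by (replace w with ((w + d) - d)%C by ring; rewrite E; ring).
    subst w. rewrite Cmod_opp in Hw. fold m in Hw. lra. }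
  apply Cpseries_Clim, Clim_incr.
  apply (Clim_ext (fun n => / (w + d) * (Cpsum a w (S n) + div_coef a d n * w ^ S n))%C).
  { intros n. rewrite <- Cpsum_div by trivial. field. trivial. }
  replace (f w / (w + d))%C with (/ (w + d) * (f w + 0))%C by (unfold Cdiv; ring).
  apply Clim_scal, Clim_plus.
  - apply Clim_incr. apply Cpseries_Clim, Ha.
  - apply (Clim_squeeze _ _ (fun n => 2 * T * (Cmod w / m) * (Cmod w / m) ^ n)).
    + intros n. replace (div_coef a d n * w ^ S n - 0)%C with (div_coef a d n * w ^ S n)%C by ring.
      rewrite Cmod_mult, Cmod_pow. specialize (HC n).
      pose proof (Cmod_ge_0 w).
      assert (P : 0 < m ^ S n) by (apply pow_lt; trivial).
      assert (P2 : 0 < (/ 2) ^ n) by (apply pow_lt; lra).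
      replace (2 * T * (Cmod w / m) * (Cmod w / m) ^ n) with (2 * T * (Cmod w / m) ^ S n) by (simpl; ring).
      replace (Cmod w ^ S n) with ((Cmod w / m) ^ S n * m ^ S n).
      2: { rewrite <- Rpow_mult_distr. f_equal. field. lra. }
      assert (P3 : 0 <= (Cmod w / m) ^ S n).
      { apply pow_le. apply Rmult_le_pos; trivial. left; apply Rinv_0_lt_compat; trivial. }
      assert (Cmod (div_coef a d n) * m ^ S n <= 2 * T) by nra. nra.
    + apply geom_lim_0. split.
      * apply Rmult_le_pos; [apply Cmod_ge_0|left; apply Rinv_0_lt_compat; trivial].
      * apply Rmult_lt_reg_r with m; trivial. unfold Rdiv. rewrite Rmult_assoc, Rinv_l; lra.
Qed.

(** * Jensen's integral and the continued zeta function *)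

Lemma cpower_plus z a w : cpower z (a + w) = (cpower z a * Cexp (w * Clog z))%C.
Proof. unfold cpower. rewrite <- Cexp_plus. f_equal. ring. Qed.

Lemma cpower_0 z : cpower z 0 = RtoC 1.
Proof. unfold cpower. rewrite Cmult_0_l. apply Cexp_0. Qed.

Lemma tame_exp_sum w n : tame (fun z => exp_sum n (w * Clog z)%C).
Proof.
  induction n as [|n IH]; [apply (tame_const 0)|].
  apply (tame_plus (fun z => exp_sum n (w * Clog z)%C) (fun z => (w * Clog z) ^ n * / INR (fact n))%C); trivial.
  apply tame_mult; [|apply tame_const].
  apply (tame_pow (fun z => w * Clog z)%C). apply tame_mult; [apply tame_const|apply tame_Clog].
Qed.

Definition B_coef (b : R) (a : C) (k : nat) : C :=
  CII (fun y => (cpower (b, y) a * (Clog (b, y) ^ k * / INR (fact k))) * (sech y ^ 2)%R)%C.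

Lemma B_coef_sum b a w n : 0 < b -> Cpsum (B_coef b a) w n =
  CII (fun y => (cpower (b, y) a * exp_sum n (w * Clog (b, y))) * (sech y ^ 2)%R)%C.
Proof.
  intros Hb. induction n as [|n IH].
  - unfold Cpsum; simpl.
    rewrite (CII_ext _ (fun _ => RtoC 0)) by (intros; ring).
    rewrite (CII_RtoC (fun _ => 0)). rewrite (II_ext _ (fun x => 0 * sech x)) by (intros; ring).
    destruct dominated_real_sech as [M HM]. rewrite (II_scal _ _ _ HM). rewrite Rmult_0_l. trivial.
  - change (Cpsum (B_coef b a) w (S n)) with (Cpsum (B_coef b a) w n + B_coef b a n * w ^ n)%C.
    rewrite IH.
    assert (T1 : tame (fun z => cpower z a * exp_sum n (w * Clog z))%C)
      by (apply tame_mult; [apply tame_cpower|apply tame_exp_sum]).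
    assert (T2 : tame (fun z => cpower z a * (Clog z ^ n * / INR (fact n)))%C).
    { apply tame_mult; [apply tame_cpower|]. apply tame_mult; [|apply tame_const].
      apply tame_pow, tame_Clog. }
    destruct (tame_sech2 _ b Hb T1) as [M1 D1]. destruct (tame_sech2 _ b Hb T2) as [M2 D2].
    unfold B_coef. rewrite Cmult_comm, <- (CII_scal _ _ _ D2).
    rewrite <- (CII_plus _ _ _ _ D1 (Cdominated_scal _ _ _ D2)).
    apply CII_ext. intros y. simpl. rewrite Cpow_mult_l. ring.
Qed.

(** The n-th remainder of the integrand lies in a growth class with constant 2^-n and an exponent
    independent of n: [m] accounts for |a| and [m'] for 3|w| in [Cexp_remainder_geom]. Integration
    against the kernel preserves the geometric rate. *)
Lemma entire_B_int b : 0 < b -> entire (B_int b).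
Proof.
  intros Hb a. exists (B_coef b a). intros w. apply Cpseries_Clim.
  destruct (exists_INR_ge (Cmod a)) as [m Hm]. destruct (exists_INR_ge (3 * Cmod w)) as [m' Hm'].
  set (S := strip_const (m + m') b b).
  apply (Clim_squeeze _ _ (fun n => (2 * PI * 16 * S) * (/ 2) ^ n)); [|apply geom_lim_0; lra].
  intros n. rewrite B_coef_sum by trivial. unfold B_int.
  assert (T1 : tame (fun z => cpower z a * exp_sum n (w * Clog z))%C)
    by (apply tame_mult; [apply tame_cpower|apply tame_exp_sum]).
  destruct (tame_sech2 _ b Hb T1) as [M1 D1].
  destruct (tame_sech2 _ b Hb (tame_cpower (a + w)%C)) as [M2 D2].
  rewrite <- (CII_minus _ _ _ _ D1 D2).
  set (h := fun z => (cpower z a * exp_sum n (w * Clog z) - cpower z (a + w))%C).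
  assert (Hh : hol h) by (apply tame_minus; [exact T1|apply tame_cpower]).
  assert (Gh : growth h ((/ 2) ^ n) (m + m')).
  { assert (P : 0 < (/ 2) ^ n) by (apply pow_lt; lra). split; [lra|]. intros z Hz. unfold h.
    rewrite cpower_plus.
    replace (cpower z a * exp_sum n (w * Clog z) - cpower z a * Cexp (w * Clog z))%C
      with (cpower z a * (exp_sum n (w * Clog z) - Cexp (w * Clog z)))%C by ring.
    rewrite Cmod_mult, (Cmod_sub_sym (exp_sum _ _)), plus_INR, Rmult_plus_distr_r, exp_plus.
    pose proof (Cmod_cpower_le z a m Hm) as H1.
    pose proof (Cexp_remainder_geom n (w * Clog z)) as H2.
    assert (H3 : exp (3 * Cmod (w * Clog z)) <= exp (INR m' * Cmod (Clog z))).
    { apply exp_incr. rewrite Cmod_mult, <- Rmult_assoc. apply Rmult_le_compat_r; [apply Cmod_ge_0|lra]. }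
    replace ((/ 2) ^ n * (exp (INR m * Cmod (Clog z)) * exp (INR m' * Cmod (Clog z)))) with
     (exp (INR m * Cmod (Clog z)) * ((/ 2) ^ n * exp (INR m' * Cmod (Clog z)))) by ring.
    apply Rmult_le_compat; try apply Cmod_ge_0; trivial.
    eapply Rle_trans; [apply H2|]. apply Rmult_le_compat_l; lra. }
  destruct Hh as [h' Hh].
  pose proof (CII_bound _ _ (dominated_sech2 h h' _ _ b Hb Hh Gh)) as Bd. fold S in Bd.
  eapply Rle_trans; [|eapply Rle_trans; [exact Bd|right; ring]].
  right. f_equal. apply CII_ext. intros y. unfold h. ring.
Qed.

(** The factor pi/2 inverts the total mass 2/pi of the weight, so that the value at s = 1 is the
    residue 1. *)
Definition E_int (b : R) (s : C) : C := ((PI / 2)%R * B_int b (1 - s))%C.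

Lemma entire_E_int b : 0 < b -> entire (E_int b).
Proof. intros Hb. apply entire_scal, (entire_reflect 1 (B_int b)), entire_B_int, Hb. Qed.

Lemma E_int_1 b : 0 < b -> E_int b 1 = RtoC 1.
Proof.
  intros Hb. unfold E_int, B_int. replace (1 - 1)%C with (RtoC 0) by ring.
  rewrite (CII_ext _ (fun y => RtoC (sech y ^ 2))) by (intros; rewrite cpower_0; ring).
  rewrite CII_RtoC, II_sech2, <- RtoC_mult. f_equal. field. apply PI_neq0.
Qed.

Lemma E_int_rec b s : 0 < b ->
  (E_int b s - E_int (b + 1) s = (s - 1) * Rcpow (b + / 2) (- s))%C.
Proof.
  intros Hb. unfold E_int. rewrite Rcpow_cpower by lra.
  pose proof (B_int_rec b (1 - s) Hb) as H.
  replace ((PI / 2)%R * B_int b (1 - s) - (PI / 2)%R * B_int (b + 1) (1 - s))%C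
    with (- ((PI / 2)%R * (B_int (b + 1) (1 - s) - B_int b (1 - s))))%C by ring.
  rewrite H. replace (1 - s - 1)%C with (- s)%C by ring.
  replace ((PI / 2)%R * ((2 / PI)%R * ((1 - s) * cpower (b + / 2)%R (- s))))%C
    with ((PI / 2 * (2 / PI))%R * ((1 - s) * cpower (b + / 2)%R (- s)))%C by (rewrite RtoC_mult; ring).
  replace (PI / 2 * (2 / PI)) with 1 by (field; apply PI_neq0). ring.
Qed.

(* (s - 1) times the continued zeta function (Jensen's formula); the first term of the series is split off because Jensen's integral needs a base point [u - 1/2 > 0]. *)
Definition zeta_num (u : R) (s : C) : C := ((s - 1) * Rcpow u (- s) + E_int (u + / 2) s)%C.
Definition zeta_fun (u : R) (s : C) : C := (zeta_num u s / (s - 1))%C.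

Lemma entire_zeta_num u : 0 < u -> entire (zeta_num u).
Proof.
  intros Hu. apply entire_plus; [|apply entire_E_int; lra].
  apply entire_mult_linear.
  apply (entire_ext (fun s => Cexp (- (ln u) * s)%C)).
  - intros s. unfold Rcpow. f_equal. ring.
  - apply entire_exp.
Qed.

Lemma zeta_num_1 u : 0 < u -> zeta_num u 1 = RtoC 1.
Proof. intros Hu. unfold zeta_num. rewrite E_int_1 by lra. ring. Qed.

Lemma E_int_telescope b s n : 0 < b ->
  ((s - 1) * Csum (fun k => Rcpow (INR k + (b + / 2)) (- s)) n = E_int b s - E_int (INR n + b) s)%C.
Proof.
  intros Hb. induction n as [|n IH].
  - simpl. rewrite Rplus_0_l. ring.
  - change (Csum (fun k => Rcpow (INR k + (b + / 2)) (- s)) (S n)) with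
     (Csum (fun k => Rcpow (INR k + (b + / 2)) (- s)) n + Rcpow (INR n + (b + / 2)) (- s))%C.
    rewrite Cmult_plus_distr_l, IH.
    replace (INR n + (b + / 2)) with (INR n + b + / 2) by ring.
    rewrite <- E_int_rec by (pose proof (pos_INR n); lra).
    replace (INR (S n) + b) with (INR n + b + 1) by (rewrite S_INR; ring). ring.
Qed.

Lemma Csum_first f n : Csum f (S n) = (f 0%nat + Csum (fun k => f (S k)) n)%C.
Proof.
  induction n as [|n IH]; [simpl; ring|].
  change (Csum f (S (S n))) with (Csum f (S n) + f (S n))%C. rewrite IH. simpl. ring.
Qed.

Lemma zeta_partial_sum u s n : 0 < u -> s <> RtoC 1 ->
  Csum (fun k => Rcpow (INR k + u) (- s)) (S n) =
  (zeta_fun u s - E_int (INR n + (u + / 2)) s / (s - 1))%C.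
Proof.
  intros Hu Hs. rewrite Csum_first.
  assert (Hs1 : (s - 1)%C <> RtoC 0) by (apply Cminus_eq_contra, Hs).
  rewrite (Csum_ext _ (fun k => Rcpow (INR k + ((u + / 2) + / 2)) (- s))).
  2: { intros k. f_equal. rewrite S_INR. lra. }
  set (X := Csum _ n).
  assert (HX : X = ((E_int (u + / 2) s - E_int (INR n + (u + / 2)) s) / (s - 1))%C).
  { rewrite <- E_int_telescope by lra. fold X. field. trivial. }
  rewrite HX. simpl INR. rewrite Rplus_0_l. unfold zeta_fun, zeta_num. field. trivial.
Qed.

(** |z^a| = |z|^(Re a) exp(- Im a arg z). With Re a <= 0 the first factor is largest for the
    smallest |z|, and the 2 bounds |arg z| < pi/2. *)
Lemma Cmod_cpower_bound (z a : C) (be : R) : 0 < be <= Re z -> Re a <= 0 ->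
  Cmod (cpower z a) <= exp (Re a * ln be) * exp (2 * Rabs (Im a)).
Proof.
  intros [Hb1 Hb2] Ha. unfold cpower. rewrite Cmod_Cexp, <- exp_plus. apply exp_incr.
  rewrite re_mult. unfold Clog. simpl Re at 2. simpl Im at 2.
  assert (H1 : ln be <= ln (Cmod z)).
  { apply ln_le; trivial. eapply Rle_trans; [apply Hb2|]. eapply Rle_trans; [apply Rle_abs|apply re_le_Cmod]. }
  pose proof (atan_bound (Im z / Re z)). pose proof PI_4.
  pose proof (Rle_abs (Im a)). pose proof (Rle_abs (- Im a)). rewrite Rabs_Ropp in *.
  nra.
Qed.

Lemma ln_INR_lim c : is_lim_seq (fun n => ln (INR n + c)) p_infty.
Proof.
  apply is_lim_seq_spec. intros M. destruct (INR_unbounded (exp M - c)) as [N HN].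
  exists N. intros n Hn. apply le_INR in Hn. pose proof (exp_pos M).
  rewrite <- (ln_exp M). apply ln_increasing; lra.
Qed.

Lemma exp_neg_ln_lim p c : p < 0 -> is_lim_seq (fun n => exp (p * ln (INR n + c))) 0.
Proof.
  intros Hp. apply (is_lim_seq_ext (fun n => / exp (- p * ln (INR n + c)))).
  { intros n. rewrite <- exp_Ropp. f_equal. ring. }
  apply (is_lim_seq_inv _ p_infty); [|discriminate].
  apply (is_lim_seq_le_p_loc (fun n => - p * ln (INR n + c))).
  - exists 0%nat. intros n _. pose proof (exp_ineq1_le (- p * ln (INR n + c))). lra.
  - replace p_infty with (Rbar_mult (- p) p_infty).
    + apply is_lim_seq_scal_l, ln_INR_lim.
    + simpl. destruct (Rle_dec 0 (- p)) as [h|h]; [|lra].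
      destruct (Rle_lt_or_eq_dec 0 (- p) h); [trivial|lra].
Qed.

Lemma E_int_lim_0 b s : 0 < b -> 1 < Re s -> Clim (fun n => E_int (INR n + b) s) 0.
Proof.
  intros Hb Hs. destruct dominated_real_sech2 as [M0 HM0].
  pose proof (dominated_nonneg _ _ HM0) as HM.
  set (K := exp (2 * Rabs (Im (1 - s)%C))).
  apply (Clim_squeeze _ _ (fun n => (PI / 2 * (2 * PI * (K * M0))) * exp (Re (1 - s)%C * ln (INR n + b)))).
  - intros n. pose proof (pos_INR n).
    replace (E_int (INR n + b) s - 0)%C with (E_int (INR n + b) s) by ring.
    unfold E_int, B_int. rewrite Cmod_mult, Cmod_R, Rabs_right by (pose proof PI_RGT_0; lra).
    rewrite Rmult_assoc. apply Rmult_le_compat_l; [pose proof PI_RGT_0; lra|].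
    eapply Rle_trans.
    + destruct (dominated_cpower_sech2 (1 - s) (INR n + b) ltac:(lra)) as [M1 D1].
      apply (CII_weight_bound _ _ (exp (Re (1 - s)%C * ln (INR n + b)) * K) M0 M1 HM0 D1).
      intros y. apply Cmod_cpower_bound; [simpl; lra|].
        unfold Cminus. rewrite re_plus, re_opp, re_RtoC. lra.
    + right. ring.
  - apply is_lim_seq_scal_0. apply exp_neg_ln_lim.
    unfold Cminus. rewrite re_plus, re_opp, re_RtoC. lra.
Qed.

Lemma zeta_fun_series u s : 0 < u -> 1 < Re s ->
  @is_series C_AbsRing C_NormedModule (fun n => Rcpow (INR n + u) (- s)%C) (zeta_fun u s).
Proof.
  intros Hu Hs. apply is_series_Clim, Clim_incr.
  assert (Hs1 : s <> RtoC 1) by (intros ->; rewrite re_RtoC in Hs; lra).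
  eapply Clim_ext; [intros n; symmetry; apply zeta_partial_sum; trivial|].
  replace (zeta_fun u s) with (zeta_fun u s - / (s - 1) * 0)%C at 1 by ring.
  apply Clim_minus; [apply Clim_const|].
  apply (Clim_ext (fun n => / (s - 1) * E_int (INR n + (u + / 2)) s)%C).
  { intros; unfold Cdiv; ring. }
  apply Clim_scal, E_int_lim_0; [lra|trivial].
Qed.

Lemma zeta_fun_is_hurwitz u : 0 < u -> is_hurwitz_zeta u (zeta_fun u).
Proof.
  intros Hu. split; [|split].
  - intros s Hs. apply zeta_fun_series; trivial.
  - intros s Hs.
    assert (Hd : (s - 1)%C <> RtoC 0) by (apply Cminus_eq_contra, Hs).
    destruct (entire_zeta_num u Hu s) as [a Ha].
    exists (div_coef a (s - 1)). exists (mkposreal _ (proj1 (Cmod_gt_0 _) Hd)). simpl.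
    intros z Hz. pose proof (Cpseries_div a _ _ Hd Ha (z - s)%C Hz) as H. cbv beta in H.
    replace (s + (z - s))%C with z in H by ring.
    replace (z - s + (s - 1))%C with (z - 1)%C in H by ring. exact H.
  - destruct (entire_zeta_num u Hu 1) as [a Ha].
    exists 1%nat, a, (mkposreal 1 Rlt_0_1). intros z [Hz _].
    assert (Hd : (z - 1)%C <> RtoC 0) by (apply Cmod_gt_0; trivial).
    specialize (Ha (z - 1)%C). replace (1 + (z - 1))%C with z in Ha by ring.
    replace ((z - 1) ^ 1 * zeta_fun u z)%C with (zeta_num u z); trivial.
    unfold zeta_fun. simpl. field. trivial.
Qed.

(** * Uniqueness of the continuation *)

Lemma Cpsum_tail_bound a z x0 T : 0 < x0 -> (forall n, Cmod (a n) * x0 ^ n <= T) ->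
  Cmod z <= x0 / 2 -> forall n,
  Cmod (Cpsum a z (S n) - a 0%nat) <= 2 * T / x0 * Cmod z * (1 - (/ 2) ^ n).
Proof.
  intros Hx HT Hz. pose proof (Cmod_ge_0 z) as Z0.
  assert (T0 : 0 <= T).
  { eapply Rle_trans; [|apply (HT 0%nat)]. simpl. pose proof (Cmod_ge_0 (a 0%nat)). lra. }
  induction n as [|n IH].
  - unfold Cpsum. simpl. replace (0 + a 0%nat * 1 - a 0%nat)%C with (RtoC 0) by ring.
    rewrite Cmod_0. lra.
  - change (Cpsum a z (S (S n))) with (Cpsum a z (S n) + a (S n) * z ^ S n)%C.
    replace (Cpsum a z (S n) + a (S n) * z ^ S n - a 0%nat)%C
      with (Cpsum a z (S n) - a 0%nat + a (S n) * z ^ S n)%C by ring.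
    eapply Rle_trans; [apply Cmod_triangle|].
    assert (B : Cmod (a (S n) * z ^ S n) <= T / x0 * Cmod z * (/ 2) ^ n).
    { rewrite Cmod_mult, Cmod_pow. specialize (HT (S n)).
      assert (P : 0 < x0 ^ S n) by (apply pow_lt; trivial).
      assert (Q : Cmod z ^ n <= (x0 * / 2) ^ n) by (apply pow_incr; lra).
      rewrite Rpow_mult_distr in Q.
      assert (A0 := Cmod_ge_0 (a (S n))).
      apply Rle_trans with (Cmod (a (S n)) * (Cmod z * (x0 ^ n * (/ 2) ^ n))).
      - simpl. apply Rmult_le_compat_l; trivial. apply Rmult_le_compat_l; trivial.
      - replace (Cmod (a (S n)) * (Cmod z * (x0 ^ n * (/ 2) ^ n))) with
          ((Cmod (a (S n)) * x0 ^ S n) * (/ x0 * Cmod z * (/ 2) ^ n)) by (simpl; field; lra).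
        replace (T / x0 * Cmod z * (/ 2) ^ n) with (T * (/ x0 * Cmod z * (/ 2) ^ n)) by (unfold Rdiv; ring).
        apply Rmult_le_compat_r; trivial.
        repeat apply Rmult_le_pos; trivial; [left; apply Rinv_0_lt_compat; trivial|apply pow_le; lra]. }
    eapply Rle_trans; [apply Rplus_le_compat; [apply IH|apply B]|].
    right. simpl. field. lra.
Qed.

(** Convergence at one positive point bounds the terms geometrically in the disc of half that
    radius. This yields a Lipschitz bound at the centre, uniform over the sums there. *)
Lemma Cpseries_first_order a x0 l0 : 0 < x0 -> Cpseries a (RtoC x0) l0 ->
  exists K, 0 <= K /\ forall z l, Cmod z <= x0 / 2 -> Cpseries a z l -> Cmod (l - a 0%nat) <= K * Cmod z.
Proof.
  intros Hx H0. destruct (Cpseries_term_bounded _ _ _ H0) as [T [HT0 HT]].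
  rewrite Cmod_R, Rabs_right in HT by lra.
  exists (2 * T / x0). split.
  { apply Rmult_le_pos; [lra|left; apply Rinv_0_lt_compat; trivial]. }
  intros z l Hz Hl. apply Cpseries_Clim, Clim_incr in Hl.
  pose proof (Clim_minus _ _ _ _ Hl (Clim_const (a 0%nat))) as H.
  unfold Clim in H.
  assert (B : forall n, Cmod (l - a 0%nat) <= 2 * T / x0 * Cmod z + Cmod (Cpsum a z (S n) - a 0%nat - (l - a 0%nat))).
  { intros n. pose proof (Cpsum_tail_bound a z x0 T Hx HT Hz n) as B.
    assert (P : 0 < (/ 2) ^ n) by (apply pow_lt; lra).
    assert (Q : 0 <= 2 * T / x0 * Cmod z).
    { apply Rmult_le_pos; [|apply Cmod_ge_0].
      apply Rmult_le_pos; [lra|left; apply Rinv_0_lt_compat; trivial]. }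
    set (X := (Cpsum a z (S n) - a 0%nat)%C) in *.
    replace (l - a 0%nat)%C with (X + - (X - (l - a 0%nat)))%C at 1 by ring.
    eapply Rle_trans; [apply Cmod_triangle|]. rewrite Cmod_opp. nra. }
  apply (is_lim_seq_le _ _ (Finite _) (Finite _) B).
  - apply is_lim_seq_const.
  - replace (Finite (2 * T / x0 * Cmod z)) with (Finite (2 * T / x0 * Cmod z + 0)) by (f_equal; ring).
    apply is_lim_seq_plus'; [apply is_lim_seq_const|exact H].
Qed.

Lemma RtoC_neq_0 x : x <> 0 -> RtoC x <> RtoC 0.
Proof. intros H E. apply H, RtoC_inj, E. Qed.

(** As x decreases to 0 the Lipschitz bound kills the constant coefficient; dividing by x shifts the
    series and the induction continues. A one-sided real interval is what agreement for real s > 1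
    provides. *)
Lemma Cpseries_real_zero a r : 0 < r ->
  (forall x, 0 < x < r -> Cpseries a (RtoC x) 0) -> forall n, a n = RtoC 0.
Proof.
  intros Hr H n. revert a H.
  assert (Z : forall a, (forall x, 0 < x < r -> Cpseries a (RtoC x) 0) -> a 0%nat = RtoC 0).
  { intros a H. destruct (Cpseries_first_order a (r / 2) _ ltac:(lra) (H (r / 2) ltac:(lra))) as [K [HK HB]].
    apply Cmod_eq_0. apply Rle_antisym; [|apply Cmod_ge_0]. apply Rnot_lt_le. intros Hlt.
    set (x := Rmin (r / 4) (Cmod (a 0%nat) / (2 * (K + 1)))).
    assert (Hx0 : 0 < x) by (apply Rmin_pos; [lra|apply Rdiv_lt_0_compat; lra]).
    assert (Hx1 : x <= r / 4) by apply Rmin_l.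
    assert (Hx2 : x * (2 * (K + 1)) <= Cmod (a 0%nat)).
    { replace (Cmod (a 0%nat)) with (Cmod (a 0%nat) / (2 * (K + 1)) * (2 * (K + 1))) by (field; lra).
      apply Rmult_le_compat_r; [lra|apply Rmin_r]. }
    assert (Hcx : Cmod x = x) by (rewrite Cmod_R, Rabs_right; lra).
    specialize (HB (RtoC x) 0 ltac:(rewrite Hcx; lra) (H x ltac:(lra))).
    rewrite Hcx in HB. replace (0 - a 0%nat)%C with (- a 0%nat)%C in HB by ring.
    rewrite Cmod_opp in HB. nra. }
  induction n as [|n IH]; intros a H; [apply Z, H|].
  apply (IH (fun k => a (S k))). intros x Hx.
  pose proof (Cpseries_decr a (RtoC x) 0 (RtoC_neq_0 x ltac:(lra)) (H x Hx)) as D.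
  rewrite (Z a H) in D. replace ((0 - 0) / x)%C with (RtoC 0) in D; trivial.
  field. apply RtoC_neq_0; lra.
Qed.

Lemma Cpseries_real_unique a b (f : R -> C) r : 0 < r ->
  (forall x, 0 < x < r -> Cpseries a (RtoC x) (f x)) ->
  (forall x, 0 < x < r -> Cpseries b (RtoC x) (f x)) -> forall n, a n = b n.
Proof.
  intros Hr Ha Hb n. apply Ceq_minus.
  apply (Cpseries_real_zero (fun n => a n - b n)%C r Hr). intros x Hx.
  replace (RtoC 0) with (f x - f x)%C by ring. apply Cpseries_minus; auto.
Qed.

Lemma Cpseries_coef_0 a z : (forall n, a n = RtoC 0) -> Cpseries a z 0.
Proof.
  intros H. apply Cpseries_Clim. apply (Clim_ext (fun _ => RtoC 0)); [|apply Clim_const].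
  intros n. unfold Cpsum. induction n; simpl; [trivial|]. rewrite <- IHn, H. ring.
Qed.

Definition real_analytic (f : R -> C) (x : R) : Prop :=
  exists a r, 0 < r /\ forall w, Rabs w < r -> Cpseries a (RtoC w) (f (x + w)).

Lemma analytic_real f (x : R) : analytic_at f x -> real_analytic (fun t => f (RtoC t)) x.
Proof.
  intros [a [r H]]. exists a, r. split; [apply cond_pos|]. intros w Hw.
  specialize (H (RtoC (x + w))). replace (RtoC (x + w) - x)%C with (RtoC w) in H by (rewrite RtoC_plus; ring).
  apply H. rewrite Cmod_R. exact Hw.
Qed.

Lemma real_analytic_minus f g x : real_analytic f x -> real_analytic g x ->
  real_analytic (fun t => f t - g t)%C x.
Proof.
  intros [a [r [Hr Ha]]] [b [q [Hq Hb]]].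
  exists (fun n => a n - b n)%C, (Rmin r q). split; [apply Rmin_pos; trivial|].
  intros w Hw. apply Cpseries_minus; [apply Ha|apply Hb];
    (eapply Rlt_le_trans; [apply Hw|]); [apply Rmin_l|apply Rmin_r].
Qed.

(** The interval of zeros is pushed to the left: the expansion at its left end vanishes on one side,
    hence has zero coefficients, hence vanishes a little further. *)
Lemma real_identity (H : R -> C) q : (forall x, x < q -> real_analytic H x) ->
  (exists q', q' < q /\ forall x, q' < x < q -> H x = RtoC 0) ->
  forall x, x < q -> H x = RtoC 0.
Proof.
  intros Ha [q' [Hq' Hz]] x Hx.
  destruct (Rlt_le_dec q' x) as [h|h]; [apply Hz; lra|].
  (* Left ends are cut off at p < x so that their infimum exists, and they enter S with reversed
     sign because [completeness] speaks of suprema. *)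
  set (p := x - 1).
  set (S := fun t => p <= - t < q /\ forall z, - t < z < q -> H z = RtoC 0).
  destruct (completeness S) as [m [Hub Hlub]].
  - exists (- p). intros t [Ht _]. lra.
  - exists (- q'). split; [unfold p; lra|]. intros z Hz'. apply Hz. lra.
  - set (y := - m).
    assert (Hy1 : y <= q') by (assert (- q' <= m) by (apply Hub; split; [unfold p; lra|intros; apply Hz; lra]); unfold y; lra).
    assert (Hy2 : p <= y).
    { assert (m <= - p); [|unfold y; lra]. apply Hlub. intros t [Ht _]. lra. }
    assert (HyZ : forall z, y < z < q -> H z = RtoC 0).
    { intros z Hz'. destruct (classic (exists t, S t /\ - z < t)) as [[t [[_ Ht] Htz]]|N].
      - apply Ht. lra.
      - assert (m <= - z); [|unfold y in *; lra]. apply Hlub. intros t Ht.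
        apply Rnot_lt_le. intros Hlt. apply N. exists t. split; trivial. }
    destruct (Req_dec p y) as [E|E]; [apply HyZ; unfold p in *; lra|].
    destruct (Ha y ltac:(lra)) as [a [r [Hr Har]]].
    assert (Z : forall n, a n = RtoC 0).
    { assert (Hr' : 0 < Rmin r (q - y)) by (apply Rmin_pos; lra).
      apply (Cpseries_real_zero a _ Hr'). intros w Hw.
      pose proof (Rmin_l r (q - y)). pose proof (Rmin_r r (q - y)).
      rewrite <- (HyZ (y + w)) by lra. apply Har. rewrite Rabs_right; lra. }
    exfalso. set (y' := Rmax p (y - r / 2)).
    assert (Hy' : y' < y) by (apply Rmax_lub_lt; lra).
    assert (p <= y') by apply Rmax_l. assert (y - r / 2 <= y') by apply Rmax_r.
    assert (- y' <= m); [|unfold y in *; lra].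
    apply Hub. split; [lra|]. intros z Hz'. destruct (Rlt_le_dec y z) as [h'|h']; [apply HyZ; lra|].
    apply (Cpseries_unique a (RtoC (z - y))).
    + replace z with (y + (z - y)) at 2 by ring. apply Har. apply Rabs_def1; lra.
    + apply Cpseries_coef_0, Z.
Qed.

Fixpoint shift_coefs (N : nat) (a : nat -> C) : nat -> C :=
  match N with O => a | S n => shift_coef (shift_coefs n a) end.

Lemma Cpseries_shifts N a z l : Cpseries a z l -> Cpseries (shift_coefs N a) z (z ^ N * l)%C.
Proof.
  intros H. induction N as [|N IH]; simpl; [replace (1 * l)%C with l by ring; trivial|].
  rewrite <- Cmult_assoc. apply Cpseries_shift, IH.
Qed.

(** The order N in [meromorphic_at] is unknown, while the constructed function has order 1. Both are
    therefore multiplied by (s - 1)^(N+1); the coefficients agree because the functions agree for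
    real s > 1, and the equality of series then holds in the whole punctured disc. *)
Lemma hurwitz_near_1 u Z : 0 < u -> is_hurwitz_zeta u Z ->
  exists r : posreal, forall z, 0 < Cmod (z - 1) < r -> Z z = zeta_fun u z.
Proof.
  intros Hu [HZ1 [_ [N [a [r HZ3]]]]]. exists r.
  destruct (entire_zeta_num u Hu 1) as [e He].
  assert (E : forall n, shift_coefs 1 a n = shift_coefs N e n).
  { apply (Cpseries_real_unique _ _ (fun x => RtoC x ^ N * zeta_num u (1 + x))%C r (cond_pos r)).
    - intros x Hx. assert (Hx0 : RtoC x <> RtoC 0) by (apply RtoC_neq_0; lra).
      assert (Ex : (1 + x - 1)%C = RtoC x) by ring.
      specialize (HZ3 (1 + x)%C). rewrite Ex, Cmod_R, Rabs_right in HZ3 by lra.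
      specialize (HZ3 Hx).
      assert (EZ : Z (1 + x)%C = zeta_fun u (1 + x)%C).
      { assert (HR : 1 < Re (1 + x)%C) by (rewrite re_plus, !re_RtoC; lra).
        pose proof (HZ1 _ HR) as S1. pose proof (zeta_fun_series u _ Hu HR) as S2.
        apply is_series_Clim in S1. apply is_series_Clim in S2.
        apply (Clim_unique _ _ _ S1 S2). }
      rewrite EZ in HZ3. apply (Cpseries_shifts 1) in HZ3.
      replace (RtoC x ^ N * zeta_num u (1 + x))%C with (x ^ 1 * (x ^ N * zeta_fun u (1 + x)))%C; trivial.
      unfold zeta_fun. rewrite Ex. simpl. field. trivial.
    - intros x _. apply Cpseries_shifts, He. }
  intros z Hz. assert (Hz0 : (z - 1)%C <> RtoC 0) by (apply Cmod_gt_0; lra).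
  specialize (HZ3 z Hz). apply (Cpseries_shifts 1) in HZ3.
  specialize (He (z - 1)%C). replace (1 + (z - 1))%C with z in He by ring.
  apply (Cpseries_shifts N) in He.
  apply (Cpseries_ext _ _ _ _ E) in HZ3.
  pose proof (Cpseries_unique _ _ _ _ HZ3 He) as H.
  assert (Hp : ((z - 1) ^ N)%C <> RtoC 0) by (apply Cpow_nz; trivial).
  replace (Z z) with ((z - 1) ^ 1 * ((z - 1) ^ N * Z z) / ((z - 1) ^ 1 * (z - 1) ^ N))%C.
  2: { simpl. field. split; trivial. }
  rewrite H. unfold zeta_fun. simpl. field. split; trivial.
Qed.

Lemma hurwitz_zeta_spec u : 0 < u -> is_hurwitz_zeta u (hurwitz_zeta u).
Proof.
  intros Hu. unfold hurwitz_zeta. apply epsilon_spec. exists (zeta_fun u).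
  apply zeta_fun_is_hurwitz, Hu.
Qed.

Lemma hurwitz_zeta_real u x : 0 < u -> x < 1 -> hurwitz_zeta u (RtoC x) = zeta_fun u (RtoC x).
Proof.
  intros Hu Hx. apply Ceq_minus.
  pose proof (hurwitz_zeta_spec u Hu) as HZ.
  apply (real_identity (fun t => hurwitz_zeta u (RtoC t) - zeta_fun u (RtoC t))%C 1); trivial.
  - intros y Hy. assert (RtoC y <> RtoC 1) by (intros E; apply RtoC_inj in E; lra).
    apply (real_analytic_minus (fun t => hurwitz_zeta u (RtoC t)) (fun t => zeta_fun u (RtoC t)));
      apply analytic_real; [apply HZ|apply (zeta_fun_is_hurwitz u Hu)]; trivial.
  - destruct (hurwitz_near_1 u _ Hu HZ) as [r Hr]. exists (1 - r).
    split; [pose proof (cond_pos r); lra|]. intros y Hy.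
    rewrite Hr; [ring|]. rewrite <- RtoC_minus, Cmod_R, Rabs_left by lra. lra.
Qed.

Lemma fact_neq_0_C p : RtoC (INR (fact p)) <> RtoC 0.
Proof. apply RtoC_neq_0. pose proof (INR_fact_pos p). lra. Qed.

Lemma m1_pow_sq p : (RtoC (-1) ^ p * RtoC (-1) ^ p)%C = RtoC 1.
Proof. rewrite <- Cpow_mult_l, <- RtoC_mult. replace (-1 * -1) with 1 by ring. apply Cpow_1_l. Qed.

(** [zeta_num] is (s - 1) zeta, so the Laurent coefficients are its Taylor coefficients with the
    index raised by one. Coefficient 0 is the residue 1, which [is_stieltjes] subtracts; uniqueness
    of coefficients pins down the sequence picked by [epsilon]. *)
Lemma stieltjes_coef u e p : 0 < u -> (forall w, Cpseries e w (zeta_num u (1 + w)%C)) ->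
  stieltjes p u = (RtoC (-1) ^ p * INR (fact p) * e (S p))%C.
Proof.
  intros Hu He.
  assert (He0 : e 0%nat = RtoC 1).
  { apply (Cpseries_unique e 0); [apply Cpseries_0|].
    specialize (He 0). replace (1 + 0)%C with (RtoC 1) in He by ring.
    rewrite zeta_num_1 in He; trivial. }
  destruct (hurwitz_near_1 u _ Hu (hurwitz_zeta_spec u Hu)) as [r Hr].
  assert (V : forall s, 0 < Cmod (s - 1) < r ->
    Cpseries (fun p => e (S p)) (s - 1)%C (hurwitz_zeta u s - 1 / (s - 1))%C).
  { intros s Hs. assert (Hs0 : (s - 1)%C <> RtoC 0) by (apply Cmod_gt_0; lra).
    pose proof (Cpseries_decr e _ _ Hs0 (He (s - 1)%C)) as H.
    rewrite He0 in H. replace (1 + (s - 1))%C with s in H by ring.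
    rewrite Hr by trivial. unfold zeta_fun.
    replace (zeta_num u s / (s - 1) - 1 / (s - 1))%C with ((zeta_num u s - 1) / (s - 1))%C; trivial.
    field. trivial. }
  assert (X : is_stieltjes u (fun p => stieltjes p u)).
  { unfold stieltjes. apply epsilon_spec.
    exists (fun p => RtoC (-1) ^ p * INR (fact p) * e (S p))%C. exists r. intros s Hs.
    eapply Cpseries_ext; [|apply V, Hs]. intros k. cbv beta.
    replace (RtoC (-1) ^ k / INR (fact k) * (RtoC (-1) ^ k * INR (fact k) * e (S k)))%C
      with ((RtoC (-1) ^ k * RtoC (-1) ^ k) * e (S k))%C by (field; apply fact_neq_0_C).
    rewrite m1_pow_sq. ring. }
  destruct X as [r' Hr'].
  assert (Q : (RtoC (-1) ^ p / INR (fact p) * stieltjes p u)%C = e (S p)).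
  { apply (Cpseries_real_unique (fun p => RtoC (-1) ^ p / INR (fact p) * stieltjes p u)%C (fun p => e (S p))
      (fun x => hurwitz_zeta u (1 + x) - 1 / (1 + x - 1))%C (Rmin r r')).
    - apply Rmin_pos; apply cond_pos.
    - intros x Hx. pose proof (Rmin_r r r'). specialize (Hr' (1 + x)%C).
      replace (1 + x - 1)%C with (RtoC x) in * by ring. apply Hr'.
      rewrite Cmod_R, Rabs_right; lra.
    - intros x Hx. pose proof (Rmin_l r r'). specialize (V (1 + x)%C).
      replace (1 + x - 1)%C with (RtoC x) in * by ring. apply V.
      rewrite Cmod_R, Rabs_right; lra. }
  rewrite <- Q.
  replace (RtoC (-1) ^ p * INR (fact p) * (RtoC (-1) ^ p / INR (fact p) * stieltjes p u))%C
    with ((RtoC (-1) ^ p * RtoC (-1) ^ p) * stieltjes p u)%C by (field; apply fact_neq_0_C).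
  rewrite m1_pow_sq. ring.
Qed.

(** [C_derive] is built from limits along the horizontal line through the point, so the real and
    imaginary parts on the real axis determine it. *)
Lemma C_derive_real (f : C -> C) (x l1 l2 : R) :
  is_derive (fun t => Re (f (RtoC t))) x l1 -> is_derive (fun t => Im (f (RtoC t))) x l2 ->
  C_derive f (RtoC x) = (l1, l2).
Proof.
  assert (K : forall (g : R -> R) (l : R) (h : R -> R), is_derive g x l ->
     (forall t, t <> x -> h t = (g t - g x) / (t - x)) -> real (Lim h x) = l).
  { intros g l h Hg Hh.
    rewrite (is_lim_unique h x l); trivial.
    apply is_lim_spec. intros eps. apply is_derive_Reals in Hg.
    destruct (Hg eps (cond_pos eps)) as [d Hd]. exists d. intros t Ht Hne.
    rewrite Hh by trivial. specialize (Hd (t - x) ltac:(lra) Ht).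
    rewrite (Rplus_minus x t) in Hd. exact Hd. }
  assert (D : forall t, t <> x -> ((f (RtoC t) - f (RtoC x)) / (RtoC t - RtoC x))%C =
    ((Re (f (RtoC t)) - Re (f (RtoC x))) / (t - x), (Im (f (RtoC t)) - Im (f (RtoC x))) / (t - x))).
  { intros t Ht. rewrite <- RtoC_minus. unfold Cdiv. rewrite <- RtoC_inv by lra.
    unfold Cminus. rewrite (C_eta ((f (RtoC t) + - f (RtoC x)) * _)%C).
    rewrite re_scal_r, im_scal_r, re_plus, im_plus, re_opp, im_opp. reflexivity. }
  intros H1 H2. apply (f_equal2 (fun p q : R => (p, q))).
  - apply (K _ _ _ H1). intros t Ht.
    change (t, snd (RtoC x)) with (RtoC t). rewrite D by trivial. reflexivity.
  - apply (K _ _ _ H2). intros t Ht.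
    change (t, snd (RtoC x)) with (RtoC t). rewrite D by trivial. reflexivity.
Qed.

Lemma PSeries_of_bounded (a : nat -> R) (x r T : R) : Rabs x < r ->
  (forall n, Rabs (a n) * r ^ n <= T) -> Rbar_lt (Rabs x) (CV_radius a).
Proof.
  intros Hx HT. apply Rbar_lt_le_trans with (Finite r); [exact Hx|].
  apply CV_radius_bounded. exists T. intros n.
  rewrite Rabs_mult, <- RPow_abs. pose proof (Rabs_pos x). rewrite (Rabs_right r) by lra. apply HT.
Qed.

Lemma Cpsum_1 a z : Cpsum a z 1 = a 0%nat.
Proof. unfold Cpsum. simpl. ring. Qed.

Lemma Re_Cpsum a (x : R) n : Re (Cpsum a (RtoC x) (S n)) = sum_n (fun k => scal (pow_n x k) (Re (a k))) n.
Proof.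
  induction n as [|n IH].
  - rewrite sum_O, Cpsum_1. symmetry. exact (Rmult_1_l _).
  - change (Cpsum a (RtoC x) (S (S n))) with (Cpsum a (RtoC x) (S n) + a (S n) * RtoC x ^ S n)%C.
    rewrite sum_Sn, <- IH, re_plus, <- RtoC_pow, re_scal_r.
    apply (f_equal (Rplus _)). rewrite Rmult_comm. apply (f_equal (fun p => p * _)). symmetry. apply pow_n_pow.
Qed.

Lemma Im_Cpsum a (x : R) n : Im (Cpsum a (RtoC x) (S n)) = sum_n (fun k => scal (pow_n x k) (Im (a k))) n.
Proof.
  induction n as [|n IH].
  - rewrite sum_O, Cpsum_1. symmetry. exact (Rmult_1_l _).
  - change (Cpsum a (RtoC x) (S (S n))) with (Cpsum a (RtoC x) (S n) + a (S n) * RtoC x ^ S n)%C.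
    rewrite sum_Sn, <- IH, im_plus, <- RtoC_pow, im_scal_r.
    apply (f_equal (Rplus _)). rewrite Rmult_comm. apply (f_equal (fun p => p * _)). symmetry. apply pow_n_pow.
Qed.

Lemma Cpseries_real_parts a (x : R) l : Cpseries a (RtoC x) l ->
  PSeries (fun n => Re (a n)) x = Re l /\ PSeries (fun n => Im (a n)) x = Im l.
Proof.
  intros H. apply Cpseries_Clim, Clim_incr, Clim_re_im in H. destruct H as [H1 H2].
  split; apply is_pseries_unique.
  - change (is_lim_seq (sum_n (fun k => scal (pow_n x k) (Re (a k)))) (Re l)).
    eapply is_lim_seq_ext; [|exact H1]. intros n. apply Re_Cpsum.
  - change (is_lim_seq (sum_n (fun k => scal (pow_n x k) (Im (a k)))) (Im l)).
    eapply is_lim_seq_ext; [|exact H2]. intros n. apply Im_Cpsum.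
Qed.

Lemma Rabs_lt_of_near (t x r : R) : Rabs (t - x) < r - Rabs x -> Rabs t < r.
Proof. intros H. pose proof (Rabs_triang_inv t x). lra. Qed.

Lemma C_derive_2_pseries (f : C -> C) a r : 0 < r ->
  (forall x, Rabs x < r -> Cpseries a (RtoC x) (f (RtoC x))) ->
  C_derive (C_derive f) 0 = (2 * a 2%nat)%C.
Proof.
  intros Hr H.
  assert (CV : forall x, Rabs x < r -> Rbar_lt (Rabs x) (CV_radius (fun n => Re (a n))) /\
     Rbar_lt (Rabs x) (CV_radius (fun n => Im (a n)))).
  (* Convergence at a point strictly between |x| and r bounds the terms there, which puts |x| inside
     both real radii of convergence. *)
  { intros x Hx. set (q := (Rabs x + r) / 2).
    assert (Hq : Rabs q < r) by (unfold q; pose proof (Rabs_pos x); rewrite Rabs_right; lra).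
    destruct (Cpseries_term_bounded _ _ _ (H q Hq)) as [T [_ HT]].
    assert (Q0 : 0 <= q) by (unfold q; pose proof (Rabs_pos x); lra).
    rewrite Cmod_R, (Rabs_right q) in HT by lra.
    split; apply (PSeries_of_bounded _ x q T); try (unfold q; lra); intros n;
      (eapply Rle_trans; [|apply (HT n)]); (apply Rmult_le_compat_r; [apply pow_le; trivial|]);
      [apply re_le_Cmod|apply im_le_Cmod]. }
  assert (Near : forall x : R, Rabs x < r -> locally x (fun t : R => Rabs t < r)).
  { intros x Hx. assert (Hd : 0 < r - Rabs x) by lra. exists (mkposreal _ Hd). intros t Ht.
    apply (Rabs_lt_of_near t x r). exact Ht. }
  assert (D1 : forall x, Rabs x < r -> C_derive f (RtoC x) =
     (PSeries (PS_derive (fun n => Re (a n))) x, PSeries (PS_derive (fun n => Im (a n))) x)).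
  { intros x Hx. apply C_derive_real.
    - apply (is_derive_ext_loc (PSeries (fun n => Re (a n)))).
      + apply (filter_imp (fun t : R => Rabs t < r)); [|apply Near, Hx].
        intros t Ht. apply (Cpseries_real_parts a t _ (H t Ht)).
      + apply is_derive_PSeries, CV, Hx.
    - apply (is_derive_ext_loc (PSeries (fun n => Im (a n)))).
      + apply (filter_imp (fun t : R => Rabs t < r)); [|apply Near, Hx].
        intros t Ht. apply (Cpseries_real_parts a t _ (H t Ht)).
      + apply is_derive_PSeries, CV, Hx. }
  assert (H0 : Rabs 0 < r) by (rewrite Rabs_R0; trivial).
  destruct (CV 0 H0) as [CV1 CV2].
  rewrite (C_derive_real _ 0 (PSeries (PS_derive (PS_derive (fun n => Re (a n)))) 0)
    (PSeries (PS_derive (PS_derive (fun n => Im (a n)))) 0)).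
  - rewrite !PSeries_0. unfold PS_derive. rewrite (C_eta (2 * a 2%nat)%C), re_scal_l, im_scal_l.
    f_equal; simpl; ring.
  - apply (is_derive_ext_loc (PSeries (PS_derive (fun n => Re (a n))))).
    + apply (filter_imp (fun t : R => Rabs t < r)); [|apply Near, H0].
      intros t Ht. rewrite D1 by trivial. reflexivity.
    + apply is_derive_PSeries. rewrite CV_radius_derive. exact CV1.
  - apply (is_derive_ext_loc (PSeries (PS_derive (fun n => Im (a n))))).
    + apply (filter_imp (fun t : R => Rabs t < r)); [|apply Near, H0].
      intros t Ht. rewrite D1 by trivial. reflexivity.
    + apply is_derive_PSeries. rewrite CV_radius_derive. exact CV2.
Qed.

Lemma hurwitz_zeta''_coef u a : 0 < u ->
  (forall w, Cmod w < 1 -> Cpseries a w (zeta_fun u w)) ->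
  hurwitz_zeta'' 0 u = (2 * a 2%nat)%C.
Proof.
  intros Hu Ha. apply (C_derive_2_pseries _ a 1 Rlt_0_1). intros x Hx.
  rewrite hurwitz_zeta_real; trivial.
  - apply Ha. rewrite Cmod_R. exact Hx.
  - apply Rabs_def2 in Hx. lra.
Qed.

(** * The gamma function *)

(** With u = c|x|, both 1 and u^2/2 are at most e^u, hence 1 + x^2 <= (1 + 2/c^2) e^(c|x|). *)
Lemma exp_decay_dominated (f : R -> R) K c : 0 < c -> (forall x, continuous f x) ->
  (forall x, Rabs (f x) <= K * exp (- (c * Rabs x))) -> dominated f (K * (1 + 2 / c ^ 2)).
Proof.
  intros Hc Hf HK. split; trivial. intros x. eapply Rle_trans; [apply HK|].
  assert (K0 : 0 <= K).
  { pose proof (HK 0). pose proof (Rabs_pos (f 0)). pose proof (exp_pos (- (c * Rabs 0))). nra. }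
  unfold Rdiv. rewrite Rmult_assoc. apply Rmult_le_compat_l; trivial.
  pose proof (Rabs_pos x) as Hx.
  assert (Hcx : 0 <= c * Rabs x) by nra.
  pose proof (exp_sum_term (c * Rabs x) 2 Hcx) as H2. simpl in H2.
  pose proof (exp_sum_term (c * Rabs x) 0 Hcx) as H0. simpl in H0.
  rewrite exp_Ropp. set (E := exp (c * Rabs x)) in *.
  assert (E0 : 0 < E) by apply exp_pos.
  assert (Hx2 : Rabs x * Rabs x = x ^ 2) by (rewrite <- Rabs_mult, Rabs_right; [ring|nra]).
  assert (Hc2 : 0 < c ^ 2) by (apply pow_lt; trivial).
  assert (A1 : c ^ 2 * x ^ 2 <= 2 * E).
  { rewrite <- Hx2. lra. }
  assert (A2 : x ^ 2 <= 2 * / c ^ 2 * E).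
  { apply Rmult_le_reg_l with (c ^ 2); trivial.
    replace (c ^ 2 * (2 * / c ^ 2 * E)) with (2 * E) by (field; lra). trivial. }
  apply Rmult_le_reg_r with (E * (1 + x ^ 2)); [nra|].
  replace (/ E * (E * (1 + x ^ 2))) with (1 + x ^ 2) by (field; lra).
  replace ((1 + 2 * / c ^ 2) * / (1 + x ^ 2) * (E * (1 + x ^ 2))) with ((1 + 2 * / c ^ 2) * E)
    by (field; split; nra).
  lra.
Qed.

(** For x >= 0 the bound e^x >= x^2/2 reduces the claim to completing the square in (s + c) x -
    x^2/2. For x < 0 the term s x alone decays fast enough, as c <= s. *)
Lemma gamma_weight_bound s c x : 0 < c <= s ->
  exp (s * x - exp x) <= exp ((s + c) ^ 2 / 2) * exp (- (c * Rabs x)).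
Proof.
  intros Hc. rewrite <- exp_plus. apply exp_incr.
  destruct (Rle_dec 0 x) as [h|h].
  - rewrite (Rabs_right x) by lra. pose proof (exp_sum_term x 2 h) as H. simpl in H.
    pose proof (pow2_ge_0 (s + c - x)). nra.
  - rewrite (Rabs_left x) by lra. pose proof (exp_pos x). pose proof (pow2_ge_0 (s + c)). nra.
Qed.

Ltac cont_auto := intros; apply (real_derive_continuous); auto_derive; trivial.

(* Euler's integral after the substitution [t = e^x], which moves both singular ends to infinity. *)
Definition GI (s : R) : R := II (fun x => exp (s * x - exp x)).

Lemma dominated_gamma s : 0 < s -> exists M, dominated (fun x => exp (s * x - exp x)) M.
Proof.
  intros Hs. eexists. apply (exp_decay_dominated _ (exp ((s + s) ^ 2 / 2)) s Hs).
  - cont_auto.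
  - intros x. rewrite Rabs_right by (left; apply exp_pos). apply gamma_weight_bound. lra.
Qed.

Lemma dominated_lim_0 f M : dominated f M ->
  is_lim_seq (fun n => f (INR n)) 0 /\ is_lim_seq (fun n => f (- INR n)) 0.
Proof.
  intros [_ H]. split; apply is_lim_seq_abs_0;
    apply (is_lim_seq_le_le (fun _ => 0) _ (fun n => M / (1 + INR n ^ 2)));
    try apply is_lim_seq_const; try apply inv_square_lim; intros n; split; try apply Rabs_pos; try apply H.
  replace (INR n ^ 2) with ((- INR n) ^ 2) by ring. apply H.
Qed.

Lemma GI_rec s : 0 < s -> GI (s + 1) = s * GI s.
Proof.
  intros Hs. destruct (dominated_gamma s Hs) as [M D1].
  destruct (dominated_gamma (s + 1) ltac:(lra)) as [M' D2].
  destruct (dominated_lim_0 _ _ D1) as [L1 L2].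
  assert (D : dominated (fun x => s * exp (s * x - exp x) - exp ((s + 1) * x - exp x))
    (Rabs s * M + Rabs (-1) * M')).
  { apply (dominated_ext (fun x => s * exp (s * x - exp x) + (-1) * exp ((s + 1) * x - exp x))).
    - intros; ring.
    - apply dominated_plus; apply dominated_scal; trivial. }
  pose proof (II_FTC _ (fun x => exp (s * x - exp x)) _ 0 0 D) as F.
  rewrite (II_minus _ _ _ _ (dominated_scal _ _ s D1) D2), (II_scal _ _ _ D1) in F.
  fold (GI s) in F. fold (GI (s + 1)) in F.
  assert (s * GI s - GI (s + 1) = 0 - 0); [|lra]. apply F; trivial.
  intros x.
  replace (exp ((s + 1) * x - exp x)) with (exp (s * x - exp x) * exp x)
    by (rewrite <- exp_plus; f_equal; ring).
  auto_derive; trivial. unfold Rminus. ring.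
Qed.

Lemma II_ge_RInt f M a b : dominated f M -> (forall x, 0 <= f x) -> a <= b -> RInt f a b <= II f.
Proof.
  intros H Hf Hab. destruct (exists_INR_ge (Rabs a + Rabs b)) as [N HN].
  apply (is_lim_seq_le_loc (fun _ => RInt f a b) (fun n => RInt f (- INR n) (INR n)) (Finite _) (Finite _)).
  - exists N. intros n Hn. apply le_INR in Hn.
    pose proof (Rle_abs a). pose proof (Rle_abs b). pose proof (Rle_abs (- a)). pose proof (Rle_abs (- b)).
    rewrite Rabs_Ropp in *. pose proof (Rabs_pos a). pose proof (Rabs_pos b).
    rewrite (RInt_split f (- INR n) a (INR n)) by apply H.
    rewrite (RInt_split f a b (INR n)) by apply H.
    assert (0 <= RInt f (- INR n) a) by (apply RInt_ge_0; [lra|apply (dominated_ex_RInt _ _ _ _ H)|auto]).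
    assert (0 <= RInt f b (INR n)) by (apply RInt_ge_0; [lra|apply (dominated_ex_RInt _ _ _ _ H)|auto]).
    lra.
  - apply is_lim_seq_const.
  - apply (II_lim _ _ H).
Qed.

Lemma GI_pos s : 0 < s -> 0 < GI s.
Proof.
  intros Hs. destruct (dominated_gamma s Hs) as [M D].
  eapply Rlt_le_trans; [|apply (II_ge_RInt _ _ 0 1 D); [intros; left; apply exp_pos|lra]].
  apply RInt_gt_0; [lra|intros; apply exp_pos|intros; apply (proj1 D)].
Qed.

(** The tangent at t q lies below the graph; its values at q and at 0 are combined with the weights
    t and 1 - t. *)
Lemma exp_convex t q : 0 <= t <= 1 -> exp (t * q) <= 1 - t + t * exp q.
Proof.
  intros Ht. set (m := t * q).
  pose proof (exp_ineq1_le (q - m)) as H1. pose proof (exp_ineq1_le (- m)) as H2.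
  pose proof (exp_pos m) as P.
  assert (E1 : exp q = exp m * exp (q - m)) by (rewrite <- exp_plus; f_equal; ring).
  assert (E2 : 1 = exp m * exp (- m)) by (rewrite <- exp_plus, Rplus_opp_r, exp_0; trivial).
  assert (A1 : exp m * (1 + (q - m)) <= exp q) by (rewrite E1; apply Rmult_le_compat_l; lra).
  assert (A2 : exp m * (1 + - m) <= 1) by (rewrite E2 at 2; apply Rmult_le_compat_l; lra).
  assert (t * (exp m * (1 + (q - m))) <= t * exp q) by (apply Rmult_le_compat_l; lra).
  assert ((1 - t) * (exp m * (1 + - m)) <= (1 - t) * 1) by (apply Rmult_le_compat_l; lra).
  assert (t * (exp m * (1 + (q - m))) + (1 - t) * (exp m * (1 + - m)) = exp m) by (unfold m; ring).
  lra.
Qed.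

(** The part of log-convexity that is used: Gamma(z + t) <= z^t Gamma(z). Convexity of the
    exponential at x - ln z bounds the integrand by a combination of those for z and z + 1, which
    the recurrence collapses to one multiple of Gamma(z). *)
Lemma GI_interpolation z t : 0 < z -> 0 <= t <= 1 -> GI (z + t) <= exp (t * ln z) * GI z.
Proof.
  intros Hz Ht. destruct (dominated_gamma z Hz) as [M1 D1].
  destruct (dominated_gamma (z + 1) ltac:(lra)) as [M2 D2].
  destruct (dominated_gamma (z + t) ltac:(lra)) as [M3 D3].
  set (A := exp (t * ln z)).
  assert (E : GI (z + t) <= A * (1 - t) * GI z + A * t / z * GI (z + 1)).
  { unfold GI. rewrite <- (II_scal _ _ (A * (1 - t)) D1), <- (II_scal _ _ (A * t / z) D2).
    rewrite <- (II_plus _ _ _ _ (dominated_scal _ _ _ D1) (dominated_scal _ _ _ D2)).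
    eapply II_le; [exact D3|apply dominated_plus; apply dominated_scal; eassumption|].
    intros x. pose proof (exp_convex t (x - ln z) Ht) as H.
    replace ((z + t) * x - exp x) with ((z * x - exp x) + (t * ln z + t * (x - ln z))) by ring.
    replace ((z + 1) * x - exp x) with ((z * x - exp x) + (ln z + (x - ln z))) by ring.
    rewrite !exp_plus. fold A. rewrite (exp_ln z Hz).
    pose proof (exp_pos (z * x - exp x)). assert (0 < A) by apply exp_pos.
    replace (A * (1 - t) * exp (z * x - exp x) + A * t / z * (exp (z * x - exp x) * (z * exp (x - ln z))))
      with (exp (z * x - exp x) * (A * (1 - t + t * exp (x - ln z)))) by (field; lra).
    apply Rmult_le_compat_l; [lra|]. apply Rmult_le_compat_l; lra. }
  rewrite GI_rec in E by trivial. eapply Rle_trans; [apply E|]. right. field. lra.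
Qed.

Lemma GI_1 : GI 1 = 1.
Proof.
  destruct (dominated_gamma 1 Rlt_0_1) as [M D].
  unfold GI. rewrite (II_FTC _ (fun x => - exp (- exp x)) M 0 (-1) D).
  - ring.
  - intros x. replace (exp (1 * x - exp x)) with (exp x * exp (- exp x))
      by (rewrite <- exp_plus; f_equal; ring).
    auto_derive; trivial. ring.
  - replace (Finite 0) with (Finite (-1 * 0)) by (f_equal; ring).
    apply (is_lim_seq_ext (fun n => -1 * exp (- exp (INR n)))); [intros; ring|].
    apply is_lim_seq_mult'; [apply is_lim_seq_const|].
    apply (is_lim_seq_ext (fun n => / exp (exp (INR n)))); [intros; rewrite exp_Ropp; trivial|].
    apply (is_lim_seq_inv _ p_infty); [|discriminate].
    apply (is_lim_seq_le_p_loc (fun n => INR n)); [|apply is_lim_seq_INR].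
    exists 0%nat. intros n _. pose proof (exp_ineq1_le (INR n)). pose proof (exp_ineq1_le (exp (INR n))). lra.
  - replace (Finite (-1)) with (Finite (-1 * exp (- 0))) by (f_equal; rewrite Ropp_0, exp_0; ring).
    apply (is_lim_seq_ext (fun n => -1 * exp (- exp (1 * - INR n)))).
    { intros n. rewrite Rmult_1_l. ring. }
    apply is_lim_seq_mult'; [apply is_lim_seq_const|].
    apply (is_lim_seq_continuous (fun x => exp (- x)) _ 0).
    + apply continuity_pt_filterlim.
      apply (real_derive_continuous (fun x => exp (- x))). auto_derive; trivial.
    + apply exp_lin_lim_0. lra.
Qed.

(** In the logarithmic variable, scaling Euler's integral by c is the translation by ln c. *)
Lemma GI_scale s c : 0 < s -> 0 < c ->
  II (fun x => exp (s * x - c * exp x)) = exp (- (s * ln c)) * GI s /\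
  exists M, dominated (fun x => exp (s * x - c * exp x)) M.
Proof.
  intros Hs Hc. destruct (dominated_gamma s Hs) as [M D].
  assert (E : forall x, exp (- (s * ln c)) * exp (s * (x + ln c) - exp (x + ln c)) = exp (s * x - c * exp x)).
  { intros x. rewrite <- exp_plus. f_equal. rewrite (exp_plus x), exp_ln by trivial. ring. }
  assert (D' : exists N, dominated (fun x => exp (s * (x + ln c) - exp (x + ln c))) N).
  { set (L := ln c).
    eexists. apply (exp_decay_dominated _ (exp ((s + s) ^ 2 / 2) * exp (s * Rabs L)) s Hs).
    - cont_auto.
    - intros x. rewrite Rabs_right by (left; apply exp_pos).
      eapply Rle_trans; [apply (gamma_weight_bound s s); lra|].
      rewrite Rmult_assoc. apply Rmult_le_compat_l; [left; apply exp_pos|].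
      rewrite <- exp_plus. apply exp_incr.
      pose proof (Rabs_triang (x + L) (- L)) as H. rewrite Rabs_Ropp in H.
      replace (x + L + - L) with x in H by ring. nra. }
  destruct D' as [N D'].
  split.
  - rewrite <- (II_ext _ _ E), (II_scal _ _ _ D').
    f_equal. apply (II_shift (fun x => exp (s * x - exp x)) M N (ln c) D D').
  - eexists. eapply dominated_ext; [exact E|]. apply dominated_scal, D'.
Qed.

Lemma Gamma_GI s : 0 < s -> Gamma s = GI s.
Proof.
  intros Hs. destruct (dominated_gamma s Hs) as [M D].
  pose proof (dominated_nonneg _ _ D) as M0.
  unfold Gamma. apply (is_RInt_gen_unique (V := R_CompleteNormedModule)).
  set (f := fun t => Rpower t (s - 1) * exp (- t)).
  assert (Cf : forall t, 0 < t -> continuous f t).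
  { intros t Ht. unfold f, Rpower. apply (real_derive_continuous).
    auto_derive. trivial. }
  assert (Sub : forall a b, 0 < a -> 0 < b ->
    is_RInt f a b (RInt (fun x => exp (s * x - exp x)) (ln a) (ln b))).
  { intros a b Ha Hb.
    assert (Ex : ex_RInt f a b).
    { apply (ex_RInt_continuous (V := R_CompleteNormedModule)). intros t Ht. apply Cf.
      eapply Rlt_le_trans; [|apply Ht]. apply Rmin_pos; trivial. }
    replace (RInt (fun x => exp (s * x - exp x)) (ln a) (ln b)) with (RInt f a b).
    { apply (RInt_correct (V := R_CompleteNormedModule)), Ex. }
    symmetry. rewrite <- (exp_ln a Ha) at 2. rewrite <- (exp_ln b Hb) at 2.
    rewrite <- (RInt_comp (V := R_CompleteNormedModule) f exp exp).
    - apply RInt_ext. intros x _. change (exp (s * x - exp x) = exp x * f (exp x)).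
      unfold f, Rpower. rewrite ln_exp, <- !exp_plus. f_equal. ring.
    - intros; apply Cf, exp_pos.
    - intros; split; [apply is_derive_exp|]. cont_auto. }
  intros P [eps HP].
  assert (He : 0 < eps / (2 * M + 1)) by (apply Rdiv_lt_0_compat; [apply cond_pos|lra]).
  pose proof atan_lim as HL. apply is_lim_seq_spec in HL.
  destruct (HL (mkposreal _ He)) as [n Hn]. specialize (Hn n (Nat.le_refl n)). simpl in Hn.
  apply Rabs_def2 in Hn.
  (* Under the logarithm these neighbourhoods of 0 and +oo become the tails beyond -n and n, where
     [II_tail] applies. *)
  apply (Filter_prod _ _ _ (fun a => 0 < a < exp (- INR n)) (fun b => exp (INR n) < b)).
  - exists (mkposreal _ (exp_pos (- INR n))). intros a Ha Ha0. simpl in Ha.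
    assert (Ha' : Rabs (a - 0) < exp (- INR n)) by exact Ha.
    rewrite Rminus_0_r, Rabs_right in Ha' by lra. split; trivial.
  - exists (exp (INR n)). intros b Hb. exact Hb.
  - intros a b [Ha0 Ha] Hb. simpl.
    assert (Hb0 : 0 < b) by (eapply Rlt_trans; [apply exp_pos|apply Hb]).
    exists (RInt (fun x => exp (s * x - exp x)) (ln a) (ln b)). split; [apply Sub; trivial|].
    apply HP. apply ln_increasing in Ha; trivial. rewrite ln_exp in Ha.
    apply ln_increasing in Hb; [|apply exp_pos]. rewrite ln_exp in Hb.
    pose proof (atan_increasing _ _ Ha) as Aa. pose proof (atan_increasing _ _ Hb) as Ab.
    rewrite atan_opp in Aa.
    change (Rabs (RInt (fun x => exp (s * x - exp x)) (ln a) (ln b) - II (fun x => exp (s * x - exp x))) < eps).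
    rewrite Rabs_minus_sym. eapply Rle_lt_trans; [apply (II_tail _ _ _ _ D)|].
    assert (E : eps / (2 * M + 1) * (2 * M + 1) = eps) by (field; lra).
    pose proof (cond_pos eps). set (q := eps / (2 * M + 1)) in *. nra.
Qed.

(** * Expansion of Gamma at 1 and Euler's constant *)

Lemma derive_le_of_right (f g : R -> R) (p q d : R) : 0 < d -> is_derive f 0 p -> is_derive g 0 q ->
  f 0 = g 0 -> (forall t, 0 < t < d -> f t <= g t) -> p <= q.
Proof.
  intros Hd Hf Hg H0 Hle. apply Rnot_lt_le. intros Hpq.
  apply is_derive_Reals in Hf. apply is_derive_Reals in Hg.
  destruct (Hf ((p - q) / 2) ltac:(lra)) as [d1 H1].
  destruct (Hg ((p - q) / 2) ltac:(lra)) as [d2 H2].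
  set (t := Rmin d (Rmin d1 d2) / 2).
  assert (Hm : 0 < Rmin d (Rmin d1 d2)) by (repeat apply Rmin_pos; trivial; apply cond_pos).
  pose proof (Rmin_l d (Rmin d1 d2)). pose proof (Rmin_r d (Rmin d1 d2)).
  pose proof (Rmin_l d1 d2). pose proof (Rmin_r d1 d2).
  assert (Ht : 0 < t) by (unfold t; lra).
  specialize (H1 t ltac:(lra) ltac:(rewrite Rabs_right; unfold t; lra)).
  specialize (H2 t ltac:(lra) ltac:(rewrite Rabs_right; unfold t; lra)).
  specialize (Hle t ltac:(unfold t in *; lra)).
  rewrite Rplus_0_l in H1, H2. apply Rabs_def2 in H1. apply Rabs_def2 in H2.
  assert ((g t - g 0) / t < (f t - f 0) / t) by lra.
  assert ((g t - g 0) < (f t - f 0)); [|lra].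
  apply Rmult_lt_reg_r with (/ t); [apply Rinv_0_lt_compat; trivial|trivial].
Qed.

Lemma exp_remainder_3 u : Rabs (exp u - (1 + u + u ^ 2 / 2)) <= Rabs u ^ 3 / 6 * exp (Rabs u).
Proof.
  pose proof (Cexp_remainder 3 (RtoC u)) as H. rewrite Cmod_R in H.
  replace (INR (fact 3)) with 6 in H by (simpl; lra).
  eapply Rle_trans; [|exact H]. eapply Rle_trans; [|apply re_le_Cmod]. right. f_equal.
  unfold Cminus. rewrite re_plus, re_opp, Cexp_RtoC, re_RtoC.
  replace (exp_sum 3 u) with (RtoC (1 + u + u ^ 2 / 2)); [rewrite re_RtoC; ring|].
  change (exp_sum 3 u) with (exp_sum 1 u + u ^ 1 * / INR (fact 1) + u ^ 2 * / INR (fact 2))%C.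
  rewrite exp_sum_1. replace (INR (fact 1)) with 1 by (simpl; lra).
  replace (INR (fact 2)) with 2 by (simpl; lra).
  rewrite <- !RtoC_inv by lra. rewrite <- !RtoC_pow, <- !RtoC_mult, <- !RtoC_plus. f_equal. field.
Qed.

(** [gamma1] is Gamma'(1) and [gamma2] is Gamma''(1)/2, obtained by differentiating under the
    integral; neither is a Stieltjes constant. *)
Definition gamma1 : R := II (fun x => x * exp (1 * x - exp x)).
Definition gamma2 : R := II (fun x => x ^ 2 / 2 * exp (1 * x - exp x)).

Lemma gamma_weight_bound_1 x : exp (1 * x - exp x) <= exp 2 * exp (- (1 * Rabs x)).
Proof.
  eapply Rle_trans; [apply (gamma_weight_bound 1 1 x); lra|].
  right. do 2 f_equal. field.
Qed.

Lemma dominated_gamma1 : exists M, dominated (fun x => x * exp (1 * x - exp x)) M.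
Proof.
  eexists. apply (exp_decay_dominated _ (2 * exp 2) (1 / 2) ltac:(lra)).
  - cont_auto.
  - intros x. rewrite Rabs_mult, (Rabs_right (exp _)) by (left; apply exp_pos).
    pose proof (gamma_weight_bound_1 x) as W. pose proof (Rabs_pos x) as P.
    pose proof (exp_ineq1_le (Rabs x / 2)) as H1.
    replace (exp (- (1 / 2 * Rabs x))) with (exp (Rabs x / 2) * exp (- (1 * Rabs x)))
      by (rewrite <- exp_plus; f_equal; field).
    replace (2 * exp 2 * (exp (Rabs x / 2) * exp (- (1 * Rabs x)))) with
      ((2 * exp (Rabs x / 2)) * (exp 2 * exp (- (1 * Rabs x)))) by ring.
    apply Rmult_le_compat; trivial; [left; apply exp_pos|lra].
Qed.

Lemma dominated_gamma2 : exists M, dominated (fun x => x ^ 2 / 2 * exp (1 * x - exp x)) M.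
Proof.
  eexists. apply (exp_decay_dominated _ (4 * exp 2) (1 / 2) ltac:(lra)).
  - cont_auto.
  - intros x. rewrite Rabs_mult, (Rabs_right (exp _)) by (left; apply exp_pos).
    pose proof (gamma_weight_bound_1 x) as W. pose proof (Rabs_pos x) as P.
    pose proof (exp_sum_term (Rabs x / 2) 2 ltac:(lra)) as H1. simpl in H1.
    assert (Hx2 : Rabs x * Rabs x = x ^ 2) by (rewrite <- Rabs_mult, Rabs_right; [ring|nra]).
    replace (exp (- (1 / 2 * Rabs x))) with (exp (Rabs x / 2) * exp (- (1 * Rabs x)))
      by (rewrite <- exp_plus; f_equal; field).
    replace (4 * exp 2 * (exp (Rabs x / 2) * exp (- (1 * Rabs x)))) with
      ((4 * exp (Rabs x / 2)) * (exp 2 * exp (- (1 * Rabs x)))) by ring.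
    apply Rmult_le_compat; trivial; [apply Rabs_pos|left; apply exp_pos|].
    rewrite Rabs_right by nra. lra.
Qed.

Lemma GI_jet : exists K, 0 <= K /\ forall t, Rabs t <= / 4 ->
  Rabs (GI (1 + t) - (1 + gamma1 * t + gamma2 * t ^ 2)) <= K * Rabs t ^ 3.
Proof.
  destruct dominated_gamma1 as [M1 D1]. destruct dominated_gamma2 as [M2 D2].
  destruct (dominated_gamma 1 Rlt_0_1) as [M0 D0].
  (* The 64 = 4^3 comes from |x|^3/6 <= 64 exp(|x|/4), and [exp 2] from the bound on the weight. For
     |t| <= 1/4 the two factors exp(|x|/4) use up half of the decay exp(-|x|), which leaves the rate
     1/2; [II_bound] adds PI. *)
  exists (64 * exp 2 * (1 + 2 / (1 / 2) ^ 2) * PI).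
  split.
  { pose proof (exp_pos 2). pose proof PI_RGT_0. replace (2 / (1 / 2) ^ 2) with 8 by field.
    assert (0 <= exp 2 * PI) by nra. nra. }
  intros t Ht.
  destruct (dominated_gamma (1 + t)) as [M3 D3].
  { apply Rabs_le_between in Ht. lra. }
  set (P := fun x => exp (1 * x - exp x) + (t * (x * exp (1 * x - exp x)) + t ^ 2 * (x ^ 2 / 2 * exp (1 * x - exp x)))).
  assert (DP : exists N, dominated P N).
  { eexists. exact (dominated_plus _ _ _ _ D0 (dominated_plus _ _ _ _ (dominated_scal _ _ t D1) (dominated_scal _ _ (t ^ 2) D2))). }
  destruct DP as [N DP].
  assert (EP : II P = 1 + gamma1 * t + gamma2 * t ^ 2).
  { unfold P. rewrite (II_plus _ _ _ _ D0 (dominated_plus _ _ _ _ (dominated_scal _ _ t D1) (dominated_scal _ _ (t ^ 2) D2))).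
    rewrite (II_plus _ _ _ _ (dominated_scal _ _ t D1) (dominated_scal _ _ (t ^ 2) D2)).
    rewrite (II_scal _ _ _ D1), (II_scal _ _ _ D2). fold gamma1. fold gamma2. fold (GI 1). rewrite GI_1. ring. }
  rewrite <- EP. unfold GI. rewrite <- (II_minus _ _ _ _ D3 DP).
  assert (DD : dominated (fun x => exp ((1 + t) * x - exp x) - P x)
    (64 * exp 2 * Rabs t ^ 3 * (1 + 2 / (1 / 2) ^ 2))).
  { apply exp_decay_dominated; [lra| |].
    - unfold P. cont_auto.
    - intros x.
      replace (exp ((1 + t) * x - exp x) - P x) with
        ((exp (t * x) - (1 + t * x + (t * x) ^ 2 / 2)) * exp (1 * x - exp x)).
      2: { unfold P. replace ((1 + t) * x - exp x) with (t * x + (1 * x - exp x)) by ring.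
           rewrite exp_plus. field. }
      rewrite Rabs_mult, (Rabs_right (exp _)) by (left; apply exp_pos).
      pose proof (exp_remainder_3 (t * x)) as R3. rewrite Rabs_mult in R3.
      pose proof (Rabs_pos x) as X0. pose proof (Rabs_pos t) as T0.
      pose proof (exp_sum_term (Rabs x / 4) 3 ltac:(lra)) as H3.
      replace (INR (fact 3)) with 6 in H3 by (simpl; lra).
      replace ((Rabs x / 4) ^ 3) with (Rabs x ^ 3 / 64) in H3 by field.
      assert (H4 : exp (Rabs t * Rabs x) <= exp (Rabs x / 4)) by (apply exp_incr; nra).
      assert (T3 : 0 <= Rabs t ^ 3) by (apply pow_le; trivial).
      assert (X3 : 0 <= Rabs x ^ 3) by (apply pow_le; trivial).
      assert (H5 : (Rabs t * Rabs x) ^ 3 / 6 * exp (Rabs t * Rabs x) <=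
         64 * Rabs t ^ 3 * (exp (Rabs x / 4) * exp (Rabs x / 4))).
      { rewrite Rpow_mult_distr.
        replace (Rabs t ^ 3 * Rabs x ^ 3 / 6 * exp (Rabs t * Rabs x)) with
          (Rabs t ^ 3 * (Rabs x ^ 3 / 6 * exp (Rabs t * Rabs x))) by field.
        replace (64 * Rabs t ^ 3 * (exp (Rabs x / 4) * exp (Rabs x / 4))) with
          (Rabs t ^ 3 * (64 * exp (Rabs x / 4) * exp (Rabs x / 4))) by ring.
        apply Rmult_le_compat_l; trivial.
        apply Rmult_le_compat; trivial; [lra|left; apply exp_pos|lra]. }
      rewrite <- exp_plus in H5. replace (Rabs x / 4 + Rabs x / 4) with (Rabs x / 2) in H5 by field.
      replace (exp (- (1 / 2 * Rabs x))) with (exp (Rabs x / 2) * exp (- (1 * Rabs x)))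
        by (rewrite <- exp_plus; f_equal; field).
      replace (64 * exp 2 * Rabs t ^ 3 * (exp (Rabs x / 2) * exp (- (1 * Rabs x)))) with
       ((64 * Rabs t ^ 3 * exp (Rabs x / 2)) * (exp 2 * exp (- (1 * Rabs x)))) by ring.
      apply Rmult_le_compat; [apply Rabs_pos|left; apply exp_pos| |apply gamma_weight_bound_1].
      eapply Rle_trans; [apply R3|apply H5]. }
  eapply Rle_trans; [apply (II_bound _ _ DD)|]. right. ring.
Qed.

Lemma GI_derive_1 : is_derive (fun t => GI (1 + t)) 0 gamma1.
Proof.
  destruct GI_jet as [K [HK HJ]].
  apply is_derive_of_linear_bound. intros eps He.
  set (B := Rabs gamma2 + K + 1).
  assert (HB : 0 < B) by (unfold B; pose proof (Rabs_pos gamma2); lra).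
  exists (Rmin (/ 4) (eps / B)).
  split; [apply Rmin_pos; [lra|apply Rdiv_lt_0_compat; trivial]|]. intros h Hh.
  assert (H1 : Rabs h <= / 4) by (left; eapply Rlt_le_trans; [apply Hh|apply Rmin_l]).
  assert (H2 : Rabs h * B <= eps).
  { replace eps with (eps / B * B) by (field; lra). apply Rmult_le_compat_r; [lra|].
    left; eapply Rlt_le_trans; [apply Hh|apply Rmin_r]. }
  rewrite Rplus_0_l, Rplus_0_r, GI_1. specialize (HJ h H1).
  replace (GI (1 + h) - 1 - gamma1 * h) with
    ((GI (1 + h) - (1 + gamma1 * h + gamma2 * h ^ 2)) + gamma2 * h ^ 2) by ring.
  eapply Rle_trans; [apply Rabs_triang|]. rewrite Rabs_mult, <- RPow_abs.
  pose proof (Rabs_pos h) as P. pose proof (Rabs_pos gamma2) as P2.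
  assert (K * Rabs h ^ 3 <= K * Rabs h ^ 2).
  { apply Rmult_le_compat_l; trivial. simpl. assert (Rabs h * (Rabs h * 1) >= 0) by nra. nra. }
  assert (K * Rabs h ^ 2 + Rabs gamma2 * Rabs h ^ 2 <= B * Rabs h * Rabs h).
  { unfold B. simpl. nra. }
  nra.
Qed.

(** Logarithm of the rising factorial x(x+1)...(x+n-1). *)
Fixpoint lnsum (x : R) (n : nat) : R :=
  match n with O => 0 | S k => lnsum x k + ln (INR k + x) end.

Lemma GI_ln x n : 0 < x -> ln (GI (INR n + x)) = lnsum x n + ln (GI x).
Proof.
  intros Hx. induction n as [|n IH].
  - simpl. rewrite !Rplus_0_l. trivial.
  - pose proof (pos_INR n). rewrite S_INR. replace (INR n + 1 + x) with (INR n + x + 1) by ring.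
    rewrite GI_rec, ln_mult by (try apply GI_pos; lra). rewrite IH. simpl. ring.
Qed.

Lemma ln_GI_interpolation z t : 0 < z -> 0 <= t <= 1 -> ln (GI (z + t)) <= t * ln z + ln (GI z).
Proof.
  intros Hz Ht. rewrite <- (ln_exp (t * ln z)), <- ln_mult by (try apply GI_pos; try apply exp_pos; trivial).
  apply ln_le; [apply GI_pos; lra|]. apply GI_interpolation; trivial.
Qed.

(** It has n + 1 terms, in step with the indexing of [euler_gamma]. *)
Definition harmonic (n : nat) : R := sum_n (fun k => / INR (k + 1)) n.

Lemma lnsum_derive n : is_derive (fun t => lnsum (1 + t) (S n)) 0 (harmonic n).
Proof.
  induction n as [|n IH].
  - unfold harmonic. rewrite sum_O. simpl. auto_derive; [lra|]. simpl. field.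
  - unfold harmonic. rewrite sum_Sn.
    apply (is_derive_plus (V := R_NormedModule) (fun t => lnsum (1 + t) (S n)) (fun t => ln (INR (S n) + (1 + t)))).
    + exact IH.
    + rewrite plus_INR. pose proof (pos_INR (S n)). change (INR 1) with 1.
      generalize dependent (INR (S n)). intros m Hm.
      auto_derive; [lra|]. field. lra.
Qed.

Lemma derive_t_ln m : 0 < m -> is_derive (fun t => t * ln (m + t)) 0 (ln m).
Proof. intros Hm. auto_derive; [lra|]. rewrite Rplus_0_r. field. lra. Qed.

(** Log-convexity brackets ln Gamma(N + 1 + t), N = n + 1, between ln Gamma(N + 1) + t ln(N + t) and
    ln Gamma(N + 1) + t ln(N + 1). After unwinding the recurrence the three functions agree at t =
    0, so their slopes there are ordered. *)
Lemma gamma1_bounds n :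
  ln (INR n + 1) - harmonic n <= gamma1 <= ln (INR n + 2) - harmonic n.
Proof.
  pose proof (pos_INR n) as Hn. pose proof (lnsum_derive n) as HL.
  pose proof GI_derive_1 as HG.
  assert (L0 : ln (GI (INR (S n) + 1)) = lnsum 1 (S n)).
  { rewrite GI_ln by lra. rewrite GI_1, ln_1. ring. }
  assert (HlnG : is_derive (fun t => ln (GI (1 + t))) 0 gamma1).
  { replace gamma1 with (gamma1 * / GI (1 + 0)) by (rewrite Rplus_0_r, GI_1; field).
    apply (is_derive_comp ln (fun t => GI (1 + t)) 0).
    - apply is_derive_Reals, derivable_pt_lim_ln. apply GI_pos; lra.
    - exact HG. }
  split.
  - apply (derive_le_of_right (fun t => t * ln (INR (S n) + t) - lnsum (1 + t) (S n) + lnsum 1 (S n)) (fun t => ln (GI (1 + t))) _ _ 1 Rlt_0_1); trivial.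
    + replace (ln (INR n + 1) - harmonic n) with (ln (INR n + 1) - harmonic n + 0) by ring.
      apply (is_derive_plus (V := R_NormedModule) (fun t => t * ln (INR (S n) + t) - lnsum (1 + t) (S n)) (fun _ => lnsum 1 (S n))); [|apply (is_derive_const (V := R_NormedModule))].
      apply (is_derive_minus (V := R_NormedModule) (fun t => t * ln (INR (S n) + t)) (fun t => lnsum (1 + t) (S n))); trivial.
      rewrite S_INR. apply derive_t_ln; lra.
    + rewrite !Rplus_0_r, GI_1, ln_1. ring.
    + intros t Ht.
      pose proof (ln_GI_interpolation (INR (S n) + t) (1 - t) ltac:(rewrite S_INR; lra) ltac:(lra)) as H.
      replace (INR (S n) + t + (1 - t)) with (INR (S n) + 1) in H by ring.
      rewrite L0 in H.
      assert (E : ln (GI (INR (S n) + 1 + t)) = ln (INR (S n) + t) + ln (GI (INR (S n) + t))).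
      { replace (INR (S n) + 1 + t) with (INR (S n) + t + 1) by ring.
        assert (0 < INR (S n) + t) by (rewrite S_INR; lra).
        rewrite GI_rec, ln_mult; trivial. apply GI_pos; trivial. }
      replace (INR (S n) + 1 + t) with (INR (S n) + (1 + t)) in E by ring.
      rewrite GI_ln in E by lra. lra.
  - apply (derive_le_of_right (fun t => ln (GI (1 + t))) (fun t => t * ln (INR n + 2) - lnsum (1 + t) (S n) + lnsum 1 (S n)) _ _ 1 Rlt_0_1); trivial.
    + replace (ln (INR n + 2) - harmonic n) with (ln (INR n + 2) - harmonic n + 0) by ring.
      apply (is_derive_plus (V := R_NormedModule) (fun t => t * ln (INR n + 2) - lnsum (1 + t) (S n)) (fun _ => lnsum 1 (S n))); [|apply (is_derive_const (V := R_NormedModule))].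
      apply (is_derive_minus (V := R_NormedModule) (fun t => t * ln (INR n + 2)) (fun t => lnsum (1 + t) (S n))); trivial.
      auto_derive; trivial. ring.
    + rewrite !Rplus_0_r, GI_1, ln_1. ring.
    + intros t Ht.
      pose proof (ln_GI_interpolation (INR (S n) + 1) t ltac:(rewrite S_INR; lra) ltac:(lra)) as H.
      rewrite L0 in H. replace (INR (S n) + 1 + t) with (INR (S n) + (1 + t)) in H by ring.
      rewrite GI_ln in H by lra. rewrite S_INR in H.
      replace (INR n + 1 + 1) with (INR n + 2) in H by ring. lra.
Qed.

Lemma ln_ratio_lim a b : 0 < a -> 0 < b -> is_lim_seq (fun n => ln (INR n + a) - ln (INR n + b)) 0.
Proof.
  intros Ha Hb.
  apply (is_lim_seq_ext (fun n => ln (1 + (a - b) * / (INR n + b)))).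
  { intros n. pose proof (pos_INR n). rewrite <- Rcomplements.ln_div by lra. f_equal. field. lra. }
  replace (Finite 0) with (Finite (ln (1 + (a - b) * 0))) by (f_equal; rewrite Rmult_0_r, Rplus_0_r; apply ln_1).
  apply (is_lim_seq_continuous ln).
  - apply continuity_pt_filterlim, continuous_ln. rewrite Rmult_0_r. lra.
  - apply is_lim_seq_plus'; [apply is_lim_seq_const|]. apply is_lim_seq_mult'; [apply is_lim_seq_const|].
    apply (is_lim_seq_inv _ p_infty); [|discriminate].
    apply (is_lim_seq_plus _ _ p_infty b); [apply is_lim_seq_INR|apply is_lim_seq_const|reflexivity].
Qed.

Lemma gamma1_euler : gamma1 = - euler_gamma.
Proof.
  assert (L : is_lim_seq (fun n => sum_n (fun k => / INR (k + 1)) n - ln (INR (n + 1))) (- gamma1)).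
  { apply (is_lim_seq_le_le (fun _ => - gamma1) _ (fun n => - gamma1 + (ln (INR n + 2) - ln (INR n + 1)))).
    - intros n. pose proof (gamma1_bounds n) as H. unfold harmonic in H. rewrite plus_INR. simpl (INR 1). lra.
    - apply is_lim_seq_const.
    - replace (Finite (- gamma1)) with (Finite (- gamma1 + 0)) by (f_equal; ring).
      apply is_lim_seq_plus'; [apply is_lim_seq_const|]. apply ln_ratio_lim; lra. }
  unfold euler_gamma. rewrite (is_lim_seq_unique _ _ L). simpl. ring.
Qed.

(** * The functional equation *)

Definition pw (x t : R) : R := exp (- (t * ln x)).

Fixpoint Rsum (f : nat -> R) (n : nat) : R :=
  match n with O => 0 | S k => Rsum f k + f k end.

Lemma Rsum_scal c f n : Rsum (fun k => c * f k) n = c * Rsum f n.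
Proof. induction n; simpl; [ring|]. rewrite IHn. ring. Qed.

(* Partial sums of [zeta(t,1/4) - zeta(t,3/4)], where [pw x t] is [x^-t]. *)
Definition Dpart (t : R) (n : nat) : R :=
  Rsum (fun k => pw (INR k + / 4) t - pw (INR k + 3 / 4) t) n.

Lemma pw_mult x y t : 0 < x -> 0 < y -> pw (x * y) t = pw x t * pw y t.
Proof. intros Hx Hy. unfold pw. rewrite ln_mult, <- exp_plus by trivial. f_equal. ring. Qed.

Lemma pw_pos x t : 0 < pw x t.
Proof. apply exp_pos. Qed.

Lemma pw_lim t c : 0 < t -> is_lim_seq (fun n => pw (INR n + c) t) 0.
Proof.
  intros Ht. apply (is_lim_seq_ext (fun n => exp (- t * ln (INR n + c)))).
  { intros n. unfold pw. f_equal. ring. }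
  apply exp_neg_ln_lim. lra.
Qed.

Lemma cpower_real x t : 0 < x -> cpower (RtoC x) (- RtoC t) = RtoC (pw x t).
Proof.
  intros Hx. unfold cpower. rewrite Clog_RtoC by trivial.
  replace (- RtoC t * RtoC (ln x))%C with (RtoC (- (t * ln x))) by (rewrite RtoC_opp, RtoC_mult; ring).
  apply Cexp_RtoC.
Qed.

(** The recurrence at b + 2n minus the one at b + 2n + 1 cancels the middle integral, so steps of 2
    produce the alternating series in pairs. *)
Lemma A_int_two_steps b t n : 0 < b ->
  (A_int b (- RtoC t) - A_int (b + 2 * INR n) (- RtoC t))%C =
  RtoC (2 * Rsum (fun k => pw (b + 2 * INR k + / 2) t - pw (b + 2 * INR k + 3 / 2) t) n).
Proof.
  intros Hb. induction n as [|n IH].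
  - cbn [INR Rsum]. rewrite !Rmult_0_r, Rplus_0_r. ring.
  - pose proof (pos_INR n).
    replace (b + 2 * INR (S n)) with (b + 2 * INR n + 1 + 1) by (rewrite S_INR; ring).
    pose proof (A_int_rec (b + 2 * INR n) (- RtoC t) ltac:(lra)) as H1.
    pose proof (A_int_rec (b + 2 * INR n + 1) (- RtoC t) ltac:(lra)) as H2.
    rewrite cpower_real in H1, H2 by lra.
    simpl Rsum. rewrite Rmult_plus_distr_l, RtoC_plus, <- IH.
    replace (b + 2 * INR n + 1 + / 2) with (b + 2 * INR n + 3 / 2) in H2 by field.
    rewrite RtoC_mult, RtoC_minus.
    replace (2 * (pw (b + 2 * INR n + / 2) t - pw (b + 2 * INR n + 3 / 2) t))%C
      with (2 * pw (b + 2 * INR n + / 2) t - 2 * pw (b + 2 * INR n + 3 / 2) t)%C by ring.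
    rewrite <- H1, <- H2. ring.
Qed.

Lemma A_int_bound b t M : 0 < b -> 0 <= t -> dominated sech M ->
  Cmod (A_int b (- RtoC t)) <= 2 * PI * (pw b t * M).
Proof.
  intros Hb Ht HM.
  destruct (tame_sech _ b Hb (tame_cpower (- RtoC t)%C)) as [N D].
  apply (CII_weight_bound _ _ _ _ N HM D). intros y.
  eapply Rle_trans; [apply (Cmod_cpower_bound _ _ b)|].
  - simpl; lra.
  - rewrite re_opp, re_RtoC. lra.
  - rewrite re_opp, im_opp, re_RtoC, im_RtoC, Ropp_0, Rabs_R0, Rmult_0_r, exp_0.
    right. unfold pw. rewrite Rmult_1_r. f_equal. ring.
Qed.

(* [e^x Re ((b + i e^x)^-t) sech (e^x)], written so that it stays continuous across [b = 0]. *)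
Definition boundary_fun (t b x : R) : R :=
  exp x * (exp (- (t * (/ 2 * ln (b * b + exp (2 * x))))) *
    cos (t * (PI / 2 - atan (b * exp (- x))))) * sech (exp x).

Lemma boundary_fun_eq t b x : 0 < b ->
  boundary_fun t b x = exp x * (Re (cpower (b, exp x) (- RtoC t)) * sech (exp x)).
Proof.
  intros Hb. unfold boundary_fun, cpower, Cexp. simpl fst.
  rewrite re_mult, im_mult, re_opp, im_opp, re_RtoC, im_RtoC. unfold Clog. simpl Re. simpl Im.
  rewrite Rmult_assoc. do 3 f_equal.
  - f_equal. rewrite Ropp_0, Rmult_0_l, Rminus_0_r. unfold Cmod. simpl fst. simpl snd.
    assert (E : b ^ 2 + exp x ^ 2 = b * b + exp (2 * x)).
    { replace (2 * x) with (x + x) by ring. rewrite exp_plus. ring. }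
    rewrite E. assert (P : 0 < b * b + exp (2 * x)) by (pose proof (exp_pos (2 * x)); nra).
    replace (ln (b * b + exp (2 * x))) with (2 * ln (sqrt (b * b + exp (2 * x)))); [field|].
    rewrite <- (sqrt_sqrt (b * b + exp (2 * x))) at 2 by lra.
    rewrite ln_mult by (apply sqrt_lt_R0; trivial). ring.
  - rewrite Ropp_0, Rmult_0_l, Rplus_0_r.
    rewrite <- (cos_neg (- t * _)). f_equal.
    (* The argument of b + i e^x is rewritten as pi/2 - arctan(b e^-x), which has a meaning at b =
       0. *)
    replace (exp x / b) with (/ (b * exp (- x))).
    2: { rewrite exp_Ropp. field. split; [lra|]. pose proof (exp_pos x); lra. }
    rewrite atan_inv by (pose proof (exp_pos (- x)); nra). ring.
Qed.

Lemma boundary_fun_0 t x : boundary_fun t 0 x = cos (PI * t / 2) * (exp ((1 - t) * x) * sech (exp x)).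
Proof.
  unfold boundary_fun. rewrite !Rmult_0_l, Rplus_0_l, ln_exp, atan_0, Rminus_0_r.
  replace (t * (PI / 2)) with (PI * t / 2) by field.
  replace ((1 - t) * x) with (x + - (t * (/ 2 * (2 * x)))) by field.
  rewrite exp_plus. ring.
Qed.

Lemma exp_sech_bound s x : 0 < s ->
  exp (s * x) * sech (exp x) <= 4 * exp ((s + s) ^ 2 / 2) * exp (- (s * Rabs x)).
Proof.
  intros Hs. pose proof (sech_decay (exp x)) as H. pose proof (exp_pos x) as P.
  rewrite (Rabs_right (exp x)) in H by lra.
  pose proof (gamma_weight_bound s s x ltac:(lra)) as W.
  apply Rle_trans with (exp (s * x) * (4 * exp (- exp x))).
  - apply Rmult_le_compat_l; [left; apply exp_pos|]. eapply Rle_trans; [apply H|].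
    apply Rmult_le_compat_l; [lra|]. apply exp_incr. pose proof PI2_1. nra.
  - replace (exp (s * x) * (4 * exp (- exp x))) with (4 * exp (s * x - exp x)).
    + lra.
    + unfold Rminus. rewrite exp_plus. ring.
Qed.

Lemma boundary_fun_2d t b x : continuity_2d_pt (boundary_fun t) b x.
Proof.
  assert (CP : forall f u, ex_derive f u -> continuity_pt f u).
  { intros f u H. apply continuity_pt_filterlim. apply (real_derive_continuous f), H. }
  assert (CE : continuity_2d_pt (fun _ x => exp x) b x).
  { apply (continuity_1d_2d_pt_comp exp (fun _ x => x)); [apply CP; auto_derive; trivial|apply continuity_2d_pt_id2]. }
  unfold boundary_fun. apply continuity_2d_pt_mult; [apply continuity_2d_pt_mult; [exact CE|apply continuity_2d_pt_mult]|].
  - apply (continuity_1d_2d_pt_comp (fun u => exp (- (t * (/ 2 * ln u)))) (fun b x => b * b + exp (2 * x))).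
    + apply CP. auto_derive. pose proof (exp_pos (2 * x)). nra.
    + apply continuity_2d_pt_plus.
      * apply continuity_2d_pt_mult; apply continuity_2d_pt_id1.
      * apply (continuity_1d_2d_pt_comp (fun x => exp (2 * x)) (fun _ x => x)); [apply CP; auto_derive; trivial|apply continuity_2d_pt_id2].
  - apply (continuity_1d_2d_pt_comp (fun u => cos (t * (PI / 2 - atan u))) (fun b x => b * exp (- x))).
    + apply CP. auto_derive; trivial.
    + apply continuity_2d_pt_mult; [apply continuity_2d_pt_id1|].
      apply (continuity_1d_2d_pt_comp (fun x => exp (- x)) (fun _ x => x)); [apply CP; auto_derive; trivial|apply continuity_2d_pt_id2].
  - apply (continuity_1d_2d_pt_comp sech (fun _ x => exp x)); [|exact CE].
    destruct dominated_real_sech as [M [HM _]]. apply continuity_pt_filterlim, HM.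
Qed.

Definition boundary_const (t : R) : R :=
  4 * exp (((1 - t) + (1 - t)) ^ 2 / 2) * (1 + 2 / (1 - t) ^ 2).

(** Since |b + i e^x| >= e^x, dropping b from the modulus gives a majorant independent of b, as the
    passage to b = 0 requires. *)
Lemma boundary_fun_dominated t b : 0 < t < 1 -> dominated (boundary_fun t b) (boundary_const t).
Proof.
  intros Ht. apply exp_decay_dominated; [lra| |].
  - intros x. apply continuity_2d_pt_snd, boundary_fun_2d.
  - intros x. eapply Rle_trans; [|apply exp_sech_bound; lra].
    unfold boundary_fun. rewrite !Rabs_mult, !(Rabs_right (exp _)) by (left; apply exp_pos).
    rewrite (Rabs_right (sech _)) by (left; apply sech_pos).
    apply Rmult_le_compat_r; [left; apply sech_pos|].
    replace ((1 - t) * x) with (x + - (t * x)) by ring. rewrite exp_plus.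
    apply Rmult_le_compat_l; [left; apply exp_pos|].
    replace (exp (- (t * x))) with (exp (- (t * x)) * 1) by ring.
    apply Rmult_le_compat; [left; apply exp_pos|apply Rabs_pos| |apply Rabs_le_between, COS_bound].
    apply exp_incr. apply Ropp_le_contravar. apply Rmult_le_compat_l; [lra|].
    pose proof (exp_pos (2 * x)).
    assert (2 * x <= ln (b * b + exp (2 * x))); [|lra].
    rewrite <- (ln_exp (2 * x)) at 1. apply ln_le; [trivial|nra].
Qed.

Lemma RInt_even (f : R -> R) n : (forall x, continuous f x) -> (forall x, f (- x) = f x) ->
  RInt f (- n) n = 2 * RInt f 0 n.
Proof.
  intros Hc He. rewrite (RInt_split f (- n) 0 n Hc).
  assert (E : RInt f (- n) 0 = RInt f 0 n).
  { pose proof (RInt_comp (V := R_CompleteNormedModule) f (fun x => - x) (fun _ => -1) n 0) as H.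
    cbv beta in H. rewrite Ropp_0 in H. rewrite <- H.
    - rewrite <- (opp_RInt_swap (V := R_CompleteNormedModule)).
      + unfold opp; simpl.
        rewrite (RInt_ext (V := R_CompleteNormedModule) _ (fun x => -1 * f x)).
        * rewrite (RInt_scal (V := R_CompleteNormedModule) f) by (apply continuous_ex_RInt, Hc).
          unfold scal; simpl; unfold mult; simpl. ring.
        * intros x _. rewrite He. reflexivity.
      + apply continuous_ex_RInt. intros x.
        apply (continuous_ext (fun x => -1 * f x)); [intros y; rewrite He; reflexivity|].
        apply (continuous_scal_r (V := R_NormedModule) (-1) f), Hc.
    - intros; apply Hc.
    - intros x _; split; [auto_derive; trivial; ring|apply continuous_const]. }
  rewrite E. lra.
Qed.

(** The variable x = ln y moves y = 0, where the limiting integrand y^-t is singular, to -oo, where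
    it decays. The piece over (0, e^-n) is at most M e^-n. *)
Lemma half_line_exp (f : R -> R) M N : dominated f M -> (forall x, f (- x) = f x) ->
  dominated (fun x => exp x * f (exp x)) N -> II f = 2 * II (fun x => exp x * f (exp x)).
Proof.
  intros Hf He Hg.
  assert (L1 : is_lim_seq (fun n => RInt f (- exp (1 * INR n)) (exp (1 * INR n))) (II f)).
  { assert (La : is_lim_seq (fun n => atan (exp (1 * INR n))) (PI / 2)).
    { apply (is_lim_seq_le_le (fun n => atan (INR n)) _ (fun _ => PI / 2)).
      - intros n. split; [|left; apply atan_bound]. rewrite Rmult_1_l.
        pose proof (exp_ineq1_le (INR n)). left; apply atan_increasing. lra.
      - apply atan_lim.
      - apply is_lim_seq_const. }
    apply (II_lim_gen f M); trivial.
    apply (is_lim_seq_ext (fun n => - atan (exp (1 * INR n)))); [intros; rewrite atan_opp; trivial|].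
    apply (is_lim_seq_opp _ (Finite (PI / 2))). exact La. }
  assert (L2 : is_lim_seq (fun n => 2 * (RInt f 0 (exp (1 * - INR n)) +
     RInt (fun x => exp x * f (exp x)) (- INR n) (INR n))) (2 * (0 + II (fun x => exp x * f (exp x))))).
  { apply is_lim_seq_mult'; [apply is_lim_seq_const|]. apply is_lim_seq_plus'.
    - apply is_lim_seq_abs_0.
      apply (is_lim_seq_le_le (fun _ => 0) _ (fun n => M * exp (1 * - INR n))).
      + intros n. split; [apply Rabs_pos|].
        pose proof (exp_pos (1 * - INR n)) as P.
        eapply Rle_trans; [apply (abs_RInt_le_const f 0 _ M); [lra|apply (dominated_ex_RInt _ _ _ _ Hf)|]|right; ring].
        intros x _. eapply Rle_trans; [apply Hf|].
        pose proof (dominated_nonneg _ _ Hf). apply Rmult_le_reg_r with (1 + x ^ 2); [nra|].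
        unfold Rdiv. rewrite Rmult_assoc, Rinv_l by nra. nra.
      + apply is_lim_seq_const.
      + apply is_lim_seq_scal_0. apply exp_lin_lim_0. lra.
    - apply (II_lim _ _ Hg). }
  assert (E : II f = 2 * (0 + II (fun x => exp x * f (exp x)))); [|lra].
  assert (E' : Finite (II f) = Finite (2 * (0 + II (fun x => exp x * f (exp x))))); [|injection E'; trivial].
  rewrite <- (is_lim_seq_unique _ _ L1). rewrite <- (is_lim_seq_unique _ _ L2).
  apply Lim_seq_ext. intros n. rewrite RInt_even by (trivial; apply Hf). f_equal.
  rewrite (RInt_split f 0 (exp (1 * - INR n)) (exp (1 * INR n))) by apply Hf. f_equal.
  rewrite !Rmult_1_l.
  rewrite <- (RInt_comp (V := R_CompleteNormedModule) f exp exp).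
  - apply RInt_ext. intros; reflexivity.
  - intros; apply Hf.
  - intros; split; [apply is_derive_exp|]. cont_auto.
Qed.

Lemma Re_A_int t b : 0 < t < 1 -> 0 < b ->
  Re (A_int b (- RtoC t)) = 2 * II (boundary_fun t b).
Proof.
  intros Ht Hb. set (f := fun y => Re (cpower (b, y) (- RtoC t)) * sech y).
  destruct (tame_sech _ b Hb (tame_cpower (- RtoC t)%C)) as [N [D _]].
  assert (Df : dominated f N).
  { eapply dominated_ext; [|exact D]. intros y. apply re_scal_r. }
  transitivity (II f).
  { exact (II_ext _ _ (fun y => re_scal_r (cpower (b, y) (- RtoC t)) (sech y))). }
  rewrite (half_line_exp f N (boundary_const t) Df).
  - f_equal. apply II_ext. intros x. symmetry. apply boundary_fun_eq, Hb.
  - intros y. unfold f. rewrite sech_even. f_equal.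
    unfold cpower, Cexp. cbn [Re fst]. rewrite !re_mult, !im_mult, !re_opp, !im_opp, !re_RtoC, !im_RtoC.
    unfold Clog. simpl Re. simpl Im.
    assert (E : Cmod (b, - y) = Cmod (b, y)) by (unfold Cmod; simpl; f_equal; ring).
    rewrite E. replace (- y / b) with (- (y / b)) by (field; lra). rewrite atan_opp.
    rewrite <- (cos_neg (- t * - atan (y / b) + - 0 * ln (Cmod (b, y)))). f_equal; f_equal; ring.
  - apply (dominated_ext (boundary_fun t b)); [|apply boundary_fun_dominated, Ht].
    intros x. apply boundary_fun_eq, Hb.
Qed.

Lemma pw_decr x y t : 0 < x <= y -> 0 <= t -> pw y t <= pw x t.
Proof.
  intros Hx Ht. apply exp_incr. apply Ropp_le_contravar. apply Rmult_le_compat_l; trivial.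
  apply ln_le; lra.
Qed.

Lemma pw_continuous t c (u : nat -> R) : 0 < c -> is_lim_seq u 0 ->
  is_lim_seq (fun k => pw (u k + c) t) (pw c t).
Proof.
  intros Hc Hu. replace (pw c t) with (pw (0 + c) t) by (f_equal; ring).
  apply (is_lim_seq_continuous (fun x => pw (x + c) t)); trivial.
  apply continuity_pt_filterlim.
  apply (real_derive_continuous (fun x => pw (x + c) t)).
  unfold pw. auto_derive. lra.
Qed.

Lemma inv_S_lim : is_lim_seq (fun k => / (INR k + 1)) 0.
Proof.
  apply (is_lim_seq_inv _ p_infty); [|discriminate].
  apply (is_lim_seq_plus _ _ p_infty 1); [apply is_lim_seq_INR|apply is_lim_seq_const|reflexivity].
Qed.

(** For fixed n, b tends to 0 along 1/(k+1). The pairs become those of [Dpart] after extracting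
    2^-t, and the leftover integral on the line b + 2n is bounded by a multiple of n^-t uniformly in
    b. *)
Lemma boundary_partial t n M : 0 < t < 1 -> (1 <= n)%nat -> dominated sech M ->
  Rabs (2 * II (boundary_fun t 0) - 2 * (pw 2 t * Dpart t n)) <= 2 * PI * (pw (INR n) t * M).
Proof.
  intros Ht Hn HM. apply le_INR in Hn. simpl in Hn.
  set (u := fun k : nat => / (INR k + 1)).
  assert (Hu : forall k, 0 < u k).
  { intros k. apply Rinv_0_lt_compat. pose proof (pos_INR k); lra. }
  set (S := fun b => Rsum (fun k => pw (b + 2 * INR k + / 2) t - pw (b + 2 * INR k + 3 / 2) t) n).
  assert (L1 : is_lim_seq (fun k => II (boundary_fun t (u k))) (II (boundary_fun t 0))).
  { apply (is_lim_seq_continuous (fun b => II (boundary_fun t b))); [|apply inv_S_lim].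
    apply continuity_pt_filterlim. apply (II_param_continuous (boundary_fun t) 0 (boundary_const t) 1 Rlt_0_1).
    - intros; apply boundary_fun_dominated, Ht.
    - intros; apply boundary_fun_2d. }
  assert (L2 : is_lim_seq (fun k => S (u k)) (pw 2 t * Dpart t n)).
  { unfold S, Dpart. rewrite <- Rsum_scal. clear - Hu.
    induction n as [|n IH]; [apply is_lim_seq_const|].
    simpl Rsum. apply is_lim_seq_plus'; [exact IH|]. pose proof (pos_INR n).
    replace (pw 2 t * (pw (INR n + / 4) t - pw (INR n + 3 / 4) t))
      with (pw (2 * INR n + / 2) t - pw (2 * INR n + 3 / 2) t).
    2: { replace (2 * INR n + / 2) with (2 * (INR n + / 4)) by field.
         replace (2 * INR n + 3 / 2) with (2 * (INR n + 3 / 4)) by field.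
         rewrite !pw_mult by lra. ring. }
    apply is_lim_seq_minus'.
    - apply (is_lim_seq_ext (fun k => pw (u k + (2 * INR n + / 2)) t)); [intros; f_equal; ring|].
      apply pw_continuous; [lra|apply inv_S_lim].
    - apply (is_lim_seq_ext (fun k => pw (u k + (2 * INR n + 3 / 2)) t)); [intros; f_equal; ring|].
      apply pw_continuous; [lra|apply inv_S_lim]. }
  apply (is_lim_seq_le (fun k => Rabs (2 * II (boundary_fun t (u k)) - 2 * S (u k))) (fun _ => 2 * PI * (pw (INR n) t * M))
    (Finite _) (Finite _)).
  - intros k. specialize (Hu k). rewrite <- Re_A_int by trivial.
    pose proof (A_int_two_steps (u k) t n Hu) as H. fold (S (u k)) in H.
    assert (HR : Re (A_int (u k) (- RtoC t)) - 2 * S (u k) = Re (A_int (u k + 2 * INR n) (- RtoC t))).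
    { apply (f_equal Re) in H. unfold Cminus in H. rewrite re_plus, re_opp, re_RtoC in H. lra. }
    rewrite HR. eapply Rle_trans; [apply re_le_Cmod|].
    eapply Rle_trans; [apply (A_int_bound _ _ M); trivial; lra|].
    apply Rmult_le_compat_l; [pose proof PI_RGT_0; lra|].
    apply Rmult_le_compat_r; [apply (dominated_nonneg _ _ HM)|]. apply pw_decr; lra.
  - apply (is_lim_seq_abs _ (Finite _)). apply is_lim_seq_minus'; apply is_lim_seq_mult'; trivial; apply is_lim_seq_const.
  - apply is_lim_seq_const.
Qed.

(** * The Mellin transform of the kernel and its series *)

Definition sech_mellin (s : R) : R := II (fun x => exp (s * x) * sech (exp x)).

Lemma sech_mellin_dominated s : 0 < s -> exists M, dominated (fun x => exp (s * x) * sech (exp x)) M.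
Proof.
  intros Hs. eexists. apply (exp_decay_dominated _ (4 * exp ((s + s) ^ 2 / 2)) s Hs).
  - intros x. destruct dominated_real_sech as [M [HM _]].
    apply (continuous_mult (K := R_AbsRing) (fun x => exp (s * x)) (fun x => sech (exp x))); [cont_auto|].
    apply (continuous_comp exp sech); [cont_auto|apply HM].
  - intros x. rewrite Rabs_right; [apply exp_sech_bound, Hs|].
    apply Rle_ge, Rmult_le_pos; left; [apply exp_pos|apply sech_pos].
Qed.

Lemma Dpart_lim_boundary t : 0 < t < 1 ->
  is_lim_seq (fun n => pw 2 t * Dpart t n) (cos (PI * t / 2) * sech_mellin (1 - t)).
Proof.
  intros Ht. destruct dominated_real_sech as [M HM].
  assert (E : II (boundary_fun t 0) = cos (PI * t / 2) * sech_mellin (1 - t)).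
  { destruct (sech_mellin_dominated (1 - t) ltac:(lra)) as [N HN].
    unfold sech_mellin. rewrite <- (II_scal _ _ _ HN). apply II_ext. intros; apply boundary_fun_0. }
  rewrite <- E.
  apply (is_lim_seq_ext (fun n => II (boundary_fun t 0) + - (II (boundary_fun t 0) - pw 2 t * Dpart t n))).
  { intros; ring. }
  replace (Finite (II (boundary_fun t 0))) with (Finite (II (boundary_fun t 0) + 0)) by (f_equal; ring).
  apply is_lim_seq_plus'; [apply is_lim_seq_const|]. apply is_lim_seq_abs_0.
  apply (is_lim_seq_le_le_loc (fun _ => 0) _ (fun n => PI * M * pw (INR n + 0) t)).
  - exists 1%nat. intros n Hn. split; [apply Rabs_pos|]. rewrite Rabs_Ropp, Rplus_0_r.
    pose proof (boundary_partial t n M Ht Hn HM) as H.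
    replace (2 * II (boundary_fun t 0) - 2 * (pw 2 t * Dpart t n)) with
      (2 * (II (boundary_fun t 0) - pw 2 t * Dpart t n)) in H by ring.
    rewrite Rabs_mult, (Rabs_right 2) in H by lra. lra.
  - apply is_lim_seq_const.
  - apply is_lim_seq_scal_0. apply pw_lim. lra.
Qed.

Lemma sech_q y : sech y = 2 * exp (- (PI * y)) / (1 + exp (- (PI * y)) ^ 2).
Proof. rewrite <- sech_even, sech_exp. replace (PI * - y) with (- (PI * y)) by ring. reflexivity. Qed.

Lemma exp_mult_nat (n : nat) x : exp (INR n * x) = exp x ^ n.
Proof.
  induction n as [|n IH]; [simpl; rewrite Rmult_0_l; apply exp_0|].
  rewrite S_INR. replace ((INR n + 1) * x) with (x + INR n * x) by ring. rewrite exp_plus, IH. reflexivity.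
Qed.

(** With q = exp(-pi e^x) the kernel is 2q/(1 + q^2), the sum of 2(q^(4k+1) - q^(4k+3)). Grouping in
    pairs makes every term positive and yields the offsets 1/4 and 3/4. *)
Definition sech_term (s : R) (k : nat) (x : R) : R :=
  2 * (exp (s * x - (4 * INR k + 1) * PI * exp x) - exp (s * x - (4 * INR k + 3) * PI * exp x)).

Lemma sech_term_sum s n x : 
  Rsum (fun k => sech_term s k x) n = exp (s * x) * sech (exp x) * (1 - exp (- (PI * exp x)) ^ (4 * n)).
Proof.
  set (q := exp (- (PI * exp x))). assert (Hq : 0 < q) by apply exp_pos.
  rewrite sech_q. fold q. induction n as [|n IH].
  - simpl. field. nra.
  - simpl Rsum. rewrite IH. unfold sech_term.
    replace (s * x - (4 * INR n + 1) * PI * exp x) with (s * x + INR (4 * n + 1) * - (PI * exp x)).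
    2: { rewrite plus_INR, mult_INR. simpl. ring. }
    replace (s * x - (4 * INR n + 3) * PI * exp x) with (s * x + INR (4 * n + 3) * - (PI * exp x)).
    2: { rewrite plus_INR, mult_INR. simpl. ring. }
    rewrite !exp_plus, !exp_mult_nat. fold q.
    replace (4 * S n)%nat with (4 * n + 4)%nat by lia. rewrite !pow_add.
    field. nra.
Qed.

Lemma sech_term_integral s k : 0 < s ->
  (exists M, dominated (sech_term s k) M) /\
  II (sech_term s k) = 2 * (pw (4 * PI) s * GI s) * (pw (INR k + / 4) s - pw (INR k + 3 / 4) s).
Proof.
  intros Hs. pose proof PI_RGT_0 as HP. pose proof (pos_INR k) as Hk.
  destruct (GI_scale s ((4 * INR k + 1) * PI) Hs ltac:(nra)) as [E1 [M1 D1]].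
  destruct (GI_scale s ((4 * INR k + 3) * PI) Hs ltac:(nra)) as [E2 [M2 D2]].
  fold (pw ((4 * INR k + 1) * PI) s) in E1. fold (pw ((4 * INR k + 3) * PI) s) in E2.
  assert (D : exists M, dominated (fun x => exp (s * x - (4 * INR k + 1) * PI * exp x) - exp (s * x - (4 * INR k + 3) * PI * exp x)) M).
  { eexists. apply (dominated_ext (fun x => exp (s * x - (4 * INR k + 1) * PI * exp x) + (-1) * exp (s * x - (4 * INR k + 3) * PI * exp x))).
    - intros; ring.
    - apply dominated_plus; [exact D1|apply dominated_scal, D2]. }
  destruct D as [M D]. split.
  - eexists. apply (dominated_scal _ _ 2 D).
  - unfold sech_term. rewrite (II_scal _ _ _ D), (II_minus _ _ _ _ D1 D2), E1, E2.
    replace ((4 * INR k + 1) * PI) with (4 * PI * (INR k + / 4)) by field.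
    replace ((4 * INR k + 3) * PI) with (4 * PI * (INR k + 3 / 4)) by field.
    rewrite !pw_mult by lra. ring.
Qed.

Lemma sech_sum_integral s n : 0 < s ->
  (exists M, dominated (fun x => Rsum (fun k => sech_term s k x) n) M) /\
  II (fun x => Rsum (fun k => sech_term s k x) n) = 2 * (pw (4 * PI) s * GI s) * Dpart s n.
Proof.
  intros Hs. induction n as [|n [[M D] E]].
  - destruct dominated_real_sech as [M HM].
    assert (E : forall x, 0 * sech x = 0) by (intros; ring).
    simpl. split.
    + eexists. eapply dominated_ext; [exact E|]. apply dominated_scal, HM.
    + rewrite <- (II_ext _ _ E), (II_scal _ _ _ HM). unfold Dpart; simpl. ring.
  - destruct (sech_term_integral s n Hs) as [[M' D'] E']. simpl Rsum. split.
    + eexists. apply dominated_plus; [exact D|exact D'].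
    + rewrite (II_plus _ _ _ _ D D'), E, E'. unfold Dpart; simpl Rsum. ring.
Qed.

(** The remainder of the paired geometric series is non-negative and at most twice the first omitted
    exponential, whose integral is a multiple of (n + 1/4)^-s. This reaches 0 < s < 1, where the
    unpaired series does not converge absolutely. *)
Lemma sech_mellin_lim s : 0 < s ->
  is_lim_seq (fun n => 2 * (pw (4 * PI) s * GI s) * Dpart s n) (sech_mellin s).
Proof.
  intros Hs. destruct (sech_mellin_dominated s Hs) as [M D]. pose proof PI_RGT_0 as HP.
  apply (is_lim_seq_ext (fun n => sech_mellin s + - (sech_mellin s - 2 * (pw (4 * PI) s * GI s) * Dpart s n))).
  { intros; ring. }
  replace (Finite (sech_mellin s)) with (Finite (sech_mellin s + 0)) by (f_equal; ring).
  apply is_lim_seq_plus'; [apply is_lim_seq_const|].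
  replace (Finite 0) with (Finite (-1 * 0)) by (f_equal; ring).
  apply (is_lim_seq_ext (fun n => -1 * (sech_mellin s - 2 * (pw (4 * PI) s * GI s) * Dpart s n))); [intros; ring|].
  apply is_lim_seq_mult'; [apply is_lim_seq_const|].
  apply (is_lim_seq_le_le (fun _ => 0) _ (fun n => 2 * (GI s * pw (4 * PI) s) * pw (INR n + / 4) s)).
  - intros n. pose proof (pos_INR n) as Hn.
    destruct (sech_sum_integral s n Hs) as [[M' D'] E'].
    rewrite <- E'. unfold sech_mellin. rewrite <- (II_minus _ _ _ _ D D').
    destruct (GI_scale s ((4 * INR n + 1) * PI) Hs ltac:(nra)) as [E1 [M1 D1]].
    assert (Q : forall x, 0 <= exp (s * x) * sech (exp x) - Rsum (fun k => sech_term s k x) n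
       <= 2 * exp (s * x - (4 * INR n + 1) * PI * exp x)).
    { intros x. rewrite sech_term_sum.
      replace (exp (s * x) * sech (exp x) - exp (s * x) * sech (exp x) * (1 - exp (- (PI * exp x)) ^ (4 * n)))
        with (exp (s * x) * (sech (exp x) * exp (- (PI * exp x)) ^ (4 * n))) by ring.
      pose proof (exp_pos (s * x)). pose proof (sech_pos (exp x)).
      assert (0 < exp (- (PI * exp x)) ^ (4 * n)) by (apply pow_lt, exp_pos).
      split; [apply Rmult_le_pos; [lra|apply Rmult_le_pos; lra]|].
      replace (s * x - (4 * INR n + 1) * PI * exp x) with (s * x + INR (4 * n + 1) * - (PI * exp x)).
      2: { rewrite plus_INR, mult_INR. simpl. ring. }
      rewrite exp_plus, exp_mult_nat, pow_add.
      assert (HS : sech (exp x) <= 2 * exp (- (PI * exp x))).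
      { rewrite sech_q. set (q := exp (- (PI * exp x))). assert (0 < q) by apply exp_pos.
        apply Rmult_le_reg_r with (1 + q ^ 2); [nra|].
        unfold Rdiv. rewrite Rmult_assoc, Rinv_l by nra. nra. }
      simpl (_ ^ 1). rewrite Rmult_1_r.
      set (p := exp (- (PI * exp x)) ^ (4 * n)) in *. set (q := exp (- (PI * exp x))) in *.
      assert (sech (exp x) * p <= 2 * q * p) by (apply Rmult_le_compat_r; lra).
      replace (2 * (exp (s * x) * (p * q))) with (exp (s * x) * (2 * q * p)) by ring.
      apply Rmult_le_compat_l; lra. }
    assert (DD : exists N, dominated (fun x => exp (s * x) * sech (exp x) - Rsum (fun k => sech_term s k x) n) N).
    { eexists. apply (dominated_ext (fun x => exp (s * x) * sech (exp x) + (-1) * Rsum (fun k => sech_term s k x) n)).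
      - intros; ring.
      - apply dominated_plus; [exact D|apply dominated_scal, D']. }
    destruct DD as [N DD]. split.
    + rewrite <- (Rmult_0_l (II sech)). destruct dominated_real_sech as [M2 HM2].
      rewrite <- (II_scal _ _ _ HM2). eapply II_le; [apply dominated_scal; exact HM2|exact DD|].
      intros x. rewrite Rmult_0_l. apply Q.
    + eapply Rle_trans; [eapply II_le; [exact DD|apply (dominated_scal _ _ 2 D1)|intros x; apply Q]|].
      rewrite (II_scal _ _ _ D1), E1. fold (pw ((4 * INR n + 1) * PI) s).
      replace ((4 * INR n + 1) * PI) with (4 * PI * (INR n + / 4)) by field.
      rewrite pw_mult by lra. right. ring.
  - apply is_lim_seq_const.
  - apply is_lim_seq_scal_0. apply pw_lim, Hs.
Qed.

Definition Dfun (t : R) : R := real (Lim_seq (Dpart t)).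

Lemma Dfun_lim t : 0 < t < 1 -> is_lim_seq (Dpart t) (Dfun t).
Proof.
  intros Ht. apply Lim_seq_correct'.
  exists (/ pw 2 t * (cos (PI * t / 2) * sech_mellin (1 - t))).
  pose proof (pw_pos 2 t).
  apply (is_lim_seq_ext (fun n => / pw 2 t * (pw 2 t * Dpart t n))); [intros; field; lra|].
  apply is_lim_seq_mult'; [apply is_lim_seq_const|]. apply Dpart_lim_boundary, Ht.
Qed.

(** Both sides evaluate the Mellin transform of the kernel at t: the boundary limit taken at 1 - t,
    and the geometric expansion at t. The factor 4 is the 2 of the expansion times the 2 left by
    2^-(1-t) 2^-t = 1/2. *)
Lemma functional_equation t : 0 < t < 1 ->
  Dfun (1 - t) = 4 * pw (8 * PI) t * sin (PI * t / 2) * GI t * Dfun t.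
Proof.
  intros Ht. pose proof PI_RGT_0 as HP.
  pose proof (Dpart_lim_boundary (1 - t) ltac:(lra)) as H1.
  replace (1 - (1 - t)) with t in H1 by ring.
  pose proof (sech_mellin_lim t ltac:(lra)) as H2.
  pose proof (is_lim_seq_mult' _ _ _ _ (is_lim_seq_const (pw 2 (1 - t))) (Dfun_lim (1 - t) ltac:(lra))) as H3.
  pose proof (is_lim_seq_mult' _ _ _ _ (is_lim_seq_const (2 * (pw (4 * PI) t * GI t))) (Dfun_lim t Ht)) as H4.
  apply is_lim_seq_unique in H1. apply is_lim_seq_unique in H2.
  apply is_lim_seq_unique in H3. apply is_lim_seq_unique in H4.
  rewrite H1 in H3. rewrite H2 in H4. injection H3 as H3. injection H4 as H4.
  rewrite H4 in H3.
  replace (cos (PI * (1 - t) / 2)) with (sin (PI * t / 2)) in H3.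
  2: { rewrite <- cos_shift. f_equal. field. }
  assert (E1 : pw 2 (1 - t) * pw 2 t = / 2).
  { unfold pw. rewrite <- exp_plus. replace (- ((1 - t) * ln 2) + - (t * ln 2)) with (- ln 2) by ring.
    rewrite exp_Ropp, exp_ln; lra. }
  replace (8 * PI) with (2 * (4 * PI)) by ring. rewrite pw_mult by lra.
  pose proof (pw_pos 2 t) as P. pose proof (pw_pos 2 (1 - t)) as P'.
  apply Rmult_eq_reg_l with (pw 2 (1 - t)); [|lra].
  rewrite <- H3.
  replace (pw 2 (1 - t) * (4 * (pw 2 t * pw (4 * PI) t) * sin (PI * t / 2) * GI t * Dfun t)) with
    (4 * (pw 2 (1 - t) * pw 2 t) * (pw (4 * PI) t * sin (PI * t / 2) * GI t * Dfun t)) by ring.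
  rewrite E1. field.
Qed.

Lemma cpower_half_step b y t : 0 < b -> 0 < t < 1 ->
  Cmod (cpower (b, y) (1 - RtoC t) - cpower (b + / 2, y)%R (1 - RtoC t)) <= pw b t.
Proof.
  intros Hb Ht. rewrite Cmod_sub_sym.
  replace (b + / 2, y)%R with ((b, y) + RtoC (/ 2))%C by (unfold Cplus, RtoC; simpl; f_equal; ring).
  assert (HR : forall u : R, 0 <= u <= 1 -> b <= Re ((b, y) + u * RtoC (/ 2))%C).
  { intros u Hu. rewrite re_plus, re_scal_l, re_RtoC. simpl. lra. }
  eapply Rle_trans.
  - apply (path_mvt (fun z => cpower z (1 - RtoC t)) (fun z => (1 - RtoC t) * cpower z (1 - RtoC t - 1))%C
      (b, y) (RtoC (/ 2)) (fun u => pw b t * u) (fun _ => pw b t)).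
    + intros u Hu. apply (Cdiff_cpower (1 - RtoC t)). specialize (HR u Hu). lra.
    + intros u _. auto_derive; trivial. ring.
    + intros u Hu. rewrite !Cmod_mult, Cmod_R, <- RtoC_minus, Cmod_R.
      rewrite (Rabs_right (/ 2)), (Rabs_right (1 - t)) by lra.
      assert (B := Cmod_cpower_bound ((b, y) + u * RtoC (/ 2))%C (RtoC (1 - t) - 1) b (conj Hb (HR u Hu))).
      unfold Cminus in B at 1 3 4. rewrite re_plus, im_plus, re_opp, im_opp, !re_RtoC, !im_RtoC in B.
      specialize (B ltac:(lra)).
      replace (0 + - 0) with 0 in B by ring. rewrite Rabs_R0, Rmult_0_r, exp_0, Rmult_1_r in B.
      replace ((1 - t + - (1)) * ln b) with (- (t * ln b)) in B by ring. fold (pw b t) in B.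
      pose proof (pw_pos b t).
      pose proof (Cmod_ge_0 (cpower ((b, y) + u * RtoC (/ 2))%C (RtoC (1 - t) - 1))). nra.
  - right. ring.
Qed.

(** For 0 < t < 1 each integral grows like n^(1-t). Their difference over a half step, the distance
    from 1/4 to 3/4, is governed by the derivative of z^(1-t) and is of size n^-t. *)
Lemma E_int_half_step_lim b t : 0 < b -> 0 < t < 1 ->
  Clim (fun n => E_int (INR n + b) (RtoC t) - E_int (INR n + (b + / 2)) (RtoC t))%C 0.
Proof.
  intros Hb Ht. destruct dominated_real_sech2 as [M0 HM0].
  apply (Clim_squeeze _ _ (fun n => PI / 2 * (2 * PI * M0) * pw (INR n + b) t)).
  - intros n. pose proof (pos_INR n) as Hn. set (c := INR n + b). assert (Hc : 0 < c) by (unfold c; lra).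
    replace (INR n + (b + / 2)) with (c + / 2) by (unfold c; ring).
    destruct (dominated_cpower_sech2 (1 - RtoC t) c Hc) as [M1 D1].
    destruct (dominated_cpower_sech2 (1 - RtoC t) (c + / 2) ltac:(lra)) as [M2 D2].
    replace (E_int c (RtoC t) - E_int (c + / 2) (RtoC t) - 0)%C
      with (RtoC (PI / 2) * (B_int c (1 - RtoC t) - B_int (c + / 2) (1 - RtoC t)))%C by (unfold E_int; ring).
    unfold B_int. rewrite <- (CII_minus _ _ _ _ D1 D2).
    rewrite Cmod_mult, Cmod_R, Rabs_right by (pose proof PI_RGT_0; lra).
    rewrite Rmult_assoc. apply Rmult_le_compat_l; [pose proof PI_RGT_0; lra|].
    rewrite (CII_ext _ (fun y => (cpower (c, y) (1 - RtoC t) - cpower (c + / 2, y)%R (1 - RtoC t)) * (sech y ^ 2)%R)%C)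
      by (intros; ring).
    assert (D : exists N, Cdominated (fun y => (cpower (c, y) (1 - RtoC t) - cpower (c + / 2, y)%R (1 - RtoC t)) * (sech y ^ 2)%R)%C N).
    { eexists. eapply Cdominated_ext; [|apply (Cdominated_plus _ _ _ _ D1 (Cdominated_scal _ _ (- (1))%C D2))].
      intros; cbv beta; ring. }
    destruct D as [N D].
    eapply Rle_trans; [apply (CII_weight_bound _ _ (pw c t) M0 N HM0 D)|].
    + intros y. apply cpower_half_step; trivial.
    + right. ring.
  - apply is_lim_seq_scal_0. apply pw_lim. lra.
Qed.

Lemma Rcpow_real x t : 0 < x -> Rcpow x (- RtoC t) = RtoC (pw x t).
Proof. intros Hx. rewrite Rcpow_cpower by trivial. apply cpower_real, Hx. Qed.

Lemma Csum_Dpart t n :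
  (Csum (fun k => Rcpow (INR k + 1 / 4) (- RtoC t)) n - Csum (fun k => Rcpow (INR k + 3 / 4) (- RtoC t)) n)%C
  = RtoC (Dpart t n).
Proof.
  induction n as [|n IH]; [unfold Dpart; simpl; ring|].
  pose proof (pos_INR n). unfold Dpart in *. simpl Csum. simpl Rsum.
  rewrite RtoC_plus, <- IH, RtoC_minus, <- !Rcpow_real by lra.
  replace (/ 4) with (1 / 4) by field. ring.
Qed.

Lemma zeta_difference t : 0 < t < 1 ->
  (zeta_fun (1 / 4) (RtoC t) - zeta_fun (3 / 4) (RtoC t))%C = RtoC (Dfun t).
Proof.
  intros Ht. assert (Hs : RtoC t <> RtoC 1) by (intros E; apply RtoC_inj in E; lra).
  apply (Clim_unique (fun n => RtoC (Dpart t (S n)))).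
  - apply (Clim_ext (fun n => (zeta_fun (1 / 4) t - zeta_fun (3 / 4) t) + - / (t - 1) *
       (E_int (INR n + 3 / 4) t - E_int (INR n + (3 / 4 + / 2)) t))%C).
    { intros n. rewrite <- Csum_Dpart, !zeta_partial_sum by (trivial; lra).
      replace (1 / 4 + / 2) with (3 / 4) by field. unfold Cdiv. ring. }
    set (X := (zeta_fun (1 / 4) t - zeta_fun (3 / 4) t)%C).
    replace (Clim _ X) with (Clim (fun n => X + - / (t - 1) *
       (E_int (INR n + 3 / 4) t - E_int (INR n + (3 / 4 + / 2)) t))%C (X + - / (t - 1) * 0)%C)
      by (f_equal; ring).
    apply Clim_plus; [apply Clim_const|]. apply Clim_scal, E_int_half_step_lim; lra.
  - apply (Clim_incr (fun n => RtoC (Dpart t n))).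
    pose proof (Dfun_lim t Ht) as L.
    apply (Clim_squeeze _ _ (fun n => Rabs (Dpart t n - Dfun t))).
    + intros n. rewrite <- RtoC_minus, Cmod_R. lra.
    + replace (Finite 0) with (Finite (Rabs (Dfun t - Dfun t))) by (rewrite Rminus_diag, Rabs_R0; trivial).
      apply (is_lim_seq_abs _ (Finite _)). apply is_lim_seq_minus'; [trivial|apply is_lim_seq_const].
Qed.

(** * Second-order expansions at the origin *)

(** x(x + 1) <= (x + 1/2)^2 bounds the middle power by a geometric mean, and the arithmetic mean
    dominates that. *)
Lemma pw_midpoint x t : 0 < x -> 0 <= t -> 2 * pw (x + / 2) t <= pw x t + pw (x + 1) t.
Proof.
  intros Hx Ht.
  assert (H : ln x + ln (x + 1) <= 2 * ln (x + / 2)).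
  { replace (2 * ln (x + / 2)) with (ln (x + / 2) + ln (x + / 2)) by ring.
    rewrite <- (ln_mult x (x + 1)), <- (ln_mult (x + / 2) (x + / 2)) by lra. apply ln_le; nra. }
  set (A := exp (- (t * (ln x / 2)))). set (B := exp (- (t * (ln (x + 1) / 2)))).
  assert (E1 : pw x t = A * A) by (unfold A, pw; rewrite <- exp_plus; f_equal; field).
  assert (E2 : pw (x + 1) t = B * B) by (unfold B, pw; rewrite <- exp_plus; f_equal; field).
  assert (E3 : pw (x + / 2) t <= A * B).
  { unfold A, B, pw. rewrite <- exp_plus. apply exp_incr. nra. }
  rewrite E1, E2. clearbody A B. pose proof (pow2_ge_0 (A - B)). nra.
Qed.

(* By convexity of [x^-t] the trapezoidal corrections make the partial sums monotone; at [t = 0] both bounds equal 1/2, so they also determine the slope there. *)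
Lemma Dfun_lower t n : 0 < t < 1 -> Dpart t n + / 2 * pw (INR n + / 4) t <= Dfun t.
Proof.
  intros Ht.
  apply (is_lim_seq_incr_compare (fun n => Dpart t n + / 2 * pw (INR n + / 4) t)).
  - replace (Finite (Dfun t)) with (Finite (Dfun t + / 2 * 0)) by (f_equal; ring).
    apply is_lim_seq_plus'; [apply Dfun_lim, Ht|]. apply is_lim_seq_mult'; [apply is_lim_seq_const|].
    apply pw_lim; lra.
  - intros k. pose proof (pos_INR k). unfold Dpart. simpl Rsum. rewrite S_INR.
    pose proof (pw_midpoint (INR k + / 4) t ltac:(lra) ltac:(lra)) as P.
    replace (INR k + / 4 + / 2) with (INR k + 3 / 4) in P by field.
    replace (INR k + / 4 + 1) with (INR k + 1 + / 4) in P by ring. lra.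
Qed.

Lemma Dfun_upper t n : 0 < t < 1 -> Dfun t <= Dpart t (S n) + / 2 * pw (INR n + 3 / 4) t.
Proof.
  intros Ht.
  apply (is_lim_seq_decr_compare (fun n => Dpart t (S n) + / 2 * pw (INR n + 3 / 4) t)).
  - replace (Finite (Dfun t)) with (Finite (Dfun t + / 2 * 0)) by (f_equal; ring).
    apply is_lim_seq_plus'.
    + apply (is_lim_seq_incr_1 (Dpart t)). apply Dfun_lim, Ht.
    + apply is_lim_seq_mult'; [apply is_lim_seq_const|]. apply pw_lim; lra.
  - intros k. pose proof (pos_INR k). unfold Dpart.
    change (Rsum (fun k0 => pw (INR k0 + / 4) t - pw (INR k0 + 3 / 4) t) (S (S k))) with
      (Rsum (fun k0 => pw (INR k0 + / 4) t - pw (INR k0 + 3 / 4) t) (S k) + (pw (INR (S k) + / 4) t - pw (INR (S k) + 3 / 4) t)).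
    rewrite S_INR.
    pose proof (pw_midpoint (INR k + 3 / 4) t ltac:(lra) ltac:(lra)) as P.
    replace (INR k + 3 / 4 + / 2) with (INR k + 1 + / 4) in P by field.
    replace (INR k + 3 / 4 + 1) with (INR k + 1 + 3 / 4) in P by ring. lra.
Qed.

(** It allows D(t) to be cancelled after the functional equation has been applied at t and at 1 -
    t. *)
Lemma Dfun_pos t : 0 < t < 1 -> 0 < Dfun t.
Proof.
  intros Ht. pose proof (Dfun_lower t 0 Ht) as H. unfold Dpart in H. simpl in H.
  pose proof (pw_pos (0 + / 4) t). lra.
Qed.

Lemma reflection t : 0 < t < 1 -> sin (PI * t) * GI t * GI (1 - t) = PI.
Proof.
  intros Ht. pose proof PI_RGT_0 as HP.
  pose proof (functional_equation t Ht) as H1.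
  pose proof (functional_equation (1 - t) ltac:(lra)) as H2.
  replace (1 - (1 - t)) with t in H2 by ring.
  pose proof (Dfun_pos t Ht) as P.
  replace (sin (PI * (1 - t) / 2)) with (cos (PI * t / 2)) in H2.
  2: { rewrite <- sin_shift. f_equal. field. }
  assert (E1 : pw (8 * PI) (1 - t) * pw (8 * PI) t = / (8 * PI)).
  { unfold pw. rewrite <- exp_plus.
    replace (- ((1 - t) * ln (8 * PI)) + - (t * ln (8 * PI))) with (- ln (8 * PI)) by ring.
    rewrite exp_Ropp, exp_ln; lra. }
  rewrite H1 in H2.
  assert (E2 : sin (PI * t) = 2 * sin (PI * t / 2) * cos (PI * t / 2)).
  { rewrite <- sin_2a. f_equal. field. }
  rewrite E2.
  assert (E3 : 1 = 16 * (pw (8 * PI) (1 - t) * pw (8 * PI) t) * (cos (PI * t / 2) * sin (PI * t / 2) * GI t * GI (1 - t))).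
  { apply Rmult_eq_reg_r with (Dfun t); [|lra]. rewrite Rmult_1_l. rewrite H2 at 1. ring. }
  rewrite E1 in E3.
  apply (f_equal (Rmult PI)) in E3. rewrite Rmult_1_r in E3. rewrite E3 at 3. field. lra.
Qed.

(* Second-order expansion as [t] decreases to 0; the value of [f] at 0 plays no role. *)
Definition Jet (f : R -> R) (a b c : R) : Prop :=
  exists K r, 0 < r <= 1 /\ 0 <= K /\
    forall t, 0 < t < r -> Rabs (f t - (a + b * t + c * t ^ 2)) <= K * t ^ 3.

Lemma Jet_ext f g a b c r : 0 < r -> (forall t, 0 < t < r -> f t = g t) -> Jet f a b c -> Jet g a b c.
Proof.
  intros Hr E [K [q [Hq [HK H]]]]. exists K, (Rmin q r).
  pose proof (Rmin_l q r). pose proof (Rmin_r q r).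
  split; [split; [apply Rmin_pos; lra|lra]|]. split; trivial. intros t Ht. rewrite <- E by lra. apply H; lra.
Qed.

Lemma Jet_mult f g a b c a' b' c' : Jet f a b c -> Jet g a' b' c' ->
  Jet (fun t => f t * g t) (a * a') (a * b' + b * a') (a * c' + b * b' + c * a').
Proof.
  intros [K [r [Hr [HK H]]]] [K' [r' [Hr' [HK' H']]]].
  set (A := Rabs a + Rabs b + Rabs c). set (A' := Rabs a' + Rabs b' + Rabs c').
  pose proof (Rabs_pos a). pose proof (Rabs_pos b). pose proof (Rabs_pos c).
  pose proof (Rabs_pos a'). pose proof (Rabs_pos b'). pose proof (Rabs_pos c').
  exists (K * (A' + K') + A * K' + (Rabs (b * c' + c * b') + Rabs (c * c'))), (Rmin r r').
  pose proof (Rmin_l r r'). pose proof (Rmin_r r r').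
  pose proof (Rabs_pos (b * c' + c * b')). pose proof (Rabs_pos (c * c')).
  split; [split; [apply Rmin_pos; lra|lra]|].
  split.
  { assert (0 <= K * (A' + K')) by (apply Rmult_le_pos; unfold A'; lra).
    assert (0 <= A * K') by (apply Rmult_le_pos; unfold A; lra). lra. }
  intros t Ht. specialize (H t ltac:(lra)). specialize (H' t ltac:(lra)).
  set (p := a + b * t + c * t ^ 2) in *. set (q := a' + b' * t + c' * t ^ 2) in *.
  assert (T2 : 0 <= t ^ 2 <= 1) by (simpl; nra).
  assert (T3 : 0 <= t ^ 3 <= 1) by (simpl; nra).
  assert (BP : forall x y z, Rabs (x + y * t + z * t ^ 2) <= Rabs x + Rabs y + Rabs z).
  { intros x y z. eapply Rle_trans; [apply Rabs_triang|].
    eapply Rle_trans; [apply Rplus_le_compat_r, Rabs_triang|].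
    rewrite !Rabs_mult, (Rabs_right t), (Rabs_right (t ^ 2)) by lra.
    pose proof (Rabs_pos y). pose proof (Rabs_pos z). nra. }
  assert (Hp : Rabs p <= A) by apply BP. assert (Hq : Rabs q <= A') by apply BP.
  (* The error of f times g, then the polynomial p times the error of g, then the terms of degree 3
     and 4 of p q; t < 1 lowers degree 4 to degree 3. *)
  replace (f t * g t - (a * a' + (a * b' + b * a') * t + (a * c' + b * b' + c * a') * t ^ 2))
    with ((f t - p) * (q + (g t - q)) + p * (g t - q) + ((b * c' + c * b') + c * c' * t) * t ^ 3)
    by (unfold p, q; ring).
  eapply Rle_trans; [apply Rabs_triang|].
  eapply Rle_trans; [apply Rplus_le_compat_r, Rabs_triang|].
  rewrite !Rabs_mult, (Rabs_right (t ^ 3)) by lra.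
  assert (Hg : Rabs (q + (g t - q)) <= A' + K').
  { eapply Rle_trans; [apply Rabs_triang|]. apply Rplus_le_compat; trivial.
    eapply Rle_trans; [apply H'|]. rewrite <- (Rmult_1_r K') at 2. apply Rmult_le_compat_l; lra. }
  assert (HX3 : Rabs (b * c' + c * b' + c * c' * t) <= Rabs (b * c' + c * b') + Rabs (c * c')).
  { eapply Rle_trans; [apply Rabs_triang|]. apply Rplus_le_compat_l.
    rewrite Rabs_mult, (Rabs_right t) by lra. pose proof (Rabs_pos (c * c')). nra. }
  rewrite (Rmult_plus_distr_r (K * (A' + K') + A * K')), (Rmult_plus_distr_r (K * (A' + K'))).
  apply Rplus_le_compat; [apply Rplus_le_compat|].
  - replace (K * (A' + K') * t ^ 3) with (K * t ^ 3 * (A' + K')) by ring.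
    apply Rmult_le_compat; trivial; apply Rabs_pos.
  - replace (A * K' * t ^ 3) with (A * (K' * t ^ 3)) by ring.
    apply Rmult_le_compat; trivial; apply Rabs_pos.
  - rewrite <- (Rabs_mult c c'). apply Rmult_le_compat_r; [apply T3|exact HX3].
Qed.

Lemma small_const a K r : 0 < r -> (forall t, 0 < t < r -> Rabs a <= K * t) -> a = 0.
Proof.
  intros Hr H. destruct (Req_dec a 0) as [|Ha]; trivial. exfalso.
  apply Rabs_pos_lt in Ha.
  set (t := Rmin (r / 2) (Rabs a / (2 * (Rabs K + 1)))).
  pose proof (Rabs_pos K) as K0. pose proof (Rle_abs K) as K1.
  assert (Ht : 0 < t) by (apply Rmin_pos; [lra|apply Rdiv_lt_0_compat; lra]).
  assert (Ht1 : t <= r / 2) by apply Rmin_l.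
  assert (Ht2 : t * (2 * (Rabs K + 1)) <= Rabs a).
  { apply Rle_trans with (Rabs a / (2 * (Rabs K + 1)) * (2 * (Rabs K + 1))).
    - apply Rmult_le_compat_r; [lra|apply Rmin_r].
    - right. field. lra. }
  specialize (H t ltac:(lra)). nra.
Qed.

Lemma poly_small a b c K r : 0 < r <= 1 -> 0 <= K ->
  (forall t, 0 < t < r -> Rabs (a + b * t + c * t ^ 2) <= K * t ^ 3) -> a = 0 /\ b = 0 /\ c = 0.
Proof.
  intros Hr HK H.
  pose proof (Rabs_pos a). pose proof (Rabs_pos b). pose proof (Rabs_pos c).
  assert (D : forall x y, Rabs x <= Rabs (x + y) + Rabs y).
  { intros x y. replace x with ((x + y) + - y) at 1 by ring.
    eapply Rle_trans; [apply Rabs_triang|]. rewrite Rabs_Ropp. lra. }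
  assert (Ha : a = 0).
  { apply (small_const a (K + Rabs b + Rabs c) r); [lra|]. intros t Ht. specialize (H t Ht).
    rewrite Rplus_assoc in H. pose proof (D a (b * t + c * t ^ 2)) as D1.
    pose proof (Rabs_triang (b * t) (c * t ^ 2)) as D2. rewrite !Rabs_mult in D2.
    rewrite (Rabs_right t), (Rabs_right (t ^ 2)) in D2 by (simpl; nra).
    assert (t ^ 2 <= t) by (simpl; nra). assert (t ^ 3 <= t) by (simpl; nra). nra. }
  subst a.
  assert (Hb : b = 0).
  { apply (small_const b (K + Rabs c) r); [lra|]. intros t Ht. specialize (H t Ht).
    replace (0 + b * t + c * t ^ 2) with (t * (b + c * t)) in H by ring.
    rewrite Rabs_mult, (Rabs_right t) in H by lra.
    pose proof (D b (c * t)) as D1. rewrite Rabs_mult, (Rabs_right t) in D1 by lra.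
    assert (Rabs (b + c * t) <= K * t ^ 2).
    { apply Rmult_le_reg_l with t; [lra|]. simpl in *. lra. }
    assert (t ^ 2 <= t) by (simpl; nra). nra. }
  subst b. split; [trivial|split; [trivial|]].
  apply (small_const c K r); [lra|]. intros t Ht. specialize (H t Ht).
  replace (0 + 0 * t + c * t ^ 2) with (t ^ 2 * c) in H by ring.
  assert (0 < t ^ 2) by (simpl; nra).
  rewrite Rabs_mult, (Rabs_right (t ^ 2)) in H by lra.
  apply Rmult_le_reg_l with (t ^ 2); trivial. simpl in *. lra.
Qed.

Lemma Jet_unique f a b c a' b' c' : Jet f a b c -> Jet f a' b' c' -> a = a' /\ b = b' /\ c = c'.
Proof.
  intros [K [r [Hr [HK H]]]] [K' [r' [Hr' [HK' H']]]].
  pose proof (Rmin_l r r'). pose proof (Rmin_r r r').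
  destruct (poly_small (a - a') (b - b') (c - c') (K + K') (Rmin r r')) as [E1 [E2 E3]].
  - split; [apply Rmin_pos; lra|lra].
  - lra.
  - intros t Ht. specialize (H t ltac:(lra)). specialize (H' t ltac:(lra)).
    replace (a - a' + (b - b') * t + (c - c') * t ^ 2) with
      ((f t - (a' + b' * t + c' * t ^ 2)) + - (f t - (a + b * t + c * t ^ 2))) by ring.
    eapply Rle_trans; [apply Rabs_triang|]. rewrite Rabs_Ropp. lra.
  - lra.
Qed.

Lemma Jet_const a : Jet (fun _ => a) a 0 0.
Proof.
  exists 0, 1. split; [lra|]. split; [lra|]. intros t _.
  replace (a - (a + 0 * t + 0 * t ^ 2)) with 0 by ring. rewrite Rabs_R0. lra.
Qed.

Lemma Jet_pw x : Jet (pw x) 1 (- ln x) (ln x ^ 2 / 2).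
Proof.
  set (L := ln x).
  exists (Rabs L ^ 3 / 6 * exp (Rabs L)), 1. split; [lra|].
  assert (P : 0 <= Rabs L ^ 3) by (apply pow_le, Rabs_pos). pose proof (exp_pos (Rabs L)).
  split; [nra|]. intros t Ht.
  pose proof (exp_remainder_3 (- (t * L))) as H1. rewrite Rabs_Ropp, Rabs_mult, (Rabs_right t) in H1 by lra.
  unfold pw. fold L.
  replace (1 + - L * t + L ^ 2 / 2 * t ^ 2) with (1 + - (t * L) + (- (t * L)) ^ 2 / 2) by field.
  eapply Rle_trans; [apply H1|]. rewrite Rpow_mult_distr.
  pose proof (Rabs_pos L).
  assert (exp (t * Rabs L) <= exp (Rabs L)) by (apply exp_incr; nra).
  assert (T : 0 <= t ^ 3) by (apply pow_le; lra).
  replace (t ^ 3 * Rabs L ^ 3 / 6 * exp (t * Rabs L)) with ((t ^ 3 * Rabs L ^ 3 / 6) * exp (t * Rabs L)) by ring.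
  replace (Rabs L ^ 3 / 6 * exp (Rabs L) * t ^ 3) with ((t ^ 3 * Rabs L ^ 3 / 6) * exp (Rabs L)) by field.
  apply Rmult_le_compat_l; trivial. assert (0 <= t ^ 3 * Rabs L ^ 3) by (apply Rmult_le_pos; trivial). lra.
Qed.

Lemma Jet_GI_plus : Jet (fun t => GI (1 + t)) 1 gamma1 gamma2.
Proof.
  destruct GI_jet as [K [HK H]]. exists K, (/ 4). split; [lra|]. split; trivial.
  intros t Ht. specialize (H t). rewrite Rabs_right in H by lra. apply H. lra.
Qed.

Lemma Jet_GI_minus : Jet (fun t => GI (1 - t)) 1 (- gamma1) gamma2.
Proof.
  destruct GI_jet as [K [HK H]]. exists K, (/ 4). split; [lra|]. split; trivial.
  intros t Ht. specialize (H (- t)). rewrite Rabs_Ropp, Rabs_right in H by lra.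
  replace (1 - t) with (1 + - t) by ring.
  replace (1 + - gamma1 * t + gamma2 * t ^ 2) with (1 + gamma1 * - t + gamma2 * (- t) ^ 2) by ring.
  apply H. lra.
Qed.

(** Division by t absorbs the pole of Gamma at 0, since sin(ct) Gamma(t) = (sin(ct)/t) Gamma(1 +
    t). *)
Lemma Jet_sin c : 0 < c -> Jet (fun t => sin (c * t) / t) c 0 (- (c ^ 3 / 6)).
Proof.
  intros Hc. assert (Hi : 0 < / c) by (apply Rinv_0_lt_compat; trivial).
  pose proof (Rmin_l 1 (/ c)). pose proof (Rmin_r 1 (/ c)).
  assert (C5 : 0 < c ^ 5) by (apply pow_lt; trivial).
  exists (c ^ 5 / 120), (Rmin 1 (/ c)). split; [split; [apply Rmin_pos; lra|lra]|]. split; [lra|].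
  intros t Ht. set (u := c * t).
  assert (Hu0 : 0 <= u) by (unfold u; nra).
  assert (Hu1 : u <= 1).
  { unfold u. apply Rmult_le_reg_l with (/ c); trivial. rewrite <- Rmult_assoc, Rinv_l by lra. lra. }
  assert (Hu4 : u <= 4) by lra.
  destruct (pre_sin_bound u 0 Hu0 Hu4) as [B1 B2].
  unfold sin_approx in B1, B2. simpl in B1, B2. unfold sin_term in B1, B2. simpl in B1, B2.
  assert (L : u - u ^ 3 / 6 <= sin u) by (eapply Rle_trans; [|apply B1]; right; field).
  assert (U : sin u <= u - u ^ 3 / 6 + u ^ 5 / 120) by (eapply Rle_trans; [apply B2|]; right; field).
  assert (E : sin u / t - (c + 0 * t + - (c ^ 3 / 6) * t ^ 2) = (sin u - (u - u ^ 3 / 6)) / t).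
  { unfold u. field. lra. }
  rewrite E. unfold Rdiv at 1. rewrite Rabs_mult, Rabs_inv, (Rabs_right t) by lra.
  rewrite Rabs_right by lra.
  apply Rmult_le_reg_r with t; [lra|]. rewrite Rmult_assoc, Rinv_l, Rmult_1_r by lra.
  assert (E5 : u ^ 5 / 120 = c ^ 5 / 120 * t ^ 3 * t * t) by (unfold u; field).
  assert (T3 : 0 <= t ^ 3) by (apply pow_le; lra).
  assert (Q : 0 <= c ^ 5 / 120 * t ^ 3 * t) by (repeat apply Rmult_le_pos; lra).
  nra.
Qed.

(** The coefficient of t^2 in (sin(pi t)/t) Gamma(1 + t) Gamma(1 - t) = pi gives pi (2 gamma2 -
    gamma1^2) - pi^3/6 = 0. *)
Lemma gamma2_value : gamma2 = (gamma1 ^ 2 + PI ^ 2 / 6) / 2.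
Proof.
  pose proof PI_RGT_0 as HP.
  pose proof (Jet_mult _ _ _ _ _ _ _ _ (Jet_mult _ _ _ _ _ _ _ _ (Jet_sin PI HP) Jet_GI_plus) Jet_GI_minus) as J.
  apply (Jet_ext _ (fun _ => PI) _ _ _ 1 Rlt_0_1) in J.
  2: { intros t Ht. rewrite (Rplus_comm 1 t), GI_rec by lra.
       rewrite <- (reflection t Ht) at 2. field. lra. }
  destruct (Jet_unique _ _ _ _ _ _ _ J (Jet_const PI)) as [_ [_ E]].
  apply Rmult_eq_reg_l with (2 * PI); [|lra]. 
  replace (2 * PI * ((gamma1 ^ 2 + PI ^ 2 / 6) / 2)) with (PI * gamma1 ^ 2 + PI ^ 3 / 6) by field. lra.
Qed.

Lemma Jet_FE_factor L : L = ln (8 * PI) ->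
  Jet (fun t => 4 * pw (8 * PI) t * (sin (PI * t / 2) / t) * GI (1 + t))
    (2 * PI) (2 * PI * (gamma1 - L)) (2 * PI * (gamma2 - L * gamma1 + L ^ 2 / 2 - PI ^ 2 / 24)).
Proof.
  intros HL. pose proof PI_RGT_0 as HP.
  pose proof (Jet_mult _ _ _ _ _ _ _ _ (Jet_mult _ _ _ _ _ _ _ _ (Jet_mult _ _ _ _ _ _ _ _ (Jet_const 4) (Jet_pw (8 * PI)))
     (Jet_sin (PI / 2) ltac:(lra))) Jet_GI_plus) as J.
  rewrite <- HL in J.
  apply (Jet_ext _ (fun t => 4 * pw (8 * PI) t * (sin (PI * t / 2) / t) * GI (1 + t)) _ _ _ 1 Rlt_0_1) in J.
  2: { intros t Ht. replace (PI / 2 * t) with (PI * t / 2) by field. reflexivity. }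
  match type of J with Jet _ ?a ?b ?c =>
    replace (2 * PI) with a at 1 by field;
    replace (2 * PI * (gamma1 - L)) with b by field;
    replace (2 * PI * (gamma2 - L * gamma1 + L ^ 2 / 2 - PI ^ 2 / 24)) with c by field end.
  exact J.
Qed.

Lemma Cpseries_Re_part a (x l : R) : Cpseries a (RtoC x) (RtoC l) ->
  Cpseries (fun k => RtoC (Re (a k))) (RtoC x) (RtoC l).
Proof.
  intros H. apply Cpseries_Clim. apply Cpseries_Clim in H.
  assert (E : forall n, Cpsum (fun k => RtoC (Re (a k))) (RtoC x) n = RtoC (Re (Cpsum a (RtoC x) n))).
  { intros n. unfold Cpsum. induction n as [|n IH]; cbn [Csum]; [trivial|].
    rewrite IH, re_plus, <- !RtoC_pow, re_scal_r, RtoC_plus, RtoC_mult. reflexivity. }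
  apply (Clim_squeeze _ _ (fun n => Cmod (Cpsum a (RtoC x) n - RtoC l))); [|exact H].
  intros n. rewrite E, <- RtoC_minus, Cmod_R.
  eapply Rle_trans; [|apply re_le_Cmod]. right. f_equal.
Qed.

(** The real parts of the coefficients give the same real values on (0, r), so uniqueness makes the
    coefficients real. After two divisions by t the sum is Lipschitz at 0, which is the cubic
    error. *)
Lemma Cpseries_jet a (f : R -> R) r : 0 < r ->
  (forall t, 0 < t < r -> Cpseries a (RtoC t) (RtoC (f t))) ->
  (forall k, a k = RtoC (Re (a k))) /\ Jet f (Re (a 0%nat)) (Re (a 1%nat)) (Re (a 2%nat)).
Proof.
  intros Hr H.
  assert (HR : forall k, a k = RtoC (Re (a k))).
  { apply (Cpseries_real_unique a (fun k => RtoC (Re (a k))) (fun t => RtoC (f t)) r Hr H).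
    intros t Ht. apply Cpseries_Re_part, H, Ht. }
  split; trivial.
  assert (D : forall t, 0 < t < r ->
     Cpseries (fun k => a (S (S k))) (RtoC t) (((RtoC (f t) - a 0%nat) / t - a 1%nat) / t)%C).
  { intros t Ht. assert (T : RtoC t <> RtoC 0) by (apply RtoC_neq_0; lra).
    apply (Cpseries_decr (fun k => a (S k))); trivial. apply Cpseries_decr; trivial. apply H, Ht. }
  destruct (Cpseries_first_order _ (r / 2) _ ltac:(lra) (D (r / 2) ltac:(lra))) as [K [HK HB]].
  pose proof (Rmin_l 1 (r / 4)). pose proof (Rmin_r 1 (r / 4)).
  exists K, (Rmin 1 (r / 4)). split; [split; [apply Rmin_pos; lra|lra]|]. split; trivial.
  intros t Ht. assert (T : RtoC t <> RtoC 0) by (apply RtoC_neq_0; lra).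
  specialize (HB (RtoC t) _ ltac:(rewrite Cmod_R, Rabs_right; lra) (D t ltac:(lra))).
  rewrite Cmod_R, (Rabs_right t) in HB by lra.
  assert (E : RtoC (f t - (Re (a 0%nat) + Re (a 1%nat) * t + Re (a 2%nat) * t ^ 2)) =
    (RtoC (t ^ 2) * (((RtoC (f t) - a 0%nat) / t - a 1%nat) / t - a 2%nat))%C).
  { rewrite (HR 0%nat), (HR 1%nat), (HR 2%nat), !re_RtoC.
    rewrite RtoC_minus, !RtoC_plus, !RtoC_mult, !RtoC_pow. field. trivial. }
  rewrite <- Cmod_R, E, Cmod_mult, Cmod_R, Rabs_right by (simpl; nra).
  replace (K * t ^ 3) with (t ^ 2 * (K * t)) by ring.
  apply Rmult_le_compat_l; [simpl; nra|exact HB].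
Qed.

(** Multiplication by t turns the values at 0 into slopes of functions that vanish there, so
    [derive_le_of_right] applies. *)
Lemma le_at_0_of_right (f g : R -> R) (p q d : R) : 0 < d -> is_derive f 0 p -> is_derive g 0 q ->
  (forall t, 0 < t < d -> f t <= g t) -> f 0 <= g 0.
Proof.
  intros Hd Hf Hg H.
  assert (M : forall (h : R -> R) (l : R), is_derive h 0 l -> is_derive (fun t => t * h t) 0 (h 0)).
  { intros h l Hh.
    replace (h 0) with (1 * h 0 + 0 * l) by ring.
    apply (is_derive_mult (K := R_AbsRing) (fun t => t) h 0 1 l); [|exact Hh|intros; apply Rmult_comm].
    apply (is_derive_id (K := R_AbsRing)). }
  apply (derive_le_of_right (fun t => t * f t) (fun t => t * g t) _ _ d Hd (M f p Hf) (M g q Hg)).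
  - rewrite !Rmult_0_l. trivial.
  - intros t Ht. apply Rmult_le_compat_l; [lra|auto].
Qed.

Lemma cubic_derive_0 a b c k : is_derive (fun t => a + b * t + c * t ^ 2 + k * t ^ 3) 0 b.
Proof. auto_derive; trivial. ring. Qed.

(** The jet is replaced by its cubic majorant, which is differentiable at 0 with slope [b]; slopes
    can be compared only where the values at 0 agree. *)
Lemma Jet_lower f a b c (h : R -> R) (p r : R) : Jet f a b c -> 0 < r -> is_derive h 0 p ->
  (forall t, 0 < t < r -> h t <= f t) -> h 0 <= a /\ (h 0 = a -> p <= b).
Proof.
  intros [K [q [Hq [HK H]]]] Hr Hh Hle.
  assert (B : forall t, 0 < t < Rmin q r -> h t <= a + b * t + c * t ^ 2 + K * t ^ 3).
  { intros t Ht. pose proof (Rmin_l q r). pose proof (Rmin_r q r).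
    specialize (H t ltac:(lra)). specialize (Hle t ltac:(lra)). apply Rabs_le_between in H. lra. }
  assert (M : 0 < Rmin q r) by (apply Rmin_pos; lra).
  split.
  - pose proof (le_at_0_of_right h _ _ _ _ M Hh (cubic_derive_0 a b c K) B) as V. cbv beta in V. simpl in V. lra.
  - intros E. apply (derive_le_of_right h _ _ _ _ M Hh (cubic_derive_0 a b c K)); [rewrite E; simpl; ring|exact B].
Qed.

Lemma Jet_upper f a b c (h : R -> R) (p r : R) : Jet f a b c -> 0 < r -> is_derive h 0 p ->
  (forall t, 0 < t < r -> f t <= h t) -> a <= h 0 /\ (h 0 = a -> b <= p).
Proof.
  intros [K [q [Hq [HK H]]]] Hr Hh Hle.
  assert (B : forall t, 0 < t < Rmin q r -> a + b * t + c * t ^ 2 + - K * t ^ 3 <= h t).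
  { intros t Ht. pose proof (Rmin_l q r). pose proof (Rmin_r q r).
    specialize (H t ltac:(lra)). specialize (Hle t ltac:(lra)). apply Rabs_le_between in H. lra. }
  assert (M : 0 < Rmin q r) by (apply Rmin_pos; lra).
  split.
  - pose proof (le_at_0_of_right _ h _ _ _ M (cubic_derive_0 a b c (- K)) Hh B) as V. cbv beta in V. simpl in V. lra.
  - intros E. apply (derive_le_of_right _ h _ _ _ M (cubic_derive_0 a b c (- K)) Hh); [rewrite E; simpl; ring|exact B].
Qed.

Lemma pw_derive x : is_derive (pw x) 0 (- ln x).
Proof. unfold pw. auto_derive; trivial. rewrite Rmult_0_l, Ropp_0, exp_0. ring. Qed.

Lemma Dpart_derive n : is_derive (fun t => Dpart t n) 0 (lnsum (3 / 4) n - lnsum (/ 4) n).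
Proof.
  induction n as [|n IH].
  - replace (lnsum (3 / 4) 0 - lnsum (/ 4) 0) with 0 by (simpl; ring).
    exact (is_derive_const (V := R_NormedModule) 0 0).
  - replace (lnsum (3 / 4) (S n) - lnsum (/ 4) (S n)) with
      ((lnsum (3 / 4) n - lnsum (/ 4) n) + (- ln (INR n + / 4) - - ln (INR n + 3 / 4))) by (simpl; ring).
    apply (is_derive_plus (V := R_NormedModule) (fun t => Dpart t n) (fun t => pw (INR n + / 4) t - pw (INR n + 3 / 4) t)); trivial.
    apply (is_derive_minus (V := R_NormedModule)); apply pw_derive.
Qed.

Lemma pw_0 x : pw x 0 = 1.
Proof. unfold pw. rewrite Rmult_0_l, Ropp_0. apply exp_0. Qed.

Lemma Dpart_0 n : Dpart 0 n = 0.
Proof. induction n as [|n IH]; [reflexivity|]. unfold Dpart in *. simpl. rewrite IH, !pw_0. ring. Qed.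

Lemma Dpart_bound_derive n m c : is_derive (fun t => Dpart t n + / 2 * pw (INR m + c) t) 0
  (lnsum (3 / 4) n - lnsum (/ 4) n - / 2 * ln (INR m + c)).
Proof.
  replace (lnsum (3 / 4) n - lnsum (/ 4) n - / 2 * ln (INR m + c)) with
    (lnsum (3 / 4) n - lnsum (/ 4) n + / 2 * - ln (INR m + c)) by ring.
  apply (is_derive_plus (V := R_NormedModule) (fun t => Dpart t n)); [apply Dpart_derive|].
  apply is_derive_scal, pw_derive.
Qed.

(** By [GI_ln] the slope of each bracket is ln Gamma(1/4) - ln Gamma(3/4) plus ln Gamma(N + 3/4) -
    ln Gamma(N + 1/4) minus half a logarithm, with N = n below and N = n + 1 above. A half step of
    [ln_GI_interpolation] in each direction squeezes that correction to 0. *)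
Lemma Dfun_jet_values a b c : Jet Dfun a b c -> a = / 2 /\ b = ln (GI (/ 4)) - ln (GI (3 / 4)).
Proof.
  intros J.
  assert (Lo := fun n => Jet_lower Dfun a b c _ _ 1 J Rlt_0_1 (Dpart_bound_derive n n (/ 4)) (fun t Ht => Dfun_lower t n Ht)).
  assert (Up := fun n => Jet_upper Dfun a b c _ _ 1 J Rlt_0_1 (Dpart_bound_derive (S n) n (3 / 4)) (fun t Ht => Dfun_upper t n Ht)).
  cbv beta in Lo, Up.
  assert (V : forall n m x, Dpart 0 n + / 2 * pw (INR m + x) 0 = / 2) by (intros; rewrite Dpart_0, pw_0; ring).
  assert (Ea : a = / 2).
  { destruct (Lo 0%nat) as [h1 _]. destruct (Up 0%nat) as [h2 _]. rewrite V in h1, h2. lra. }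
  split; trivial. subst a.
  assert (Lo' : forall n, lnsum (3 / 4) n - lnsum (/ 4) n - / 2 * ln (INR n + / 4) <= b) by (intros n; apply Lo, V).
  assert (Up' : forall n, b <= lnsum (3 / 4) (S n) - lnsum (/ 4) (S n) - / 2 * ln (INR n + 3 / 4)) by (intros n; apply Up, V).
  set (La := ln (GI (/ 4)) - ln (GI (3 / 4))).
  assert (EL : forall n, lnsum (3 / 4) n - lnsum (/ 4) n = La + (ln (GI (INR n + 3 / 4)) - ln (GI (INR n + / 4)))).
  { intros n. rewrite !GI_ln by lra. unfold La. ring. }
  assert (B1 : forall n, ln (GI (INR n + 3 / 4)) - ln (GI (INR n + / 4)) <= / 2 * ln (INR n + / 4)).
  { intros n. pose proof (pos_INR n).
    pose proof (ln_GI_interpolation (INR n + / 4) (/ 2) ltac:(lra) ltac:(lra)) as H0.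
    replace (INR n + / 4 + / 2) with (INR n + 3 / 4) in H0 by field. lra. }
  assert (B2 : forall n, ln (INR n + / 4) - / 2 * ln (INR n + 3 / 4) <= ln (GI (INR n + 3 / 4)) - ln (GI (INR n + / 4))).
  { intros n. pose proof (pos_INR n).
    pose proof (ln_GI_interpolation (INR n + 3 / 4) (/ 2) ltac:(lra) ltac:(lra)) as H0.
    replace (INR n + 3 / 4 + / 2) with (INR n + / 4 + 1) in H0 by field.
    rewrite GI_rec, ln_mult in H0 by (try apply GI_pos; lra). lra. }
  apply Rle_antisym.
  - apply (is_lim_seq_le (fun _ => b) (fun n => La + / 2 * (ln (INR n + 5 / 4) - ln (INR n + 3 / 4))) (Finite b) (Finite La)).
    + intros n. specialize (Up' n). rewrite EL in Up'. specialize (B1 (S n)).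
      rewrite S_INR in *. replace (INR n + 1 + / 4) with (INR n + 5 / 4) in * by field. lra.
    + apply is_lim_seq_const.
    + replace (Finite La) with (Finite (La + / 2 * 0)) by (f_equal; ring).
      apply is_lim_seq_plus'; [apply is_lim_seq_const|]. apply is_lim_seq_mult'; [apply is_lim_seq_const|].
      apply ln_ratio_lim; lra.
  - apply (is_lim_seq_le (fun n => La + / 2 * (ln (INR n + / 4) - ln (INR n + 3 / 4))) (fun _ => b) (Finite La) (Finite b)).
    + intros n. specialize (Lo' n). rewrite EL in Lo'. specialize (B2 n). lra.
    + replace (Finite La) with (Finite (La + / 2 * 0)) by (f_equal; ring).
      apply is_lim_seq_plus'; [apply is_lim_seq_const|]. apply is_lim_seq_mult'; [apply is_lim_seq_const|].
      apply ln_ratio_lim; lra.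
    + apply is_lim_seq_const.
Qed.

Lemma ln_GI_3_4 : ln (GI (3 / 4)) = ln PI + / 2 * ln 2 - ln (GI (/ 4)).
Proof.
  pose proof PI_RGT_0 as HP. pose proof (reflection (/ 4) ltac:(lra)) as H.
  replace (1 - / 4) with (3 / 4) in H by field. replace (PI * / 4) with (PI / 4) in H by field.
  rewrite sin_PI4 in H.
  assert (S2 : 0 < sqrt 2) by (apply sqrt_lt_R0; lra).
  pose proof (GI_pos (/ 4) ltac:(lra)) as G1. pose proof (GI_pos (3 / 4) ltac:(lra)) as G2.
  assert (E : GI (/ 4) * GI (3 / 4) = PI * sqrt 2).
  { rewrite <- H. field. lra. }
  apply (f_equal ln) in E. rewrite !ln_mult in E by lra.
  assert (E2 : ln 2 = 2 * ln (sqrt 2)).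
  { rewrite <- (sqrt_sqrt 2) at 1 by lra. rewrite ln_mult by trivial. ring. }
  lra.
Qed.

(** * Comparison of the coefficients of t^2 *)

Lemma zeta_fun_pseries_0 u : 0 < u -> exists a, forall w, Cmod w < 1 -> Cpseries a w (zeta_fun u w).
Proof.
  intros Hu. destruct (entire_zeta_num u Hu 0) as [e He].
  assert (Hd : (0 - 1)%C <> RtoC 0) by (apply Cminus_eq_contra; intros E; apply RtoC_inj in E; lra).
  exists (div_coef e (0 - 1)). intros w Hw.
  assert (Hw' : Cmod w < Cmod (0 - 1)) by (rewrite <- RtoC_minus, Cmod_R, Rabs_left; lra).
  pose proof (Cpseries_div e _ _ Hd He w Hw') as H. cbv beta in H.
  replace (0 + w)%C with w in H by ring. replace (w + (0 - 1))%C with (w - 1)%C in H by ring. exact H.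
Qed.

Theorem mainTheorem2 :
  (stieltjes 2 (1 / 4) - stieltjes 2 (3 / 4) =
   RtoC (2 * PI) * (hurwitz_zeta'' (RtoC 0) (1 / 4) - hurwitz_zeta'' (RtoC 0) (3 / 4))
   - RtoC (4 * PI * (euler_gamma + ln (8 * PI))
           * (2 * ln (Gamma (1 / 4)) - ln PI - 1 / 2 * ln 2))
   + RtoC (PI / 2 * (2 * (euler_gamma + ln (8 * PI)) ^ 2 + PI ^ 2 / 6)))%C.
Proof.
  assert (U1 : 0 < 1 / 4) by lra. assert (U2 : 0 < 3 / 4) by lra. pose proof PI_RGT_0 as HP.
  destruct (zeta_fun_pseries_0 _ U1) as [a Ha]. destruct (zeta_fun_pseries_0 _ U2) as [a' Ha'].
  destruct (entire_zeta_num _ U1 1) as [e He]. destruct (entire_zeta_num _ U2 1) as [e' He'].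
  rewrite (hurwitz_zeta''_coef _ a U1 Ha), (hurwitz_zeta''_coef _ a' U2 Ha').
  rewrite (stieltjes_coef _ e 2 U1 He), (stieltjes_coef _ e' 2 U2 He').
  destruct (Cpseries_jet (fun k => a k - a' k)%C Dfun 1 Rlt_0_1) as [R0 J0].
  { intros t Ht. rewrite <- zeta_difference by trivial.
    apply Cpseries_minus; [apply Ha|apply Ha']; rewrite Cmod_R, Rabs_right; lra. }
  (* Expansion at s = 1 - t: the equal residues cancel in the difference, division by -t raises the
     index by one, and (-1)^k comes from (-t)^k. *)
  destruct (Cpseries_jet (fun k => RtoC (-1) ^ k * (e (S k) - e' (S k)))%C (fun t => Dfun (1 - t)) 1 Rlt_0_1) as [R1 J1].
  { intros t Ht. rewrite <- zeta_difference by lra.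
    assert (T : RtoC t <> RtoC 0) by (apply RtoC_neq_0; lra).
    assert (T' : (- RtoC t)%C <> RtoC 0).
    { rewrite <- RtoC_opp. apply RtoC_neq_0; lra. }
    assert (H0 : e 0%nat = e' 0%nat).
    { transitivity (RtoC 1).
      - apply (Cpseries_unique e 0); [apply Cpseries_0|]. specialize (He 0).
        replace (1 + 0)%C with (RtoC 1) in He by ring. rewrite zeta_num_1 in He; trivial.
      - apply (Cpseries_unique e' 0); [|apply Cpseries_0]. specialize (He' 0).
        replace (1 + 0)%C with (RtoC 1) in He' by ring. rewrite zeta_num_1 in He'; trivial. }
    pose proof (Cpseries_decr _ _ _ T' (Cpseries_minus _ _ _ _ _ (He (- RtoC t)%C) (He' (- RtoC t)%C))) as D.
    cbv beta in D. rewrite H0 in D.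
    replace (zeta_fun (1 / 4) (RtoC (1 - t)) - zeta_fun (3 / 4) (RtoC (1 - t)))%C with
      ((zeta_num (1 / 4) (1 + - t) - zeta_num (3 / 4) (1 + - t) - (e' 0%nat - e' 0%nat)) / - t)%C.
    2: { unfold zeta_fun. replace (RtoC (1 - t)) with (1 + - RtoC t)%C by (rewrite RtoC_minus; ring).
         field. split; [|exact T]. intros E. apply T'. rewrite <- E. ring. }
    apply Cpseries_Clim. apply Cpseries_Clim in D. eapply Clim_ext; [|exact D].
    intros n. apply Csum_ext. intros k.
    replace (- RtoC t)%C with (RtoC (-1) * RtoC t)%C.
    2: { rewrite <- RtoC_mult, <- RtoC_opp. f_equal. ring. }
    rewrite Cpow_mult_l. ring. }
  destruct (Dfun_jet_values _ _ _ J0) as [V0 V1].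
  pose proof (Jet_mult _ _ _ _ _ _ _ _ (Jet_FE_factor _ eq_refl) J0) as JM.
  apply (Jet_ext _ (fun t => Dfun (1 - t)) _ _ _ 1 Rlt_0_1) in JM.
  2: { intros t Ht. rewrite functional_equation by trivial.
       rewrite (Rplus_comm 1 t), GI_rec by lra. field. lra. }
  (* Only the t^2 coefficients are kept; the left one is half the difference of the second Stieltjes
     constants, by [stieltjes_coef]. *)
  destruct (Jet_unique _ _ _ _ _ _ _ J1 JM) as [_ [_ E]].
  cbv beta in *.
  rewrite V0, V1, ln_GI_3_4, gamma2_value, gamma1_euler in E.
  rewrite Gamma_GI by lra. replace (1 / 4) with (/ 4) by field.
  pose proof (R0 2%nat) as Q0. pose proof (R1 2%nat) as Q1. cbv beta in Q0, Q1.
  transitivity (2 * (RtoC (-1) ^ 2 * (e 3%nat - e' 3%nat)))%C.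
  { replace (INR (fact 2)) with 2 by (simpl; ring). ring. }
  rewrite Q1, E.
  transitivity (RtoC (2 * PI) * (2 * (a 2%nat - a' 2%nat))
   - RtoC (4 * PI * (euler_gamma + ln (8 * PI)) * (2 * ln (GI (/ 4)) - ln PI - 1 / 2 * ln 2))
   + RtoC (PI / 2 * (2 * (euler_gamma + ln (8 * PI)) ^ 2 + PI ^ 2 / 6)))%C; [|ring].
  rewrite Q0, re_RtoC. set (d2 := Re (a 2%nat - a' 2%nat)%C).
  rewrite <- !RtoC_mult, <- RtoC_minus, <- RtoC_plus. f_equal. field.
Qed.
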